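(* There exists a function $\epsilon:[0,\infty)\to[0,\infty)$, independent of $n$, with $\lim_{\delta\to 0}\epsilon(\delta)=0$, that satisfies the following property. If $X,H\in M_n(\mathbb{C})$ are self-adjoint contractions, then there are commuting self-adjoint $X'',H''\in M_n(\mathbb{C})$ with $$\|X''-X\|,\ \|H''-H\|\le\epsilon(\|[X,H]\|),$$ where $X'',H''$ can be chosen with additional structure if $X,H$ have additional structure as in one of the following cases: - Case $\{\mathcal{W}_\alpha,\mathcal{T}_\beta\}$: Suppose that $\{\mathcal{W}_\alpha\}_\alpha$ is a family of unitaries on $\mathbb{C}^n$ and $\{\mathcal{T}_\beta\}_\beta$ is a family of anti-unitaries on $\mathbb{C}^n$ (either family may be empty) such that each $\mathcal{T}_\beta$ commutes with all the maps in $\{\mathcal{W}_\alpha\}_\alpha$ and $\{\mathcal{T}_\beta\}_\beta$ up to a phase. Suppose that all the maps in $\{\mathcal{W}_\alpha\}_\alpha$, $\{\mathcal{T}_\beta\}_\beta$ commute with both $X$ and $H$. Then $X'',H''$ can be chosen to commute with all the $\mathcal{W}_\alpha,\mathcal{T}_\beta$ simultaneously. - Case $\mathcal{C}$: In addition to the assumptions of case $\{\mathcal{W}_\alpha,\mathcal{T}_\beta\}$, let $\mathcal{C}$ be an anti-unitary map on $\mathbb{C}^n$ that commutes with each of the $\mathcal{W}_\alpha,\mathcal{T}_\beta$ up to a phase. If $\mathcal{C}$ commutes with $X$ and anti-commutes with $H$, then $X'',H''$ can be chosen so that $\mathcal{C}$ commutes with $X''$ and anti-commutes with $H''$, in addition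 to $X'',H''$ commuting with all the $\mathcal{W}_\alpha,\mathcal{T}_\beta$. - Case $\mathcal{S}$: In addition to the assumptions of case $\{\mathcal{W}_\alpha,\mathcal{T}_\beta\}$, let $\mathcal{S}$ be a unitary map on $\mathbb{C}^n$ that commutes with each of the $\mathcal{W}_\alpha,\mathcal{T}_\beta$ up to a phase. If $\mathcal{S}$ commutes with $X$ and anti-commutes with $H$, then $X'',H''$ can be chosen so that $\mathcal{S}$ commutes with $X''$ and anti-commutes with $H''$, in addition to $X'',H''$ commuting with all the $\mathcal{W}_\alpha,\mathcal{T}_\beta$.
   Context: $\|\cdot\|$ is the operator norm, $[X,H]=XH-HX$, a contraction is a matrix of norm at most $1$. An anti-unitary map on a Hilbert space is an invertible conjugate-linear map $U$ with $\langle Uv,Uw\rangle=\overline{\langle v,w\rangle}$ for all $v,w$. Two (unitary or anti-unitary) maps $U,V$ commute up to a phase if $UV=\zeta VU$ for some $\zeta\in\mathbb{C}$ with $|\zeta|=1$. A map $\mathcal{C}$ commutes (resp. anti-commutes) with $A$ if $\mathcal{C}A=A\mathcal{C}$ (resp. $\mathcal{C}A=-A\mathcal{C}$) as maps on $\mathbb{C}^n$. *)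

(* Defs.v *)
From mathcomp Require Import all_boot all_order all_algebra.
From mathcomp Require Import complex.
From mathcomp Require Import boolp classical_sets reals topology normedtype.

Set Implicit Arguments.
Unset Strict Implicit.
Unset Printing Implicit Defensive.

Import Order.TTheory GRing.Theory Num.Theory.
Import numFieldNormedType.Exports.

Local Open Scope ring_scope.
Local Open Scope classical_set_scope.
Local Open Scope sesquilinear_scope.

Section HilbertSpace.
Variables (R : realType) (n : nat).
Local Notation C := R[i].
Implicit Types (v w : 'cV[C]_n) (A X H : 'M[C]_n) (U V : 'cV[C]_n -> 'cV[C]_n).

(* Conjugate-linear in the first argument. *)
Definition inner v w : C := (v^t* *m w) 0 0.

Definition l2norm v : R := Num.sqrt (complex.Re (inner v v)).

(* The norm that MathComp-Analysis puts on matrices is the entrywise sup norm,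
   so the operator norm is defined here. *)
Definition opnorm A : R :=
  sup [set l2norm (A *m v) | v in [set v | l2norm v <= 1]].

Definition contraction_mx A := opnorm A <= 1.

Definition mx_commutator X H : 'M[C]_n := X *m H - H *m X.

Definition antiunitary U :=
  [/\ bijective U,
      forall v w, U (v + w) = U v + U w,
      forall (c : C) v, U (c *: v) = c^* *: U v
    & forall v w, inner (U v) (U w) = (inner v w)^*].

Definition commute_up_to_phase U V :=
  exists zeta : C, `|zeta| = 1 /\ forall v, U (V v) = zeta *: V (U v).

Definition commutes_with U A := forall v, U (A *m v) = A *m U v.

Definition anticommutes_with U A := forall v, U (A *m v) = - (A *m U v).

Section Families.
Variables (I J : Type) (W : I -> 'M[C]_n) (T : J -> 'cV[C]_n -> 'cV[C]_n).

Definition symmetry_families :=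
  [/\ forall a, W a \is unitarymx,
      forall b, antiunitary (T b),
      forall b a, commute_up_to_phase (T b) (mulmx (W a))
    & forall b b', commute_up_to_phase (T b) (T b')].

Definition families_commute_with A :=
  (forall a, commutes_with (mulmx (W a)) A) /\
  (forall b, commutes_with (T b) A).

Definition commutes_with_families_up_to_phase U :=
  (forall a, commute_up_to_phase U (mulmx (W a))) /\
  (forall b, commute_up_to_phase U (T b)).

End Families.

Definition commuting_approximants (e : R) X H X2 H2 :=
  [/\ X2 \is hermsymmx, H2 \is hermsymmx, comm_mx X2 H2,
      opnorm (X2 - X) <= e & opnorm (H2 - H) <= e].

End HilbertSpace.

(* Submission.v *)
Require Import Defs.
From HB Require Import structures.
From mathcomp Require Import all_boot all_order all_algebra.
From mathcomp Require Import complex.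
From mathcomp Require Import boolp classical_sets reals topology normedtype.
From mathcomp Require Import ring lra.

Set Implicit Arguments.
Unset Strict Implicit.
Unset Printing Implicit Defensive.

Import Order.TTheory GRing.Theory Num.Theory.
Import numFieldNormedType.Exports.
Import Normc.

Local Open Scope ring_scope.
Local Open Scope classical_set_scope.
Local Open Scope sesquilinear_scope.

(** The proof makes Lin's theorem natural: X'' and H'' are obtained from X and H by operations
    that every symmetry respects.

    A unitary W acts on matrices by A |-> W A W^*, and an anti-unitary by
    A |-> U conj(A) U^* for a unitary matrix U. Both are real *-automorphisms
    ([unitary_automorphism], [antiunitary_automorphism]), and commuting with a matrix means
    fixing it. A real *-automorphism respects sums, products, adjoints and the
    functional calculus of hermitian matrices ([ra_fcalc]). Therefore, if X'' and H'' are
    built from X and H by such operations only, they keep all the symmetries of the pair;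
    and if in addition replacing H by - H leaves X'' alone and changes the sign of H'',
    then anti-commutation with H is kept as well.

    It remains to prove Lin's theorem with such a construction, following the idea of Friis
    and Rordam. If it failed for some distance e, there would be hermitian contractions
    X_j, H_j of arbitrary sizes with commutators tending to 0 and without approximation at
    distance e. In the ring of bounded sequences of matrices modulo null sequences
    ([asymp]) their classes x and h commute. The construction is carried out with the
    matrices, and is verified with the classes. The functional calculus of a continuous
    function passes from matrices to classes as far as commutation is concerned, because of an
    inequality about square roots that does not depend on the size ([sqrt_intertwine],
    [good_root]).

    Puncture. Fix a finite square grid of points with mesh r. For a grid point p, write
    X + iH - p = V T with T positive, and add V (rho - T)_+ to X + iH. In the quotient this
    pushes the spectrum of the normal element x + ih out of a disc around p, and the pushes
    at different points do not interfere. Afterwards F(h) G(x) = 0 whenever F and G live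
    close to the coordinates of a grid point ([punctured]).

    Cuts. Fix a vertical grid line. A continuous approximation of the sign of x minus its
    abscissa gives an element u with u^2 + q^2 = 1, where q lives near the line. The spectrum
    of x + ih near the line is cut by the grid points into bands, and the spectral
    projections chi of h for the bands are honest projections against q. On the band chi the
    discontinuous function sign u commutes with h: indeed
    1 - 2 q chi q + i (u q chi + chi q u) is unitary, with angle twice that of u + iq, and
    the half-angle formulas for an exactly unitary representative give sign u - u as the
    sign of a sine times a function of the cosine ([jump_algebra]). Correcting u on every band
    yields a symmetry S with S^2 = 1 that is equal to u away from the line and that commutes
    with a staircase function of h which is constant on the bands
    ([cut_sqr], [cut_comm]).

    Rounding. The projections (1 + S)/2 of the different lines are nested. Their sum has
    integer values in the quotient ([nested_sum_roots]), and rounding it to exact integers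
    gives X'', while H'' is the pinching of the staircase of H by the spectral projections
    of X''. These commute exactly. The distance from X'' to the staircase of X is
    the norm of a sum of terms of norm at most r that live near different grid lines, hence at
    most r for any number of lines ([opnorm_orth_sum]). As r is arbitrary, this contradicts
    the choice of the sequence. *)

(** * The operator norm *)

Section OperatorNorm.
Variables (R : realType).
Local Notation C := R[i].
Local Notation "x %:C" := (real_complex R x).

Lemma adjmxM m n p (A : 'M[C]_(m, n)) (B : 'M[C]_(n, p)) :
  (A *m B)^t* = B^t* *m A^t*.
Proof. by rewrite trmx_mul map_mxM. Qed.

Lemma adjmxD m n (A B : 'M[C]_(m, n)) : (A + B)^t* = A^t* + B^t*.
Proof. by rewrite linearD map_mxD. Qed.

Lemma adjmxZ m n (c : C) (A : 'M[C]_(m, n)) : (c *: A)^t* = c^* *: A^t*.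
Proof. by rewrite linearZ map_mxZ. Qed.

Lemma adjmxN m n (A : 'M[C]_(m, n)) : (- A)^t* = - A^t*.
Proof. by rewrite linearN map_mxN. Qed.

Lemma adjmxB m n (A B : 'M[C]_(m, n)) : (A - B)^t* = A^t* - B^t*.
Proof. by rewrite adjmxD adjmxN. Qed.

Lemma adjmx1 n : (1%:M : 'M[C]_n)^t* = 1%:M.
Proof. by rewrite trmx1 map_mx1. Qed.

Lemma adjmx0 m n : (0 : 'M[C]_(m, n))^t* = 0.
Proof. by rewrite trmx0 map_mx0. Qed.

Section Vectors.
Variable n : nat.
Implicit Types (v w : 'cV[C]_n) (A : 'M[C]_n).

Lemma innerDl v w x : inner (v + w) x = inner v x + inner w x.
Proof. by rewrite /inner adjmxD mulmxDl mxE. Qed.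

Lemma innerDr v w x : inner x (v + w) = inner x v + inner x w.
Proof. by rewrite /inner mulmxDr mxE. Qed.

Lemma innerZl (c : C) v w : inner (c *: v) w = c^* * inner v w.
Proof. by rewrite /inner adjmxZ -scalemxAl mxE. Qed.

Lemma innerZr (c : C) v w : inner v (c *: w) = c * inner v w.
Proof. by rewrite /inner -scalemxAr mxE. Qed.

Lemma inner0l v : inner 0 v = 0 :> C.
Proof. by rewrite /inner adjmx0 mul0mx mxE. Qed.

Lemma innerNl v w : inner (- v) w = - inner v w.
Proof. by rewrite /inner adjmxN mulNmx mxE. Qed.

Lemma innerNr v w : inner v (- w) = - inner v w.
Proof. by rewrite /inner mulmxN mxE. Qed.

Lemma inner_adj A v w : inner (A *m v) w = inner v (A^t* *m w).
Proof. by rewrite /inner adjmxM mulmxA. Qed.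

Lemma inner_conj v w : (inner v w)^* = inner w v.
Proof.
by rewrite /inner !mxE rmorph_sum; apply: eq_bigr => i _; rewrite !mxE rmorphM /= conjCK mulrC.
Qed.

Lemma inner_sum v : inner v v = (\sum_i (complex.Re (v i 0) ^+ 2 + complex.Im (v i 0) ^+ 2))%:C.
Proof.
rewrite /inner !mxE rmorph_sum; apply: eq_bigr => i _; rewrite !mxE.
by rewrite /= add_Re2_Im2 mulrC -normCK.
Qed.

Lemma l2norm_ge0 v : 0 <= l2norm v.
Proof. exact: sqrtr_ge0. Qed.

Lemma inner_l2 v : inner v v = (l2norm v ^+ 2)%:C.
Proof.
rewrite /l2norm sqr_sqrtr inner_sum //=.
by apply: sumr_ge0 => i _; rewrite addr_ge0 ?sqr_ge0.
Qed.

Lemma l2norm_sqr v : l2norm v ^+ 2 = complex.Re (inner v v).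
Proof. by rewrite inner_l2. Qed.

Lemma l2norm_eq0 v : l2norm v = 0 -> v = 0.
Proof.
move=> h; have := inner_sum v; rewrite inner_l2 h expr0n /= => /eqP.
rewrite eq_sym (fmorph_eq0 (real_complex R)) psumr_eq0; last first.
  by move=> i _; rewrite addr_ge0 ?sqr_ge0.
move=> /allP h2; apply/matrixP => i j; rewrite ord1 mxE.
have := h2 i (mem_index_enum i); rewrite /= paddr_eq0 ?sqr_ge0 // !sqrf_eq0.
by case: (v i 0) => a b /= /andP[/eqP -> /eqP ->].
Qed.

Lemma l2norm0 : l2norm (0 : 'cV[C]_n) = 0.
Proof. by rewrite /l2norm inner0l sqrtr0. Qed.

Lemma ReD (x y : C) : complex.Re (x + y) = complex.Re x + complex.Re y.
Proof. by case: x; case: y. Qed.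
Lemma ReZ (a : R) (x : C) : complex.Re (a%:C * x) = a * complex.Re x.
Proof. by case: x => x y /=; rewrite mul0r subr0. Qed.
Lemma conjRe (x : C) : complex.Re (x^*) = complex.Re x.
Proof. by case: x. Qed.
Lemma conjR (a : R) : (a%:C)^* = a%:C.
Proof. exact: conjc_real. Qed.

Lemma l2normB_sqr v w (a b : R) : l2norm (a%:C *: v + b%:C *: w) ^+ 2 =
   a ^+ 2 * l2norm v ^+ 2 + b ^+ 2 * l2norm w ^+ 2 + 2 * a * b * complex.Re (inner v w).
Proof.
rewrite l2norm_sqr !(innerDl, innerDr, innerZl, innerZr) !conjR !(ReD, ReZ).
by rewrite -(inner_conj v w) conjRe -!l2norm_sqr; ring.
Qed.

Lemma cauchy_schwarz v w : complex.Re (inner v w) <= l2norm v * l2norm w.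
Proof.
set x := l2norm v; set y := l2norm w.
have x0 : 0 <= x := l2norm_ge0 _; have y0 : 0 <= y := l2norm_ge0 _.
have [xe|xn] := eqVneq x 0; first by rewrite (l2norm_eq0 xe) inner0l xe mul0r.
have [ye|yn] := eqVneq y 0.
  by rewrite (l2norm_eq0 ye) -inner_conj inner0l conjC0 ye mulr0.
have := sqr_ge0 (l2norm (y%:C *: v + (- x)%:C *: w)); rewrite l2normB_sqr -/x -/y.
have xp : 0 < x by rewrite lt_def xn. have yp : 0 < y by rewrite lt_def yn.
have xy : 0 < x * y by apply: mulr_gt0.
set t := complex.Re _ => h; have : 0 <= (x * y) * (x * y - t) by nra.
by rewrite pmulr_rge0 // subr_ge0.
Qed.

Lemma l2normD v w : l2norm (v + w) <= l2norm v + l2norm w.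
Proof.
rewrite -(@ler_pXn2r _ 2) ?nnegrE ?addr_ge0 ?l2norm_ge0 //.
have := l2normB_sqr v w 1 1; rewrite !rmorph1 !scale1r => ->.
by have := cauchy_schwarz v w; nra.
Qed.

Lemma l2normZ (c : C) v : l2norm (c *: v) = normc c * l2norm v.
Proof.
apply/eqP; rewrite -(@eqrXn2 _ 2) ?mulr_ge0 ?l2norm_ge0 //; last by case: c => a b; exact: sqrtr_ge0.
apply/eqP; apply: complexI; rewrite -inner_l2 innerZl innerZr inner_l2 mulrA.
have -> : c^* * c = (normc c ^+ 2)%:C.
  by rewrite mulrC -normCK normc_def; case: c => a b /=; rewrite rmorphXn.
by rewrite -rmorphM /= exprMn.
Qed.

Lemma l2normN v : l2norm (- v) = l2norm v.
Proof. by rewrite /l2norm innerNl innerNr opprK. Qed.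

Lemma l2norm_coord v i : normc (v i 0) <= l2norm v.
Proof.
rewrite /normc /l2norm inner_sum /= (bigD1 i) //=.
case: (v i 0) => a b /=; rewrite ler_sqrt ?addr_ge0 ?sqr_ge0 ?lerDl //;
  last by apply: sumr_ge0 => j _; rewrite addr_ge0 ?sqr_ge0.
by apply: sumr_ge0 => j _; rewrite addr_ge0 ?sqr_ge0.
Qed.

Lemma normc_ge0 (c : C) : 0 <= normc c.
Proof. by case: c => a b; exact: sqrtr_ge0. Qed.

Lemma l2norm_sum (I : Type) (r : seq I) (P : pred I) (F : I -> 'cV[C]_n) :
  l2norm (\sum_(i <- r | P i) F i) <= \sum_(i <- r | P i) l2norm (F i).
Proof.
apply: (big_ind2 (fun v (x : R) => l2norm v <= x)); first by rewrite l2norm0.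
  by move=> v x w y hv hw; apply: le_trans (l2normD _ _) (lerD hv hw).
by [].
Qed.

Lemma inner_delta (A : 'M[C]_n) i j : inner (delta_mx i 0) (A *m delta_mx j 0) = A i j.
Proof. by rewrite /inner -colE trmx_delta map_delta_mx -rowE !mxE. Qed.

End Vectors.

Section Matrices.
Variable n : nat.
Implicit Types (v w : 'cV[C]_n) (A B : 'M[C]_n).

Lemma mulmx_bounded A : exists M, forall v, l2norm (A *m v) <= M * l2norm v.
Proof.
exists (\sum_j l2norm (col j A)) => v.
have -> : A *m v = \sum_j v j 0 *: col j A.
  apply/matrixP => i k; rewrite ord1 !mxE summxE; apply: eq_bigr => j _.
  by rewrite !mxE mulrC.
apply: le_trans (l2norm_sum _ _ _) _; rewrite mulr_suml; apply: ler_sum => j _.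
by rewrite l2normZ mulrC ler_wpM2l ?l2norm_ge0 ?l2norm_coord.
Qed.

Lemma opnorm_has_sup A :
  has_sup [set l2norm (A *m v) | v in [set v | l2norm v <= 1]].
Proof.
split; first by exists (l2norm (A *m 0)), 0 => //=; rewrite l2norm0.
have [M hM] := mulmx_bounded A; exists (Num.max 0 M) => _ [v /= hv <-].
apply: le_trans (hM v) _; have := l2norm_ge0 v.
have [M0|M0] := lerP 0 M => v0.
  by rewrite -{2}(mulr1 M) ler_wpM2l.
by rewrite mulr_le0_ge0 // ltW.
Qed.

Lemma opnorm_ge0 A : 0 <= opnorm A.
Proof.
apply: le_trans (l2norm_ge0 (A *m 0)) _.
apply: sup_upper_bound (opnorm_has_sup A) _ _.
by exists 0 => //=; rewrite l2norm0.
Qed.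

Lemma opnormP A v : l2norm (A *m v) <= opnorm A * l2norm v.
Proof.
have [h|h] := eqVneq (l2norm v) 0.
  by rewrite (l2norm_eq0 h) mulmx0 !l2norm0 mulr0.
have hp : 0 < l2norm v by rewrite lt_def h l2norm_ge0.
have nV : normc (l2norm v)^-1%:C = (l2norm v)^-1.
  by rewrite /normc /= expr0n addr0 sqrtr_sqr ger0_norm // invr_ge0 ltW.
rewrite -ler_pdivrMr // mulrC -nV -l2normZ scalemxAr.
apply: sup_upper_bound (opnorm_has_sup A) _ _.
by exists ((l2norm v)^-1%:C *: v) => //=; rewrite l2normZ nV mulVf.
Qed.

Lemma opnorm_le A (M : R) : 0 <= M ->
  (forall v, l2norm (A *m v) <= M * l2norm v) -> opnorm A <= M.
Proof.
move=> M0 h; apply: ge_sup; first by case: (opnorm_has_sup A).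
move=> _ [v /= hv <-]; apply: le_trans (h v) _.
by rewrite -{2}(mulr1 M) ler_wpM2l.
Qed.

Lemma opnorm0 : opnorm (0 : 'M[C]_n) = 0.
Proof.
apply/eqP; rewrite eq_le opnorm_ge0 andbT; apply: opnorm_le => // v.
by rewrite mul0mx l2norm0 mul0r.
Qed.

Lemma opnormD A B : opnorm (A + B) <= opnorm A + opnorm B.
Proof.
apply: opnorm_le => [|v]; first by rewrite addr_ge0 ?opnorm_ge0.
by rewrite mulmxDl mulrDl; apply: le_trans (l2normD _ _) (lerD _ _); apply: opnormP.
Qed.

Lemma opnormM A B : opnorm (A *m B) <= opnorm A * opnorm B.
Proof.
apply: opnorm_le => [|v]; first by rewrite mulr_ge0 ?opnorm_ge0.
rewrite -mulmxA -mulrA; apply: le_trans (opnormP _ _) _.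
by rewrite ler_wpM2l ?opnorm_ge0 ?opnormP.
Qed.

Lemma opnormZ_le (c : C) A : opnorm (c *: A) <= normc c * opnorm A.
Proof.
apply: opnorm_le => [|v]; first by rewrite mulr_ge0 ?opnorm_ge0 ?normc_ge0.
by rewrite -scalemxAl l2normZ -mulrA ler_wpM2l ?normc_ge0 ?opnormP.
Qed.

Lemma opnormN A : opnorm (- A) = opnorm A.
Proof.
have le B : opnorm (- B) <= opnorm B.
  by apply: opnorm_le (opnorm_ge0 B) _ => v; rewrite mulNmx l2normN; exact: opnormP.
have h := le (- A); rewrite opprK in h.
by apply/eqP; rewrite eq_le; exact (introT andP (conj (le A) h)).
Qed.

Lemma opnormB A B : opnorm (A - B) <= opnorm A + opnorm B.
Proof. by rewrite -(opnormN B) opnormD. Qed.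

Lemma opnorm_scalar_le (c : C) : opnorm (c%:M : 'M[C]_n) <= normc c.
Proof.
by apply: opnorm_le => [|v]; rewrite ?normc_ge0 // mul_scalar_mx l2normZ.
Qed.

Lemma opnorm_adj_le A : opnorm (A^t*) <= opnorm A.
Proof.
apply: opnorm_le => [|v]; first exact: opnorm_ge0.
have [h|h] := eqVneq (l2norm (A^t* *m v)) 0.
  by rewrite h mulr_ge0 ?opnorm_ge0 ?l2norm_ge0.
have hp : 0 < l2norm (A^t* *m v) by rewrite lt_def h l2norm_ge0.
rewrite -(@ler_pM2l _ (l2norm (A^t* *m v))) // -expr2 l2norm_sqr inner_adj trmxCK.
apply: le_trans (cauchy_schwarz _ _) _.
rewrite [leRHS]mulrC -mulrA [leRHS]mulrCA ler_wpM2l ?l2norm_ge0 // opnormP //.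
Qed.

Lemma opnorm_adj A : opnorm (A^t*) = opnorm A.
Proof.
have h := opnorm_adj_le (A^t*); rewrite trmxCK in h.
by apply/eqP; rewrite eq_le; exact (introT andP (conj (opnorm_adj_le A) h)).
Qed.

Lemma opnorm_sum (I : Type) (r : seq I) (P : pred I) (F : I -> 'M[C]_n) :
  opnorm (\sum_(i <- r | P i) F i) <= \sum_(i <- r | P i) opnorm (F i).
Proof.
apply: (big_ind2 (fun A (x : R) => opnorm A <= x)); first by rewrite opnorm0.
  by move=> v x w y hv hw; apply: le_trans (opnormD _ _) (lerD hv hw).
by [].
Qed.

Lemma l2norm_isometry A v : A^t* *m A = 1%:M -> l2norm (A *m v) = l2norm v.
Proof. by move=> h; rewrite /l2norm inner_adj mulmxA h mul1mx. Qed.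

Lemma opnorm_isometry_le A : A^t* *m A = 1%:M -> opnorm A <= 1.
Proof. by move=> h; apply: opnorm_le => // v; rewrite mul1r l2norm_isometry. Qed.

End Matrices.
End OperatorNorm.

(** * Functional calculus of hermitian matrices *)

Section FunctionalCalculus.
Variables (R : realType).
Local Notation C := R[i].
Local Notation "x %:C" := (real_complex R x).

Lemma hermsymmxP n (A : 'M[C]_n) : reflect (A^t* = A) (A \is hermsymmx).
Proof.
apply: (iffP (is_hermitianmxP _ _ _)); rewrite expr0 scale1r; first by move=> {2}->.
by move=> {1}<-.
Qed.

Lemma interpolation (f : R -> R) (s : seq R) :
  exists p : {poly R}, forall x, x \in s -> p.[x] = f x.
Proof.
elim: s => [|a s [p hp]]; first by exists 0.
have [ain|an] := boolP (a \in s).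
  by exists p => x; rewrite inE => /predU1P[->|]; apply: hp.
pose q := \prod_(b <- s) ('X - b%:P).
have qa : q.[a] != 0.
  by rewrite -rootE root_prod_XsubC.
exists (p + ((f a - p.[a]) / q.[a]) *: q) => x; rewrite inE !hornerE => /predU1P[->|xs].
  by rewrite divfK // addrC subrK.
have -> : q.[x] = 0 by apply/eqP; rewrite -rootE root_prod_XsubC.
by rewrite mulr0 addr0 hp.
Qed.

Variable m : nat.
Local Notation n := m.+1.
Implicit Types (A B : 'M[C]_n) (f g : R -> R) (v : 'cV[C]_n) (p : {poly R}).

Lemma conj_mulmx (U D E : 'M[C]_n) : U *m U^t* = 1%:M ->
  (U^t* *m D *m U) *m (U^t* *m E *m U) = U^t* *m (D *m E) *m U.
Proof. by move=> hU; rewrite !mulmxA -(mulmxA _ U) hU mulmx1. Qed.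

Lemma conj_addmx (U D E : 'M[C]_n) :
  U^t* *m (D + E) *m U = U^t* *m D *m U + U^t* *m E *m U.
Proof. by rewrite mulmxDr mulmxDl. Qed.

Lemma conj_adjmx (U D : 'M[C]_n) : (U^t* *m D *m U)^t* = U^t* *m D^t* *m U.
Proof. by rewrite !adjmxM trmxCK mulmxA. Qed.

Definition unitary_diag (U : 'M[C]_n) (d : 'I_n -> R) : 'M[C]_n :=
  U^t* *m diag_mx (\row_i (d i)%:C) *m U.

Lemma eq_unitary_diag (U : 'M[C]_n) d e : d =1 e -> unitary_diag U d = unitary_diag U e.
Proof. by move=> /funext ->. Qed.

Lemma unitary_diagM (U : 'M[C]_n) d e : U *m U^t* = 1%:M ->
  unitary_diag U (d \* e) = unitary_diag U d *m unitary_diag U e.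
Proof.
move=> hU; rewrite /unitary_diag.
have -> : \row_i ((d \* e) i)%:C = \row_i ((\row_i (d i)%:C) 0 i * (\row_i (e i)%:C) 0 i).
  by apply/rowP => i; rewrite !mxE rmorphM.
by rewrite -mulmx_diag -conj_mulmx.
Qed.

Lemma unitary_diagD (U : 'M[C]_n) d e :
  unitary_diag U (d \+ e) = unitary_diag U d + unitary_diag U e.
Proof.
rewrite /unitary_diag.
have -> : \row_i ((d \+ e) i)%:C = \row_i (d i)%:C + \row_i (e i)%:C.
  by apply/rowP => i; rewrite !mxE rmorphD.
by rewrite linearD conj_addmx.
Qed.

Lemma unitary_diag_cst (U : 'M[C]_n) c : U^t* *m U = 1%:M ->
  unitary_diag U (fun=> c) = (c%:C)%:M.
Proof.
move=> hU; rewrite /unitary_diag (_ : diag_mx _ = (c%:C)%:M).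
  by rewrite mul_mx_scalar -scalemxAl hU scalemx1.
by apply/matrixP => i j; rewrite !mxE.
Qed.

Lemma unitary_diag_herm (U : 'M[C]_n) d : (unitary_diag U d)^t* = unitary_diag U d.
Proof.
have e : (diag_mx (\row_i (d i)%:C))^t* = diag_mx (\row_i (d i)%:C) :> 'M[C]_n.
  apply/matrixP => i j; rewrite !mxE rmorphMn /= conjR eq_sym.
  by case: eqP => [->|].
by apply: etrans (conj_adjmx _ _) _; rewrite e.
Qed.

Lemma unitary_diag_eigvec (U : 'M[C]_n) d i : U *m U^t* = 1%:M ->
  let v := U^t* *m delta_mx i 0 in
  l2norm v = 1 /\ unitary_diag U d *m v = (d i)%:C *: v.
Proof.
move=> hU /=; split.
  rewrite l2norm_isometry ?trmxCK // /l2norm inner_sum /= (bigD1 i) //= big1.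
    by rewrite !mxE !eqxx /= expr1n expr0n !addr0 sqrtr1.
  by move=> j /negPf ji; rewrite !mxE ji /= expr0n addr0.
rewrite /unitary_diag mulmxA -(mulmxA _ U) hU mulmx1 -mulmxA.
rewrite (_ : diag_mx _ *m delta_mx i 0 = (d i)%:C *: delta_mx i 0) -?scalemxAr //.
apply/matrixP => j k; rewrite mul_diag_mx !mxE.
by case: (eqVneq j i) => [->|_] //=; rewrite !mulr0.
Qed.

Lemma unitary_diag_norm (U : 'M[C]_n) d (M : R) : U *m U^t* = 1%:M -> 0 <= M ->
  (forall i, `|d i| <= M) -> opnorm (unitary_diag U d) <= M.
Proof.
move=> hU M0 h; apply: opnorm_le => // v; rewrite /unitary_diag -!mulmxA.
rewrite l2norm_isometry ?trmxCK //.
rewrite -[l2norm v](l2norm_isometry v (mulmx1C hU)).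
set w := U *m v; rewrite -(@ler_pXn2r _ 2) ?nnegrE ?mulr_ge0 ?l2norm_ge0 //.
rewrite exprMn; move: w => w; rewrite 2!l2norm_sqr 2!inner_sum /= mulr_sumr.
apply: ler_sum => i _; rewrite mul_diag_mx mxE [(\row__ _) _ _]mxE; case: (w i 0) => a b /=; rewrite !mul0r subr0 addr0.
rewrite !exprMn -mulrDr ler_wpM2r ?addr_ge0 ?sqr_ge0 //.
by rewrite -[leLHS]real_normK ?num_real // ler_pXn2r ?nnegrE.
Qed.

(** The eigenvalues of a hermitian matrix are real, so that taking real parts loses
    nothing for it. *)
Definition spec A (i : 'I_n) : R := complex.Re (spectral_diag A 0 i).

Definition fcalc f A : 'M[C]_n := unitary_diag (spectralmx A) (f \o spec A).

Definition in_spec A (x : R) := exists i, x = spec A i.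

Definition rhorner p A : 'M[C]_n := horner_mx A (map_poly (real_complex R) p).

Local Notation U A := (spectralmx A).

Lemma spectralmxK A : U A *m (U A)^t* = 1%:M.
Proof. exact/unitarymxP/spectral_unitarymx. Qed.

Lemma spectralmxKV A : (U A)^t* *m U A = 1%:M.
Proof. exact/mulmx1C/spectralmxK. Qed.

Lemma eq_fcalc A f g : (forall x, in_spec A x -> f x = g x) -> fcalc f A = fcalc g A.
Proof. by move=> h; apply: eq_unitary_diag => i /=; rewrite h //; exists i. Qed.

Lemma fcalcD A f g : fcalc (f \+ g) A = fcalc f A + fcalc g A.
Proof. exact: unitary_diagD. Qed.

Lemma fcalcM A f g : fcalc (f \* g) A = fcalc f A *m fcalc g A.
Proof. exact/unitary_diagM/spectralmxK. Qed.

Lemma fcalc_cst A (c : R) : fcalc (fun=> c) A = (c%:C)%:M.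
Proof. exact/unitary_diag_cst/spectralmxKV. Qed.

Lemma fcalcZ A (c : R) f : fcalc (fun x => c * f x) A = c%:C *: fcalc f A.
Proof. by rewrite (fcalcM A (fun=> c) f) fcalc_cst mul_scalar_mx. Qed.

Lemma fcalcN A f : fcalc (fun x => - f x) A = - fcalc f A.
Proof.
rewrite -scaleN1r -(rmorphN1 (real_complex R)) -fcalcZ.
by apply: eq_fcalc => x _; rewrite mulN1r.
Qed.

Lemma fcalcB A f g : fcalc (fun x => f x - g x) A = fcalc f A - fcalc g A.
Proof. by rewrite (fcalcD A f (fun x => - g x)) fcalcN. Qed.

Lemma fcalc_sum (I : Type) (r : seq I) (F : I -> R -> R) A :
  fcalc (fun x => \sum_(i <- r) F i x) A = \sum_(i <- r) fcalc (F i) A.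
Proof.
elim: r => [|i r ih].
  rewrite big_nil (@eq_fcalc A _ (fun=> 0)) ?fcalc_cst ?rmorph0 ?scalemx1 ?raddf0 // => x _.
  by rewrite big_nil.
rewrite big_cons -ih -fcalcD; apply: eq_fcalc => x _; by rewrite big_cons.
Qed.

Lemma fcalc_herm A f : (fcalc f A)^t* = fcalc f A.
Proof. exact: unitary_diag_herm. Qed.

Lemma fcalc_id A : A^t* = A -> fcalc id A = A.
Proof.
move=> hA; have /hermsymmxP hA2 := hA.
have := orthomx_spectralP (hermitian_normalmx hA2).
have := hermitian_spectral_diag_real hA2; rewrite /fcalc /spec invmx_unitary ?spectral_unitarymx // /unitary_diag.
move: (spectralmx A) (spectral_diag A) => U d /mxOverP dR ->.
have -> : \row_i ((id \o (fun i => complex.Re (d 0 i))) i)%:C = d.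
  by apply/rowP => i; rewrite !mxE RRe_real.
by [].
Qed.

Lemma fcalc_comm A f g : fcalc f A *m fcalc g A = fcalc g A *m fcalc f A.
Proof.
rewrite -fcalcM -fcalcM; apply: eq_fcalc => x _; exact: mulrC.
Qed.

Lemma spec_eigvec A x f : in_spec A x ->
  exists v, l2norm v = 1 /\ fcalc f A *m v = (f x)%:C *: v.
Proof.
move=> [i ->]; have [] := unitary_diag_eigvec (f \o spec A) i (spectralmxK A).
by exists ((U A)^t* *m delta_mx i 0).
Qed.

Lemma fcalc_norm A f (M : R) : 0 <= M -> (forall x, in_spec A x -> `|f x| <= M) ->
  opnorm (fcalc f A) <= M.
Proof.
move=> M0 h; apply: unitary_diag_norm (spectralmxK A) M0 _ => i.
by apply: h; exists i.
Qed.

Lemma spec_bound A x : A^t* = A -> in_spec A x -> `|x| <= opnorm A.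
Proof.
move=> hA /spec_eigvec -/(_ id)[v [v1]]; rewrite fcalc_id // => e.
have := opnormP A v; rewrite e l2normZ v1 !mulr1 /normc /= expr0n addr0.
by rewrite sqrtr_sqr.
Qed.

Lemma fcalc_horner A f p : rhorner p (fcalc f A) = fcalc (fun x => p.[f x]) A.
Proof.
rewrite /rhorner; elim/poly_ind: p => [|p c ih].
  rewrite !rmorph0 (@eq_fcalc A _ (fun=> 0)) ?fcalc_cst ?rmorph0 ?raddf0 // => x _.
  by rewrite horner0.
rewrite !rmorphD !rmorphM /= map_polyX map_polyC /= horner_mx_X horner_mx_C ih.
rewrite -(fcalc_cst A c) -[_ * fcalc f A]fcalcM -fcalcD; apply: eq_fcalc => x _ /=.
by rewrite !hornerE.
Qed.

(** On a finite spectrum every function agrees with a real polynomial. Hence whatever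
    respects the evaluation of real polynomials respects the functional calculus. *)
Lemma fcalc_poly A f p : A^t* = A -> (forall x, in_spec A x -> p.[x] = f x) ->
  fcalc f A = rhorner p A.
Proof.
move=> hA h; rewrite -[in RHS](fcalc_id hA) fcalc_horner; apply: eq_fcalc => x hx.
by rewrite h.
Qed.

Lemma spec_list A : exists s : seq R, forall x, in_spec A x -> x \in s.
Proof.
exists [seq spec A i | i : 'I_n] => x [i ->].
exact: map_f (mem_enum _ _).
Qed.

Lemma fcalc_comp A f g : fcalc f (fcalc g A) = fcalc (f \o g) A.
Proof.
have [s hs] := spec_list (fcalc g A); have [s2 hs2] := spec_list A.
have [p hp] := interpolation f (s ++ map g s2).
rewrite (@fcalc_poly (fcalc g A) f p) ?fcalc_herm //; last first.
  by move=> x hx; apply: hp; rewrite mem_cat hs.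
rewrite fcalc_horner; apply: eq_fcalc => x hx; apply: hp.
by rewrite mem_cat map_f ?orbT // hs2.
Qed.

Lemma comm_fcalc A B f : A^t* = A -> B *m A = A *m B ->
  B *m fcalc f A = fcalc f A *m B.
Proof.
move=> hA BA; have [s hs] := spec_list A; have [p hp] := interpolation f s.
rewrite (fcalc_poly hA (p := p)); last by move=> x /hs; exact: hp.
exact: comm_mx_horner.
Qed.

(** Conjugation by a unitary and the map A |-> U conj(A) U^* of an anti-unitary are of
    this kind; [ra_anti] tells whether scalars get conjugated. *)
Record real_automorphism := RealAutomorphism {
  ra_fun :> 'M[C]_n -> 'M[C]_n;
  ra_anti : bool;
  raD : forall A B, ra_fun (A + B) = ra_fun A + ra_fun B;
  raM : forall A B, ra_fun (A *m B) = ra_fun A *m ra_fun B;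
  ra1 : ra_fun 1%:M = 1%:M;
  raZ : forall (c : C) A, ra_fun (c *: A) = (if ra_anti then c^* else c) *: ra_fun A;
  raA : forall A, ra_fun (A^t*) = (ra_fun A)^t*
}.

Variable s : real_automorphism.

Lemma ra0 : s 0 = 0.
Proof. by have := raZ s 0 0; rewrite conjC0 if_same !scale0r. Qed.

Lemma raN A : s (- A) = - s A.
Proof. by have := raZ s (-1) A; rewrite conjCN1 if_same !scaleN1r. Qed.

Lemma raB A B : s (A - B) = s A - s B.
Proof. by rewrite raD raN. Qed.

Lemma raZR (c : R) A : s (c%:C *: A) = c%:C *: s A.
Proof. by rewrite raZ conjR if_same. Qed.

Lemma raC (c : R) : s ((c%:C)%:M) = (c%:C)%:M.
Proof. by have := raZR c 1%:M; rewrite ra1 scalemx1. Qed.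

Lemma ra_sum (I : Type) (r : seq I) (P : pred I) (F : I -> 'M[C]_n) :
  s (\sum_(i <- r | P i) F i) = \sum_(i <- r | P i) s (F i).
Proof. exact: (big_morph s (raD s) ra0). Qed.

Lemma ra_horner p A : s (rhorner p A) = rhorner p (s A).
Proof.
rewrite /rhorner; elim/poly_ind: p => [|p c ih]; first by rewrite !rmorph0 ra0.
rewrite !rmorphD !rmorphM /= map_polyX map_polyC /= !horner_mx_X !horner_mx_C.
by rewrite raD raC -ih -[in LHS]mulmxE raM.
Qed.

(** A real automorphism fixes the real scalars, hence respects real polynomials, and one
    polynomial interpolates f on the spectra of A and of its image. *)
Lemma ra_fcalc f A : A^t* = A -> s (fcalc f A) = fcalc f (s A).
Proof.
move=> hA; have hsA : (s A)^t* = s A by rewrite -raA hA.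
have [r hr] := spec_list A; have [r2 hr2] := spec_list (s A).
have [p hp] := interpolation f (r ++ r2).
rewrite !(@fcalc_poly _ f p) ?ra_horner // => x hx; apply: hp; rewrite mem_cat.
  by rewrite hr2 ?orbT.
by rewrite hr.
Qed.

End FunctionalCalculus.

(** * Commutators with square roots *)

Section SquareRoots.
Variables (R : realType) (m : nat).
Local Notation C := R[i].
Local Notation n := m.+1.
Local Notation "x %:C" := (real_complex R x).
Implicit Types (A B T : 'M[C]_n) (v : 'cV[C]_n).

(** The largest eigenvalue of T^* T is the squared norm of T; its eigenvector is where
    [sqrt_intertwine] tests T. *)
Lemma top_eigvec T : exists v, l2norm v = 1 /\ T^t* *m T *m v = (opnorm T ^+ 2)%:C *: v.
Proof.
have hTT : (T^t* *m T)^t* = T^t* *m T by rewrite adjmxM trmxCK.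
pose d i := spec (T^t* *m T) i.
have [i0 hmax] : exists i0, forall i, d i <= d i0.
  by exists [arg max_(i > (ord0 : 'I_n)) d i]%O; case: arg_maxP => // j _ h i; exact: h.
have h0 : in_spec (T^t* *m T) (d i0) by exists i0.
have [v [v1]] := spec_eigvec id h0; rewrite fcalc_id // => ev.
have dT : d i0 = l2norm (T *m v) ^+ 2.
  by rewrite l2norm_sqr inner_adj mulmxA ev innerZr inner_l2 v1 expr1n mulr1.
have d0 : 0 <= d i0 by rewrite dT sqr_ge0.
have le1 : opnorm T ^+ 2 <= d i0.
  rewrite -(sqr_sqrtr d0) ler_pXn2r ?nnegrE ?opnorm_ge0 ?sqrtr_ge0 //.
  apply: opnorm_le => [|w]; first exact: sqrtr_ge0.
  rewrite -(@ler_pXn2r _ 2) ?nnegrE ?mulr_ge0 ?l2norm_ge0 ?sqrtr_ge0 //.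
  rewrite exprMn (sqr_sqrtr d0) l2norm_sqr inner_adj mulmxA.
  apply: le_trans (cauchy_schwarz _ _) _; rewrite mulrC expr2 mulrA.
  rewrite ler_wpM2r ?l2norm_ge0 //; apply: le_trans (opnormP _ _) _.
  rewrite ler_wpM2r ?l2norm_ge0 // -[X in opnorm X](fcalc_id hTT).
  apply: fcalc_norm => // x hx; have [w' [w1]] := spec_eigvec id hx; rewrite fcalc_id // => ew.
  have -> : x = l2norm (T *m w') ^+ 2.
    by rewrite l2norm_sqr inner_adj mulmxA ew innerZr inner_l2 w1 expr1n mulr1.
  rewrite ger0_norm ?sqr_ge0 //; case: hx => i hi; move: (hmax i).
  rewrite /d -hi => h; apply: le_trans h; move: ew => /(congr1 (fun z => inner w' z)).
  by rewrite innerZr -mulmxA -inner_adj !inner_l2 w1 expr1n mulr1 => -[->].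
have le2 : d i0 <= opnorm T ^+ 2.
  by rewrite dT ler_pXn2r ?nnegrE ?opnorm_ge0 ?l2norm_ge0 //; have := opnormP T v; rewrite v1 mulr1.
by exists v; split=> //; rewrite ev; congr (_%:C *: _); apply/eqP; rewrite eq_le le1 le2.
Qed.

(** Here Z = A T + T B. Let v be a unit vector with T^* T v = t^2 v, where t is the norm
    of T. Then Re <Tv, Zv> = |K T v|^2 + t^2 |L v|^2, whereas t^2 = Re <Tv, (A Y - Y B)
    v> is at most M (|K T v| + t |L v|). Comparing both gives the bound, whose constants
    do not depend on the size of the matrices. *)
Lemma sqrt_intertwine (K L Y A B T Z : 'M[C]_n) (M : R) :
  A = K^t* *m K -> B = L^t* *m L ->
  T = A *m Y - Y *m B -> Z = A *m A *m Y - Y *m (B *m B) ->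
  opnorm K * opnorm Y <= M -> opnorm Y * opnorm L <= M ->
  opnorm T ^+ 3 <= 2 * M ^+ 2 * opnorm Z.
Proof.
move=> hA hB hT hZ' hK hL.
have hZ : Z = A *m T + T *m B.
  by rewrite hZ' hT mulmxBr mulmxBl 3!mulmxA subrKA.
have [v [v1 ev]] := top_eigvec T.
move: (opnorm_ge0 T) ev; move: (opnorm T) => t t0 ev.
have Tv : l2norm (T *m v) = t.
  apply/eqP; rewrite -(@eqrXn2 _ 2) ?l2norm_ge0 //; apply/eqP.
  by rewrite l2norm_sqr inner_adj mulmxA ev innerZr inner_l2 v1 expr1n mulr1.
have [a ha] : exists a, a = l2norm (K *m (T *m v)) by eexists.
have [b hb] : exists b, b = t * l2norm (L *m v) by eexists.
have a0 : 0 <= a by rewrite ha l2norm_ge0.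
have b0 : 0 <= b by rewrite hb mulr_ge0 ?l2norm_ge0.
have h1 : a ^+ 2 + b ^+ 2 <= t * opnorm Z.
  have -> : a ^+ 2 + b ^+ 2 = complex.Re (inner (T *m v) (Z *m v)).
    have e1 : inner (T *m v) (A *m T *m v) = (a ^+ 2)%:C.
      by rewrite ha -inner_l2 [in RHS]inner_adj hA 3!mulmxA.
    have e2 : inner (T *m v) (T *m B *m v) = (b ^+ 2)%:C.
      have := inner_adj (T^t*) (T *m v) (B *m v); rewrite trmxCK mulmxA [in RHS]mulmxA => <-.
      rewrite ev innerZl conjR hb exprMn (rmorphM _ (t ^+ 2)) /= -inner_l2 [in RHS]inner_adj hB.
      by rewrite -mulmxA.
    by rewrite hZ mulmxDl innerDr e1 e2 -rmorphD.
  apply: le_trans (cauchy_schwarz _ _) _; rewrite Tv; apply: ler_wpM2l => //.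
  by have := opnormP Z v; rewrite v1 mulr1.
have h2 : t ^+ 2 <= M * (a + b).
  have e1 : complex.Re (inner (T *m v) (A *m Y *m v)) <= M * a.
    have -> : inner (T *m v) (A *m Y *m v) = inner (K *m (T *m v)) (K *m (Y *m v)).
      by rewrite [in RHS]inner_adj hA 3!mulmxA.
    apply: le_trans (cauchy_schwarz _ _) _; rewrite -ha mulrC; apply: ler_wpM2r => //.
    apply: le_trans hK; apply: le_trans (opnormP _ _) _; rewrite ler_wpM2l ?opnorm_ge0 //.
    by have := opnormP Y v; rewrite v1 mulr1.
  have e2 : complex.Re (inner (- (T *m v)) (Y *m B *m v)) <= M * b.
    apply: le_trans (cauchy_schwarz _ _) _; rewrite l2normN Tv hb [leRHS]mulrCA; apply: ler_wpM2l => //.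
    have -> : Y *m B *m v = (Y *m L^t*) *m (L *m v) by rewrite hB 2!mulmxA.
    apply: le_trans (opnormP _ _) _; rewrite ler_wpM2r ?l2norm_ge0 //.
    by apply: le_trans (opnormM _ _) _; rewrite opnorm_adj.
  have -> : t ^+ 2 = complex.Re (inner (T *m v) (A *m Y *m v)) +
       complex.Re (inner (- (T *m v)) (Y *m B *m v)).
    by rewrite -Tv l2norm_sqr -ReD innerNl -innerNr -innerDr -mulmxBl -hT.
  by rewrite mulrDr lerD.
have [tz|tn] := eqVneq t 0; first by rewrite tz expr0n /=; apply: mulr_ge0 (opnorm_ge0 _); apply: mulr_ge0 (sqr_ge0 _).
have tp : 0 < t by rewrite lt_def tn.
rewrite -(ler_pM2l tp); apply: (@le_trans _ _ (M ^+ 2 * (2 * (a ^+ 2 + b ^+ 2)))).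
  have -> : t * t ^+ 3 = (t ^+ 2) ^+ 2 by rewrite -exprS -exprM.
  apply: (@le_trans _ _ ((M * (a + b)) ^+ 2)).
    by rewrite ler_pXn2r ?nnegrE ?sqr_ge0 // (le_trans _ h2) ?sqr_ge0.
  rewrite exprMn; apply: ler_wpM2l; first exact: sqr_ge0.
  rewrite -subr_ge0 (_ : _ - _ = (a - b) ^+ 2) ?sqr_ge0 //.
  by move: (a) (b) => x y; ring.
have -> : t * (2 * M ^+ 2 * opnorm Z) = M ^+ 2 * (2 * (t * opnorm Z)).
  by move: (opnorm Z) => z; ring.
by apply: ler_wpM2l; [exact: sqr_ge0|apply: ler_wpM2l].
Qed.
End SquareRoots.

(** * Bounded sequences of matrices modulo null sequences *)

#[local] Opaque opnorm l2norm inner.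

Section Sequences.
Variables (R : realType) (d : nat -> nat).
Local Notation C := R[i].
Local Notation "x %:C" := (real_complex R x).

Definition mxseq := forall j, 'M[C]_((d j).+1).
Implicit Types A B : mxseq.

(** Records, so that unification does not unfold the quantifiers. *)
Record bdd A : Prop := Bdd { bdd_bound : exists M : R, forall j, opnorm (A j) <= M }.
Record null A : Prop := Null {
  null_bound : forall e : R, 0 < e -> exists N, forall j, (N <= j)%N -> opnorm (A j) <= e }.

Lemma bdd_le (M : R) A : (forall j, opnorm (A j) <= M) -> bdd A.
Proof. by move=> h; split; exists M. Qed.

Lemma bddP A : bdd A -> exists2 M : R, 0 < M & forall j, opnorm (A j) <= M.
Proof.
move=> [[M hM]]; exists (M + 1); last by move=> j; rewrite (le_trans (hM j)) // lerDl.
by rewrite ltr_wpDl // (le_trans _ (hM 0%N)) ?opnorm_ge0.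
Qed.

Lemma bddD A B : bdd A -> bdd B -> bdd (fun j => A j + B j).
Proof.
move=> [[M hM]] [[N hN]]; apply: (@bdd_le (M + N)) => j.
by apply: le_trans (opnormD _ _) (lerD _ _).
Qed.

Lemma bddN A : bdd A -> bdd (fun j => - A j).
Proof. by move=> [[M hM]]; apply: (@bdd_le M) => j; rewrite opnormN. Qed.

Lemma bddB A B : bdd A -> bdd B -> bdd (fun j => A j - B j).
Proof. by move=> hA hB; apply: bddD hA (bddN hB). Qed.

Lemma bddM A B : bdd A -> bdd B -> bdd (fun j => A j *m B j).
Proof.
move=> /bddP[M M0 hM] /bddP[N N0 hN]; apply: (@bdd_le (M * N)) => j.
by apply: le_trans (opnormM _ _) (ler_pM _ _ _ _); rewrite ?opnorm_ge0.
Qed.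

Lemma bddZ (c : C) A : bdd A -> bdd (fun j => c *: A j).
Proof.
move=> [[M hM]]; apply: (@bdd_le (normc c * M)) => j.
by apply: le_trans (opnormZ_le _ _) (ler_wpM2l _ _); rewrite ?normc_ge0.
Qed.

Lemma bdd_adj A : bdd A -> bdd (fun j => (A j)^t*).
Proof. by move=> [[M hM]]; apply: (@bdd_le M) => j; rewrite opnorm_adj. Qed.

Lemma bdd_cst (c : C) : bdd (fun j => c%:M).
Proof. by apply: (@bdd_le (normc c)) => j; exact: opnorm_scalar_le. Qed.

Lemma bdd0 : bdd (fun j => 0).
Proof. by apply: (@bdd_le 0) => j; rewrite opnorm0. Qed.

Lemma bdd_sum (I : Type) (r : seq I) (F : I -> mxseq) :
  (forall i, bdd (F i)) -> bdd (fun j => \sum_(i <- r) F i j).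
Proof.
move=> h; elim: r => [|i r ih].
  by case: bdd0 => -[M hM]; apply: (@bdd_le M) => j; rewrite big_nil.
by case: (bddD (h i) ih) => -[M hM]; apply: (@bdd_le M) => j; rewrite big_cons.
Qed.

Lemma null0 : null (fun j => 0).
Proof. by split=> e e0; exists 0%N => j _; rewrite opnorm0 ltW. Qed.

Lemma nullD A B : null A -> null B -> null (fun j => A j + B j).
Proof.
move=> [hA] [hB]; split=> e e0; have e2 : 0 < e / 2 by rewrite divr_gt0.
have [N hN] := hA _ e2; have [N' hN'] := hB _ e2; exists (maxn N N') => j.
rewrite geq_max => /andP[h1 h2]; apply: le_trans (opnormD _ _) _.
by rewrite (le_trans (lerD (hN _ h1) (hN' _ h2))) // -splitr.
Qed.

Lemma nullN A : null A -> null (fun j => - A j).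
Proof. by move=> [h]; split=> e /h[N hN]; exists N => j; rewrite opnormN; apply: hN. Qed.

Lemma nullB A B : null A -> null B -> null (fun j => A j - B j).
Proof. by move=> hA hB; apply: nullD hA (nullN hB). Qed.

Lemma null_le (M : R) A B : 0 <= M -> null A ->
  (forall j, opnorm (B j) <= M * opnorm (A j)) -> null B.
Proof.
move=> M0 [hA] h; split=> e e0.
have M1 : 0 < M + 1 by rewrite ltr_wpDl.
have [N hN] := hA _ (divr_gt0 e0 M1); exists N => j /hN hj; apply: le_trans (h j) _.
apply: le_trans (ler_wpM2l M0 hj) _; rewrite mulrCA ler_piMr ?ltW //.
by rewrite ltr_pdivrMr // mul1r ltrDl.
Qed.

Lemma null_mull A B : bdd A -> null B -> null (fun j => A j *m B j).
Proof.
move=> /bddP[M M0 hM] hB; apply: (null_le (ltW M0) hB) => j.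
by apply: le_trans (opnormM _ _) (ler_wpM2r _ _); rewrite ?opnorm_ge0.
Qed.

Lemma null_mulr A B : bdd A -> null B -> null (fun j => B j *m A j).
Proof.
move=> /bddP[M M0 hM] hB; apply: (null_le (ltW M0) hB) => j.
apply: le_trans (opnormM _ _) _; rewrite mulrC.
by apply: ler_wpM2r; rewrite ?opnorm_ge0.
Qed.

Lemma nullZ (c : C) A : null A -> null (fun j => c *: A j).
Proof.
move=> hA; apply: (null_le (normc_ge0 c) hA) => j; exact: opnormZ_le.
Qed.

Lemma eq_null A B : (forall j, A j = B j) -> null A -> null B.
Proof. by move=> h [hA]; split=> e /hA[N hN]; exists N => j; rewrite -h; apply: hN. Qed.

(** Makes [aclass] total: unbounded sequences get the class of 0. *)
Definition clip A : mxseq := if `[< bdd A >] then A else fun j => 0.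
Definition nullclass A : set mxseq := [set B | null (fun j => A j - B j)].

Lemma clip_bdd A : bdd (clip A).
Proof. by rewrite /clip; case: asboolP => // _; exact: bdd0. Qed.

Lemma clipE A : bdd A -> clip A = A.
Proof. by move=> hA; rewrite /clip; case: asboolP. Qed.

(** A class is given by the set of its members, so that equality of classes is equality
    of terms. *)
Record asymp := Asymp { asymp_set : set mxseq;
  asymp_ex : exists2 A, bdd A & asymp_set = nullclass A }.

(** Locked, as are the operations below: unification would otherwise unfold classes into
    sequences. *)
Definition aclass : mxseq -> asymp :=
  locked (fun A => Asymp (ex_intro2 _ _ (clip A) (clip_bdd A) erefl)).

Lemma aclass_set A : bdd A -> asymp_set (aclass A) = nullclass A.
Proof. by move=> hA; rewrite /aclass -lock /= clipE. Qed.

Definition representative (x : asymp) : mxseq := sval (cid2 (asymp_ex x)).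

Lemma bdd_representative x : bdd (representative x).
Proof. by rewrite /representative; case: cid2. Qed.

Lemma asympI x y : asymp_set x = asymp_set y -> x = y.
Proof.
case: x y => [S hS] [S' hS'] /= e; case: S' / e hS' => hS'.
by congr Asymp; exact: Prop_irrelevance.
Qed.

Lemma aclass_eq A B : bdd A -> bdd B -> null (fun j => A j - B j) -> aclass A = aclass B.
Proof.
move=> hA hB h; apply: asympI.
rewrite (aclass_set hA) (aclass_set hB); apply/seteqP; split=> D; rewrite /nullclass /= => hD.
  by apply: eq_null (nullB hD h) => j; rewrite opprB addrC subrKA.
by apply: eq_null (nullD h hD) => j; rewrite subrKA.
Qed.

Lemma aclass_eq0 A B : bdd A -> bdd B -> aclass A = aclass B -> null (fun j => A j - B j).
Proof.
move=> hA hB /(congr1 asymp_set) ; rewrite (aclass_set hA) (aclass_set hB) => e.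
have : nullclass B B by apply: eq_null null0 => j; rewrite subrr.
by rewrite -e.
Qed.

Lemma representativeK x : aclass (representative x) = x.
Proof.
rewrite /representative; case: cid2 => A /= hA e; apply: asympI.
by rewrite (aclass_set hA) e.
Qed.

Lemma asympP x : exists2 A, bdd A & x = aclass A.
Proof. by exists (representative x); [exact: bdd_representative|rewrite representativeK]. Qed.

HB.instance Definition _ := gen_eqMixin asymp.
HB.instance Definition _ := gen_choiceMixin asymp.

Definition addq := locked (fun x y => aclass (fun j => representative x j + representative y j)).
Definition oppq := locked (fun x => aclass (fun j => - representative x j)).
Definition mulq := locked (fun x y => aclass (fun j => representative x j *m representative y j)).
Definition scaleq := locked (fun (c : C) x => aclass (fun j => c *: representative x j)).

Lemma representative_aclass A : bdd A -> null (fun j => representative (aclass A) j - A j).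
Proof. by move=> hA; apply: aclass_eq0 hA _; rewrite ?representativeK //; apply: bdd_representative. Qed.

Lemma addqE A B : bdd A -> bdd B -> addq (aclass A) (aclass B) = aclass (fun j => A j + B j).
Proof.
move=> hA hB; rewrite /addq -lock; apply: aclass_eq; [by apply: bddD; exact: bdd_representative|exact: bddD|].
apply: eq_null (nullD (representative_aclass hA) (representative_aclass hB)) => j.
by rewrite opprD addrACA.
Qed.

Lemma oppqE A : bdd A -> oppq (aclass A) = aclass (fun j => - A j).
Proof.
move=> hA; rewrite /oppq -lock; apply: aclass_eq; [by apply: bddN; exact: bdd_representative|exact: bddN|].
by apply: eq_null (nullN (representative_aclass hA)) => j; rewrite opprD.
Qed.

Lemma scaleqE c A : bdd A -> scaleq c (aclass A) = aclass (fun j => c *: A j).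
Proof.
move=> hA; rewrite /scaleq -lock; apply: aclass_eq; [by apply: bddZ; exact: bdd_representative|exact: bddZ|].
by apply: eq_null (nullZ c (representative_aclass hA)) => j; rewrite scalerBr.
Qed.

Lemma mulqE A B : bdd A -> bdd B -> mulq (aclass A) (aclass B) = aclass (fun j => A j *m B j).
Proof.
move=> hA hB; rewrite /mulq -lock; apply: aclass_eq; [by apply: bddM; exact: bdd_representative|exact: bddM|].
apply: eq_null (nullD (null_mull (bdd_representative (aclass A)) (representative_aclass hB)) (null_mulr hB (representative_aclass hA))) => j.
by rewrite mulmxBr mulmxBl subrKA.
Qed.

Lemma addqA : associative addq.
Proof.
move=> x y z; have [A hA ->] := asympP x; have [B hB ->] := asympP y.
have [D hD ->] := asympP z; rewrite (addqE hB hD).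
rewrite (addqE hA (bddD hB hD)).
rewrite (addqE hA hB).
rewrite (addqE (bddD hA hB) hD).
congr aclass.
by apply: functional_extensionality_dep => j; rewrite addrA.
Qed.

Lemma addqC : commutative addq.
Proof.
move=> x y; have [A hA ->] := asympP x; have [B hB ->] := asympP y.
by rewrite !addqE //; congr aclass; apply: functional_extensionality_dep => j; rewrite addrC.
Qed.

Lemma add0q : left_id (aclass (fun j => 0)) addq.
Proof.
move=> x; have [A hA ->] := asympP x; rewrite addqE //; last exact: bdd0.
by congr aclass; apply: functional_extensionality_dep => j; rewrite add0r.
Qed.

Lemma addNq : left_inverse (aclass (fun j => 0)) oppq addq.
Proof.
move=> x; have [A hA ->] := asympP x; rewrite oppqE // addqE //; last exact: bddN.
by congr aclass; apply: functional_extensionality_dep => j; rewrite addNr.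
Qed.

HB.instance Definition _ := GRing.isZmodule.Build asymp addqA addqC add0q addNq.

Lemma mulqA : associative mulq.
Proof.
move=> x y z; have [A hA ->] := asympP x; have [B hB ->] := asympP y.
have [D hD ->] := asympP z; rewrite !mulqE //; try exact: bddM.
by congr aclass; apply: functional_extensionality_dep => j; rewrite mulmxA.
Qed.

Lemma mul1q : left_id (aclass (fun j => 1%:M)) mulq.
Proof.
move=> x; have [A hA ->] := asympP x; rewrite mulqE //; last exact: bdd_cst.
by congr aclass; apply: functional_extensionality_dep => j; rewrite mul1mx.
Qed.

Lemma mulq1 : right_id (aclass (fun j => 1%:M)) mulq.
Proof.
move=> x; have [A hA ->] := asympP x; rewrite mulqE //; last exact: bdd_cst.
by congr aclass; apply: functional_extensionality_dep => j; rewrite mulmx1.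
Qed.

Lemma mulqDl : left_distributive mulq addq.
Proof.
move=> x y z; have [A hA ->] := asympP x; have [B hB ->] := asympP y.
have [D hD ->] := asympP z; rewrite addqE // !mulqE ?addqE //; try exact: bddM; try exact: bddD.
by congr aclass; apply: functional_extensionality_dep => j; rewrite mulmxDl.
Qed.

Lemma mulqDr : right_distributive mulq addq.
Proof.
move=> x y z; have [A hA ->] := asympP x; have [B hB ->] := asympP y.
have [D hD ->] := asympP z; rewrite addqE // !mulqE ?addqE //; try exact: bddM; try exact: bddD.
by congr aclass; apply: functional_extensionality_dep => j; rewrite mulmxDr.
Qed.

Lemma oneq_neq0 : aclass (fun j => 1%:M) != 0 :> asymp.
Proof.
apply/eqP => /aclass_eq0 -/(_ (bdd_cst _) bdd0) [/(_ (2^-1))] [|N /(_ N (leqnn N))].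
  by rewrite invr_gt0.
have [v [v1 _]] := top_eigvec (0 : 'M[C]_((d N).+1)).
have := opnormP (1%:M : 'M[C]_((d N).+1)) v; rewrite mul1mx v1 mulr1 subr0 => h1 h2.
by have := le_trans h1 h2; lra.
Qed.

HB.instance Definition _ :=
  GRing.Zmodule_isNzRing.Build asymp mulqA mul1q mulq1 mulqDl mulqDr oneq_neq0.

Lemma scaleqA a b x : scaleq a (scaleq b x) = scaleq (a * b) x.
Proof.
have [A hA ->] := asympP x; rewrite !scaleqE //; last exact: bddZ.
by congr aclass; apply: functional_extensionality_dep => j; rewrite scalerA.
Qed.

Lemma scale1q : left_id 1 scaleq.
Proof.
move=> x; have [A hA ->] := asympP x; rewrite !scaleqE //.
by congr aclass; apply: functional_extensionality_dep => j; rewrite scale1r.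
Qed.

Lemma scaleqDr : right_distributive scaleq +%R.
Proof.
move=> c x y; have [A hA ->] := asympP x; have [B hB ->] := asympP y.
rewrite -![_ + _]/(addq _ _) addqE // !scaleqE ?addqE //; try exact: bddZ; try exact: bddD.
by congr aclass; apply: functional_extensionality_dep => j; rewrite scalerDr.
Qed.

Lemma scaleqDl x : {morph scaleq^~ x : a b / a + b}.
Proof.
move=> a b; have [A hA ->] := asympP x.
rewrite -![_ + _ in RHS]/(addq _ _) !scaleqE ?addqE //; try exact: bddZ.
by congr aclass; apply: functional_extensionality_dep => j; rewrite scalerDl.
Qed.

HB.instance Definition _ :=
  GRing.Zmodule_isLmodule.Build C asymp scaleqA scale1q scaleqDr scaleqDl.

Lemma scaleqAl (c : C) (x y : asymp) : c *: (x * y) = (c *: x) * y.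
Proof.
have [A hA ->] := asympP x; have [B hB ->] := asympP y.
rewrite -![_ * _]/(mulq _ _) -![_ *: _]/(scaleq _ _) !(mulqE, scaleqE) //; try exact: bddM; try exact: bddZ.
by congr aclass; apply: functional_extensionality_dep => j; rewrite scalemxAl.
Qed.

HB.instance Definition _ := GRing.Lmodule_isLalgebra.Build C asymp scaleqAl.

Lemma scaleqAr (c : C) (x y : asymp) : c *: (x * y) = x * (c *: y).
Proof.
have [A hA ->] := asympP x; have [B hB ->] := asympP y.
rewrite -![_ * _]/(mulq _ _) -![_ *: _]/(scaleq _ _) !(mulqE, scaleqE) //; try exact: bddM; try exact: bddZ.
by congr aclass; apply: functional_extensionality_dep => j; rewrite scalemxAr.
Qed.

HB.instance Definition _ := GRing.Lalgebra_isAlgebra.Build C asymp scaleqAr.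

Lemma aclassD A B : bdd A -> bdd B -> aclass (fun j => A j + B j) = aclass A + aclass B.
Proof. by move=> hA hB; rewrite -addqE. Qed.

Lemma aclassN A : bdd A -> aclass (fun j => - A j) = - aclass A.
Proof. by move=> hA; rewrite -oppqE. Qed.

Lemma aclassB A B : bdd A -> bdd B -> aclass (fun j => A j - B j) = aclass A - aclass B.
Proof. by move=> hA hB; rewrite aclassD ?aclassN //; exact: bddN. Qed.

Lemma aclassM A B : bdd A -> bdd B -> aclass (fun j => A j *m B j) = aclass A * aclass B.
Proof. by move=> hA hB; rewrite -mulqE. Qed.

Lemma aclassZ (c : C) A : bdd A -> aclass (fun j => c *: A j) = c *: aclass A.
Proof. by move=> hA; rewrite -scaleqE. Qed.

Lemma aclass0 : aclass (fun j => 0) = 0. Proof. by []. Qed.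
Lemma aclass1 : aclass (fun j => 1%:M) = 1. Proof. by []. Qed.
Lemma aclass_cst (c : C) : aclass (fun j => c%:M) = c%:A.
Proof.
rewrite -aclass1 -aclassZ; last exact: bdd_cst.
by congr aclass; apply: functional_extensionality_dep => j; rewrite scalemx1.
Qed.

Lemma aclass_sum (I : Type) (r : seq I) (F : I -> mxseq) : (forall i, bdd (F i)) ->
  aclass (fun j => \sum_(i <- r) F i j) = \sum_(i <- r) aclass (F i).
Proof.
move=> h; elim: r => [|i r ih].
  by rewrite big_nil -aclass0; congr aclass; apply: functional_extensionality_dep => j; rewrite big_nil.
rewrite big_cons -ih -aclassD //; last exact: bdd_sum.
by congr aclass; apply: functional_extensionality_dep => j; rewrite big_cons.
Qed.

Lemma eq_aclass A B : (forall j, A j = B j) -> aclass A = aclass B.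
Proof. by move=> h; congr aclass; apply: functional_extensionality_dep. Qed.

Lemma eq_aclass_near A B N : bdd A -> bdd B -> (forall j, (N <= j)%N -> A j = B j) -> aclass A = aclass B.
Proof.
move=> hA hB h; apply: aclass_eq => //; split=> e e0; exists N => j /h ->.
by rewrite subrr opnorm0 ltW.
Qed.

Lemma aclass_le A B (e : R) : bdd A -> bdd B -> aclass A = aclass B -> 0 < e ->
  exists N, forall j, (N <= j)%N -> opnorm (A j - B j) <= e.
Proof. by move=> hA hB /(aclass_eq0 hA hB)[h] /h. Qed.

(** The norm of x is at most t times itself up to a null sequence. Elements of the
    quotient are shown to vanish in this way. *)
Lemma contraction_eq0 (y x : asymp) (B : mxseq) (t : R) :
  y = aclass B -> (forall j, opnorm (B j) <= t) -> t < 1 -> x = y * x -> x = 0.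
Proof.
move=> -> hB t1; have [A hA ->] := asympP x.
have bB : bdd B := bdd_le hB.
rewrite -aclassM // => e.
have h := aclass_eq0 hA (bddM bB hA) e; rewrite -aclass0; apply: aclass_eq (hA) bdd0 _.
have t2 : 0 < 1 - t by rewrite subr_gt0.
have t2i : 0 <= (1 - t)^-1 by rewrite invr_ge0 ltW.
apply: (null_le t2i h) => j; rewrite subr0 mulrC ler_pdivlMr // mulrBr mulr1.
rewrite lerBlDr; apply: le_trans (_ : opnorm (A j - B j *m A j) + opnorm (B j *m A j) <= _).
  by apply: le_trans (opnormD _ _); rewrite subrK.
rewrite lerD2l mulrC; apply: le_trans (opnormM _ _) _.
by rewrite ler_wpM2r ?opnorm_ge0.
Qed.

(** The bound of [sqrt_intertwine] is uniform in the size, so that it survives in the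
    quotient: intertwining the squares of two positive elements means intertwining the
    elements. *)
Lemma aclass_sqrt_intertwine (K L Y : mxseq) : bdd K -> bdd L -> bdd Y ->
  let a := aclass (fun j => (K j)^t* *m K j) in let b := aclass (fun j => (L j)^t* *m L j) in
  a * a * aclass Y = aclass Y * (b * b) -> a * aclass Y = aclass Y * b.
Proof.
move=> bK bL bY /=.
have bA := bddM (bdd_adj bK) bK; have bB := bddM (bdd_adj bL) bL.
have bAA := bddM bA bA; have bBB := bddM bB bB.
have bAY := bddM bA bY; have bYB := bddM bY bB.
have bAAY := bddM bAA bY; have bYBB := bddM bY bBB.
rewrite -(aclassM bA bA) -(aclassM bAA bY) -(aclassM bB bB) -(aclassM bY bBB) -(aclassM bA bY) -(aclassM bY bB).
move=> /(aclass_eq0 bAAY bYBB) [h]; apply: (aclass_eq bAY bYB); split=> e e0.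
have [k k0 hk] := bddP bK; have [l l0 hl] := bddP bL; have [y y0 hy] := bddP bY.
pose M := Num.max (k * y) (y * l).
have M0 : 0 < M by rewrite lt_max mulr_gt0.
have [N hN] := h _ (divr_gt0 (exprn_gt0 3 e0) (mulr_gt0 (ltr0Sn R 1) (exprn_gt0 2 M0))).
exists N => j /hN hj.
have := @sqrt_intertwine R _ (K j) (L j) (Y j) _ _ _ _ M erefl erefl erefl erefl.
have h1 : opnorm (K j) * opnorm (Y j) <= M.
  by rewrite le_max ler_pM ?opnorm_ge0.
have h2 : opnorm (Y j) * opnorm (L j) <= M.
  by rewrite le_max (ler_pM (opnorm_ge0 _) (opnorm_ge0 _) (hy j) (hl j)) orbT.
move=> /(_ h1 h2) h3; rewrite -(@ler_pXn2r _ 3) ?nnegrE ?opnorm_ge0 ?(ltW e0) //.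
apply: le_trans h3 _; rewrite mulrC -ler_pdivlMr; first exact: hj.
by apply: mulr_gt0 => //; apply: exprn_gt0.
Qed.

End Sequences.

(** * Functions that respect commutation in the quotient *)

#[local] Opaque fcalc.

Section GoodFunctions.
Variables (R : realType) (d : nat -> nat).
Local Notation C := R[i].
Local Notation "x %:C" := (real_complex R x).
Local Notation mxseq := (mxseq R d).
Local Notation asymp := (asymp R d).
Implicit Types (A B h : mxseq) (f g : R -> R).

Definition hermseq h := forall j, (h j)^t* = h j.

Record locbdd f : Prop := Locbdd {
  locbdd_ex : forall M : R, exists K : R, forall x, `|x| <= M -> `|f x| <= K }.

Lemma locbdd_le f (K : R) : (forall x, `|f x| <= K) -> locbdd f.
Proof. by move=> h; split=> M; exists K. Qed.

Lemma locbdd_cst (c : R) : locbdd (fun=> c).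
Proof. exact: (@locbdd_le _ `|c|). Qed.

Lemma locbdd_id : locbdd id.
Proof. by split=> M; exists M. Qed.

Lemma locbddD f g : locbdd f -> locbdd g -> locbdd (f \+ g).
Proof.
move=> [hf] [hg]; split=> M; have [K hK] := hf M; have [L hL] := hg M; exists (K + L) => x hx.
by apply: le_trans (ler_normD _ _) (lerD (hK _ hx) (hL _ hx)).
Qed.

Lemma locbddM f g : locbdd f -> locbdd g -> locbdd (f \* g).
Proof.
move=> [hf] [hg]; split=> M; have [K hK] := hf M; have [L hL] := hg M; exists (K * L) => x hx.
by rewrite normrM; apply: ler_pM => //; [exact: hK|exact: hL].
Qed.

Lemma locbdd_dom f g : locbdd g -> (forall x, `|f x| <= `|g x|) -> locbdd f.
Proof.
move=> [hg] h; split=> M; have [K hK] := hg M; exists K => x hx.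
by apply: le_trans (h x) (hK _ hx).
Qed.

Lemma bdd_fc f h : locbdd f -> hermseq h -> bdd h -> bdd (fun j => fcalc f (h j)).
Proof.
move=> [hf] hh [[M hM]]; have [K hK] := hf M; apply: (@bdd_le _ _ (Num.max K 0)) => j.
apply: fcalc_norm => [|x hx]; first by rewrite le_max lexx orbT.
rewrite le_max hK //; apply: le_trans (hM j); exact: spec_bound.
Qed.

Definition fc f h := aclass (fun j => fcalc f (h j)).

Section Rules.
Variables (h : mxseq) (hh : hermseq h) (bh : bdd h).

Lemma fcD f g : locbdd f -> locbdd g -> fc (f \+ g) h = fc f h + fc g h.
Proof.
move=> hf hg; rewrite /fc -(aclassD (bdd_fc hf hh bh) (bdd_fc hg hh bh)).
by apply: eq_aclass => j; rewrite fcalcD.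
Qed.

Lemma fcM f g : locbdd f -> locbdd g -> fc (f \* g) h = fc f h * fc g h.
Proof.
move=> hf hg; rewrite /fc -(aclassM (bdd_fc hf hh bh) (bdd_fc hg hh bh)).
by apply: eq_aclass => j; rewrite fcalcM.
Qed.

Lemma fcB f g : locbdd f -> locbdd g -> fc (fun x => f x - g x) h = fc f h - fc g h.
Proof.
move=> hf hg; rewrite /fc -(aclassB (bdd_fc hf hh bh) (bdd_fc hg hh bh)).
by apply: eq_aclass => j; rewrite fcalcB.
Qed.

Lemma fc_cst (c : R) : fc (fun=> c) h = (c%:C)%:A.
Proof. by rewrite -aclass_cst; apply: eq_aclass => j; rewrite fcalc_cst. Qed.

Lemma fc_id : fc id h = aclass h.
Proof. by apply: eq_aclass => j; rewrite fcalc_id. Qed.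

Lemma eq_fc f g : f =1 g -> fc f h = fc g h.
Proof. by move=> /funext ->. Qed.

Lemma fc_comm f g : locbdd f -> locbdd g -> GRing.comm (fc f h) (fc g h).
Proof.
move=> hf hg; rewrite /GRing.comm -(fcM hf hg) -(fcM hg hf).
by apply: eq_fc => x; rewrite /= mulrC.
Qed.

End Rules.

(** For a bounded f in general, commuting with h up to a null sequence does not pass to
    f(h): the spectrum may cluster where f jumps. The good functions are those for which
    it passes. *)
Record good f : Prop := Good {
  good_locbdd :> locbdd f;
  good_comm : forall h, hermseq h -> bdd h -> forall y : asymp,
    GRing.comm y (aclass h) -> GRing.comm y (fc f h) }.

Lemma good_cst c : good (fun=> c).
Proof.
split; first exact: locbdd_cst.
by move=> h hh bh y _; rewrite fc_cst; apply/commr_sym/comm_alg.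
Qed.

Lemma good_id : good id.
Proof. by split; [exact: locbdd_id|move=> h hh bh y; rewrite fc_id]. Qed.

Lemma goodD f g : good f -> good g -> good (f \+ g).
Proof.
move=> [bf hf] [bg hg]; split; first exact: locbddD.
move=> h hh bh y hy; rewrite fcD //; apply: commrD; [exact: hf|exact: hg].
Qed.

Lemma goodM f g : good f -> good g -> good (f \* g).
Proof.
move=> [bf hf] [bg hg]; split; first exact: locbddM.
move=> h hh bh y hy; rewrite fcM //; apply: commrM; [exact: hf|exact: hg].
Qed.

Lemma good_ext f g : f =1 g -> good f -> good g.
Proof. by move=> /funext ->. Qed.

Lemma goodN f : good f -> good (fun x => - f x).
Proof.
move=> hf; apply: good_ext (goodM (good_cst (-1)) hf) => x /=; by rewrite mulN1r.
Qed.

Lemma goodB f g : good f -> good g -> good (fun x => f x - g x).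
Proof. by move=> hf hg; apply: good_ext (goodD hf (goodN hg)) => x. Qed.

Lemma goodZ c f : good f -> good (fun x => c * f x).
Proof. by move=> hf; apply: good_ext (goodM (good_cst c) hf) => x. Qed.

(** What commutes with the square of the positive element g(h) commutes with g(h).
    Together with sums and products this gives absolute values, hence maxima and minima,
    hence all piecewise linear functions. *)
Lemma good_root g : (forall x, 0 <= g x) -> good (g \* g) -> good g.
Proof.
move=> g0 [bgg hgg].
have bg : locbdd g.
  apply: (locbdd_dom (locbddD bgg (locbdd_cst 1))) => x /=.
  have := g0 x; move: (g x) => t t0.
  by rewrite !ger0_norm ?addr_ge0 ?mulr_ge0 //; nra.
pose s x := Num.sqrt (g x).
have ss x : (s \* s) x = g x by rewrite /= -expr2 sqr_sqrtr.
have bs : locbdd s.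
  apply: (locbdd_dom (locbddD bg (locbdd_cst 1))) => x /=.
  rewrite -ss /=; have := sqrtr_ge0 (g x); rewrite -/(s x); move: (s x) => t t0.
  by rewrite !ger0_norm ?addr_ge0 ?mulr_ge0 //; nra.
split; [exact: bg|move=> h hh bh y hy].
have [Y bY eY] := asympP y; rewrite eY in hy *.
have bsh := bdd_fc bs hh bh.
have e : fc g h = aclass (fun j => (fcalc s (h j))^t* *m fcalc s (h j)).
  apply: eq_aclass => j; rewrite fcalc_herm -fcalcM; apply: eq_fcalc => x _; by rewrite ss.
rewrite /GRing.comm; apply/esym; rewrite e.
apply: (aclass_sqrt_intertwine bsh bsh bY); rewrite -e -(fcM hh bh bg bg); apply/esym; exact: hgg.
Qed.

Lemma good_abs f : good f -> good (fun x => `|f x|).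
Proof.
move=> hf; apply: good_root => [x|]; first exact: normr_ge0.
by apply: good_ext (goodM hf hf) => x /=; rewrite -!expr2 real_normK ?num_real.
Qed.

Lemma good_max f g : good f -> good g -> good (fun x => Num.max (f x) (g x)).
Proof.
move=> hf hg; apply: good_ext (goodZ (2^-1) (goodD (goodD hf hg) (good_abs (goodB hf hg)))) => x /=.
by rewrite maxr_absE mulrC.
Qed.

Lemma good_min f g : good f -> good g -> good (fun x => Num.min (f x) (g x)).
Proof.
move=> hf hg; apply: good_ext (goodZ (2^-1) (goodB (goodD hf hg) (good_abs (goodB hf hg)))) => x /=.
by rewrite minr_absE mulrC.
Qed.

Lemma good_sqrt f : good f -> good (fun x => Num.sqrt (f x)).
Proof.
move=> hf; apply: good_root => [x|]; first exact: sqrtr_ge0.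
apply: good_ext (good_max hf (good_cst 0)) => x /=.
rewrite -expr2; have [h|h] := leP 0 (f x); first by rewrite sqr_sqrtr // max_l.
by rewrite ltr0_sqrtr // expr0n /= ?max_r ?(ltW h).
Qed.

Lemma good_sum (I : Type) (r : seq I) (F : I -> R -> R) : (forall i, good (F i)) ->
  good (fun x => \sum_(i <- r) F i x).
Proof.
move=> h; elim: r => [|i r ih].
  by apply: good_ext (good_cst 0) => x; rewrite big_nil.
by apply: good_ext (goodD (h i) ih) => x; rewrite big_cons.
Qed.

End GoodFunctions.

(** * Hermitian parts and polar decomposition *)

Section Cartesian.
Variables (R : realType) (m : nat).
Local Notation C := R[i].
Local Notation n := m.+1.
Local Notation "x %:C" := (real_complex R x).
Implicit Types (A B N X H Z : 'M[C]_n) (f : R -> R) (s : real_automorphism R m).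

Definition herm A := A^t* = A.

Definition cart A B : 'M[C]_n := A + 'i *: B.
Definition re_part Z : 'M[C]_n := (2^-1)%:C *: (Z + Z^t*).
Definition im_part Z : 'M[C]_n := (2^-1)%:C *: (- 'i *: (Z - Z^t*)).

Lemma herm0 : herm 0. Proof. exact: adjmx0. Qed.

Lemma hermD A B : herm A -> herm B -> herm (A + B).
Proof. by rewrite /herm adjmxD => -> ->. Qed.

Lemma hermB A B : herm A -> herm B -> herm (A - B).
Proof. by rewrite /herm adjmxB => -> ->. Qed.

Lemma hermZ (c : R) A : herm A -> herm (c%:C *: A).
Proof. by rewrite /herm adjmxZ conjR => ->. Qed.

Lemma herm_scalar (c : R) : herm (c%:C)%:M.
Proof. by rewrite -scalemx1; apply: hermZ; exact: adjmx1. Qed.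

Lemma herm_sum (I : Type) (r : seq I) (F : I -> 'M[C]_n) :
  (forall i, herm (F i)) -> herm (\sum_(i <- r) F i).
Proof. by move=> h; elim/big_ind: _ => //; [exact: herm0|exact: hermD]. Qed.

Lemma herm_conj A B : herm B -> herm (A^t* *m B *m A).
Proof. by move=> h; rewrite /herm !adjmxM trmxCK h mulmxA. Qed.

Lemma herm_conj2 A B : herm A -> herm B -> herm (A *m B *m A).
Proof. by move=> hA hB; have := herm_conj A hB; rewrite hA. Qed.

Lemma herm_anticomm A B D : herm A -> herm B -> herm D ->
  herm (A *m B *m D + D *m (B *m A)).
Proof. by move=> hA hB hD; rewrite /herm adjmxD !adjmxM hA hB hD addrC !mulmxA. Qed.

Lemma adj_mul_herm A B : herm B -> (A *m B)^t* = B *m A^t*.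
Proof. by rewrite /herm adjmxM => ->. Qed.

Lemma herm_fcalc f A : herm (fcalc f A).
Proof. exact: fcalc_herm. Qed.

Lemma conjNi : (- 'i)^* = 'i :> C.
Proof. by rewrite rmorphN /= conjCi opprK. Qed.

Lemma herm_re Z : herm (re_part Z).
Proof. by apply: hermZ; rewrite /herm adjmxD trmxCK addrC. Qed.

Lemma herm_im Z : herm (im_part Z).
Proof.
apply: hermZ; rewrite /herm adjmxZ adjmxB trmxCK conjNi scaleNr -scalerN opprB //.
Qed.

Lemma re_adj Z : re_part (Z^t*) = re_part Z.
Proof. by rewrite /re_part trmxCK addrC. Qed.

Lemma im_adj Z : im_part (Z^t*) = - im_part Z.
Proof. by rewrite /im_part trmxCK -scalerN -scalerN opprB. Qed.

Lemma half_sum Z : (2^-1)%:C *: (Z + Z) = Z.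
Proof.
rewrite -(mulr2n Z) -[Z *+ 2]scaler_nat scalerA -(rmorph_nat (real_complex R) 2) -rmorphM /=.
by rewrite mulVf ?pnatr_eq0 // rmorph1 scale1r.
Qed.

Lemma cart_parts Z : cart (re_part Z) (im_part Z) = Z.
Proof.
rewrite /cart /re_part /im_part (scalerA 'i) ['i * _]mulrC -(scalerA _ 'i) -scalerDr (scalerA 'i).
by rewrite mulrN -expr2 sqrCi opprK scale1r addrACA subrr addr0 half_sum.
Qed.

Lemma cart_adj A B : herm A -> herm B -> (cart A B)^t* = A - 'i *: B.
Proof. by move=> hA hB; rewrite /cart adjmxD adjmxZ hA hB conjCi scaleNr. Qed.

Lemma cart_adjN A B : herm A -> herm B -> (cart A B)^t* = cart A (- B).
Proof. by move=> hA hB; rewrite (cart_adj hA hB) /cart scalerN. Qed.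

Lemma re_cart A B : herm A -> herm B -> re_part (cart A B) = A.
Proof.
move=> hA hB; rewrite /re_part (cart_adj hA hB) /cart addrACA subrr addr0; exact: half_sum.
Qed.

Lemma opnorm_re Z : opnorm (re_part Z) <= opnorm Z.
Proof.
apply: le_trans (opnormZ_le _ _) _.
rewrite /normc /= expr0n addr0 sqrtr_sqr ger0_norm ?invr_ge0 //.
rewrite mulrC ler_pdivrMr // mulr_natr mulr2n.
by apply: le_trans (opnormD _ _) _; rewrite opnorm_adj.
Qed.

Lemma opnorm_im Z : opnorm (im_part Z) <= opnorm Z.
Proof.
apply: le_trans (opnormZ_le _ _) _.
rewrite /normc /= expr0n addr0 sqrtr_sqr ger0_norm ?invr_ge0 //.
rewrite mulrC ler_pdivrMr // mulr_natr mulr2n.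
apply: le_trans (opnormZ_le _ _) _.
have -> : normc (- 'i) = 1 :> R by rewrite /normc /= oppr0 expr0n add0r sqrrN expr1n sqrtr1.
by rewrite mul1r; apply: le_trans (opnormB _ _) _; rewrite opnorm_adj.
Qed.

Definition modsq N := N^t* *m N.
(** An odd functional calculus for matrices that need not be hermitian; adjoints and
    real automorphisms pass through it. *)
Definition oddcalc f N : 'M[C]_n := N *m fcalc f (modsq N).

Lemma herm_modsq N : herm (modsq N).
Proof. by rewrite /herm /modsq adjmxM trmxCK. Qed.

Lemma rhorner_swap (p : {poly R}) A B :
  rhorner p (B *m A) *m B = B *m rhorner p (A *m B).
Proof.
rewrite /rhorner; elim/poly_ind: p => [|p c ih].
  by rewrite !rmorph0 mul0mx mulmx0.
rewrite !rmorphD !rmorphM /= map_polyX map_polyC /= !horner_mx_X !horner_mx_C.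
move: (horner_mx _ _) (horner_mx _ _) ih => P Q ih; rewrite -!mulmxE mulmxDl mulmxDr.
by rewrite scalar_mxC -mulmxA -mulmxA mulmxA ih -mulmxA.
Qed.

Lemma fcalc_modsq_adj f N : fcalc f (modsq N) *m N^t* = N^t* *m fcalc f (modsq (N^t*)).
Proof.
have [r hr] := spec_list (modsq N); have [r2 hr2] := spec_list (modsq (N^t*)).
have [p hp] := interpolation f (r ++ r2).
rewrite (fcalc_poly (herm_modsq N) (p := p)); last first.
  by move=> x /hr hx; apply: hp; rewrite mem_cat hx.
rewrite (fcalc_poly (herm_modsq (N^t*)) (p := p)).
  by rewrite /modsq trmxCK rhorner_swap.
by move=> x /hr2 hx; apply: hp; rewrite mem_cat hx orbT.
Qed.

Lemma oddcalc_adj f N : (oddcalc f N)^t* = oddcalc f (N^t*).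
Proof. by rewrite /oddcalc adjmxM herm_fcalc fcalc_modsq_adj. Qed.

Lemma ra_herm s A : herm A -> herm (s A).
Proof. by rewrite /herm -raA => ->. Qed.

Lemma ra_modsq s N : s (modsq N) = modsq (s N).
Proof. by rewrite /modsq raM raA. Qed.

Lemma ra_oddcalc s f N : s (oddcalc f N) = oddcalc f (s N).
Proof. by rewrite /oddcalc raM (ra_fcalc _ _ (herm_modsq N)) ra_modsq. Qed.

Lemma ra_re s Z : s (re_part Z) = re_part (s Z).
Proof. by rewrite /re_part raZR raD raA. Qed.

Lemma ra_cart s A B : herm A -> herm B ->
  s (cart A B) = if ra_anti s then (cart (s A) (s B))^t* else cart (s A) (s B).
Proof.
move=> hA hB; rewrite (cart_adj (ra_herm s hA) (ra_herm s hB)) /cart raD raZ conjCi.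
by case: (ra_anti s) => //; rewrite scaleNr.
Qed.

Lemma ra_im s Z : s (im_part Z) = if ra_anti s then - im_part (s Z) else im_part (s Z).
Proof.
rewrite /im_part raZR raZ raB raA conjNi.
by case: (ra_anti s) => //; rewrite -scalerN scaleNr opprK.
Qed.

Definition odd_re f A B := re_part (oddcalc f (cart A B)).
Definition odd_im f A B := im_part (oddcalc f (cart A B)).

(** An antilinear automorphism sends A + iB to the adjoint of s A + i s B. The adjoint
    passes through [oddcalc] and leaves the hermitian part alone. *)
Lemma ra_odd_re s f A B : herm A -> herm B -> s (odd_re f A B) = odd_re f (s A) (s B).
Proof.
move=> hA hB; rewrite /odd_re ra_re ra_oddcalc (ra_cart s hA hB).
by case: (ra_anti s); [rewrite -oddcalc_adj re_adj|].
Qed.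

(** In the antilinear case the sign changes twice: once from the scalar i and once from
    the adjoint. *)
Lemma ra_odd_im s f A B : herm A -> herm B -> s (odd_im f A B) = odd_im f (s A) (s B).
Proof.
move=> hA hB; rewrite /odd_im ra_im ra_oddcalc (ra_cart s hA hB).
by case: (ra_anti s); [rewrite -oddcalc_adj im_adj opprK|].
Qed.

(** A - iB is the adjoint of A + iB. *)
Lemma odd_reN f A B : herm A -> herm B -> odd_re f A (- B) = odd_re f A B.
Proof. by move=> hA hB; rewrite /odd_re -(cart_adjN hA hB) -oddcalc_adj re_adj. Qed.

Lemma odd_imN f A B : herm A -> herm B -> odd_im f A (- B) = - odd_im f A B.
Proof. by move=> hA hB; rewrite /odd_im -(cart_adjN hA hB) -oddcalc_adj im_adj. Qed.

Lemma fcalc_opp f A : herm A -> fcalc f (- A) = fcalc (fun x => f (- x)) A.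
Proof.
move=> hA; rewrite -[in LHS](fcalc_id hA) -fcalcN fcalc_comp; exact: eq_fcalc.
Qed.

Definition polar N := oddcalc (fun x => (Num.sqrt x)^-1) N.

Lemma modsq_spec_ge0 N x : in_spec (modsq N) x -> 0 <= x.
Proof.
move=> /(spec_eigvec id) [v [v1]]; rewrite fcalc_id; last exact: herm_modsq.
move=> e; have -> : x = l2norm (N *m v) ^+ 2.
  by rewrite l2norm_sqr inner_adj mulmxA e innerZr inner_l2 v1 expr1n mulr1.
exact: sqr_ge0.
Qed.

Lemma modsq_spec_gt0 N x : N \in unitmx -> in_spec (modsq N) x -> 0 < x.
Proof.
move=> hN hx; rewrite lt_def (modsq_spec_ge0 hx) andbT.
move: hx => /(spec_eigvec id) [v [v1]]; rewrite fcalc_id; last exact: herm_modsq.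
move=> e; apply/eqP => x0; rewrite x0 rmorph0 scale0r in e.
have hNN : modsq N \in unitmx.
  by rewrite unitmx_mul hN andbT map_unitmx unitmx_tr.
have v0 : v = 0 by rewrite -(mul1mx v) -(mulVmx hNN) -mulmxA e mulmx0.
by move: v1; rewrite v0 l2norm0 => /eqP; rewrite eq_sym oner_eq0.
Qed.

Lemma polar_unitary N : N \in unitmx -> (polar N)^t* *m polar N = 1%:M.
Proof.
move=> hN; rewrite /polar /oddcalc adjmxM herm_fcalc mulmxA -(mulmxA (fcalc _ _)) -/(modsq N).
rewrite -{2}(fcalc_id (herm_modsq N)) -!fcalcM -(rmorph1 (real_complex R)) -(fcalc_cst (modsq N)).
apply: eq_fcalc => x hx /=; have := modsq_spec_gt0 hN hx => x0.
rewrite -[X in _ * X * _](sqr_sqrtr (ltW x0)); have : Num.sqrt x != 0 by rewrite sqrtr_eq0 -ltNge.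
by move: (Num.sqrt x) => t t0; field.
Qed.

Lemma polarE N : N \in unitmx -> polar N *m fcalc Num.sqrt (modsq N) = N.
Proof.
move=> hN; rewrite /polar /oddcalc -mulmxA -fcalcM.
rewrite (@eq_fcalc _ _ _ _ (fun=> 1)) ?fcalc_cst ?rmorph1 ?mulmx1 // => x hx /=.
by rewrite mulVf // sqrtr_eq0 -ltNge (modsq_spec_gt0 hN hx).
Qed.

End Cartesian.

(** * Pushing the spectrum away from one point *)

Section NormBounds.
Variables (R : realType) (d : nat -> nat).
Local Notation C := R[i].
Local Notation "x %:C" := (real_complex R x).
Local Notation asymp := (asymp R d).

Record qle (t : R) (y : asymp) : Prop := Qle {
  qle_lift : exists2 B, y = aclass B & forall j, opnorm (B j) <= t }.

Lemma qleD s t (x y : asymp) : qle s x -> qle t y -> qle (s + t) (x + y).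
Proof.
move=> [[A -> hA]] [[B -> hB]]; split; exists (fun j => A j + B j).
  by rewrite (aclassD (bdd_le hA) (bdd_le hB)).
by move=> j; apply: le_trans (opnormD _ _) (lerD _ _).
Qed.

Lemma qleM s t (x y : asymp) : qle s x -> qle t y -> qle (s * t) (x * y).
Proof.
move=> [[A -> hA]] [[B -> hB]]; split; exists (fun j => A j *m B j).
  by rewrite (aclassM (bdd_le hA) (bdd_le hB)).
by move=> j; apply: le_trans (opnormM _ _) (ler_pM _ _ _ _); rewrite ?opnorm_ge0.
Qed.

Lemma qleZ (c : C) t (x : asymp) : qle t x -> qle (normc c * t) (c *: x).
Proof.
move=> [[A -> hA]]; split; exists (fun j => c *: A j).
  by rewrite (aclassZ _ (bdd_le hA)).
by move=> j; apply: le_trans (opnormZ_le _ _) (ler_wpM2l _ _); rewrite ?normc_ge0.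
Qed.

Lemma qleN t (x : asymp) : qle t x -> qle t (- x).
Proof.
move=> [[A -> hA]]; split; exists (fun j => - A j).
  by rewrite (aclassN (bdd_le hA)).
by move=> j; rewrite opnormN.
Qed.

Lemma qle_fc f h t : 0 <= t -> (forall x, `|f x| <= t) -> qle t (fc f h : asymp).
Proof.
move=> t0 hf; split; exists (fun j => fcalc f (h j)) => // j.
by apply: fcalc_norm => // x _.
Qed.

Lemma qle_class t A : (forall j, opnorm (A j) <= t) -> qle t (aclass A : asymp).
Proof. by move=> h; split; exists A. Qed.

Lemma qle_contraction t (x y : asymp) : qle t y -> t < 1 -> x = y * x -> x = 0.
Proof. by move=> [[B e hB]] t1; apply: contraction_eq0 e hB t1. Qed.

Lemma comm_left_inverse (x v w : asymp) : w * v = 1 -> v * w = 1 -> GRing.comm x v -> GRing.comm x w.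
Proof.
move=> wv vw h; rewrite /GRing.comm -[x * w]mul1r -wv -mulrA [v * (x * w)]mulrA -h.
by rewrite -mulrA vw mulr1.
Qed.

End NormBounds.

Section Puncture.
Variables (R : realType) (d : nat -> nat).
Local Notation C := R[i].
Local Notation "x %:C" := (real_complex R x).
Local Notation mxseq := (mxseq R d).
Local Notation asymp := (asymp R d).
Implicit Types (f F G : R -> R).

Variables (rho : R) (rho_gt0 : 0 < rho).

(** How far the radius sqrt x falls short of rho; the argument x is a squared modulus.
    *)
Definition gap x := Num.max (rho - Num.sqrt x) 0.
(** If N = V |N|, then [oddcalc push N] is V (rho - |N|)_+. Added to N, it moves the
    spectrum in the disc of radius rho radially to the boundary circle. *)
Definition push x := (Num.sqrt x)^-1 * gap x.

Lemma gap_ge0 x : 0 <= gap x.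
Proof. by rewrite le_max lexx orbT. Qed.

Lemma gap_le x : gap x <= rho.
Proof. by rewrite ge_max (ltW rho_gt0) andbT gerBl sqrtr_ge0. Qed.

Lemma good_gap : good d gap.
Proof.
exact: (good_max (goodB (good_cst d rho) (good_sqrt (good_id R d))) (good_cst d 0)).
Qed.

Lemma good_sqrt_id : good d (@Num.sqrt R).
Proof. exact: good_sqrt (good_id R d). Qed.

(* Invertible matrices have a unitary polar part at every index, so that the class of
   the polar parts is unitary. *)
Variables (N : mxseq) (bN : bdd N) (uN : forall j, N j \in unitmx).
Hypothesis nN : GRing.comm (aclass N) (aclass (fun j => (N j)^t*)).

Local Notation n := (aclass N).
Local Notation n' := (aclass (fun j => (N j)^t*)).
Local Notation M := (fun j => modsq (N j)).
Local Notation v := (aclass (fun j => polar (N j))).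
Local Notation v' := (aclass (fun j => (polar (N j))^t*)).

Let bN' : bdd (fun j => (N j)^t*) := bdd_adj bN.
Let hM : hermseq M. Proof. by move=> j; exact: herm_modsq. Qed.
Let bM : bdd M := bddM bN' bN.

Let bV : bdd (fun j => polar (N j)).
Proof. by apply: (@bdd_le _ _ 1) => j; apply: opnorm_isometry_le; exact: polar_unitary. Qed.
Let bV' : bdd (fun j => (polar (N j))^t*) := bdd_adj bV.

Lemma class_modsq : aclass M = n' * n.
Proof. by rewrite -(aclassM bN' bN). Qed.

Lemma polarKl : v' * v = 1.
Proof.
rewrite -(aclassM bV' bV) -aclass1; apply: eq_aclass => j.
by rewrite polar_unitary.
Qed.

Lemma polarKr : v * v' = 1.
Proof.
rewrite -(aclassM bV bV') -aclass1; apply: eq_aclass => j.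
by apply: mulmx1C; rewrite polar_unitary.
Qed.

Lemma class_polar : n = v * fc Num.sqrt M.
Proof.
rewrite /fc -(aclassM bV (bdd_fc good_sqrt_id hM bM)); apply: eq_aclass => j.
by rewrite polarE.
Qed.

Lemma class_polar_adj : n' = fc Num.sqrt M * v'.
Proof.
rewrite /fc -(aclassM (bdd_fc good_sqrt_id hM bM) bV'); apply: eq_aclass => j.
exact: etrans (esym (congr1 (fun A => A^t*) (polarE (uN j)))) (adj_mul_herm _ (herm_fcalc _ _)).
Qed.

Lemma sqrt_sqr_class : fc Num.sqrt M * fc Num.sqrt M = aclass M.
Proof.
rewrite -(fcM hM bM good_sqrt_id good_sqrt_id) -(fc_id hM); apply: eq_aclass => j.
by apply: eq_fcalc => x hx /=; rewrite -expr2 sqr_sqrtr // (modsq_spec_ge0 hx).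
Qed.

Lemma comm_normal_fc f y : good d f -> GRing.comm y n -> GRing.comm y n' -> GRing.comm y (fc f M).
Proof.
move=> gf yn yn'; apply: (good_comm gf hM bM); rewrite class_modsq; exact: commrM.
Qed.

(** Normality: v |N|^2 v^* = N N^* = N^* N = |N|^2. *)
Lemma comm_polar_modsq : GRing.comm v (aclass M).
Proof.
rewrite /GRing.comm {2}class_modsq -nN class_polar class_polar_adj.
by rewrite -[in RHS]mulrA -[in RHS]mulrA -[in RHS]mulrA polarKl mulr1 sqrt_sqr_class.
Qed.

Lemma comm_polar_fc f : good d f -> GRing.comm v (fc f M).
Proof. by move=> gf; apply: (good_comm gf hM bM); exact: comm_polar_modsq. Qed.

Lemma comm_polar_n : GRing.comm v n.
Proof.
rewrite class_polar; apply: commrM; [exact: commr_refl|exact: comm_polar_fc good_sqrt_id].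
Qed.

Lemma comm_polar_n' : GRing.comm v n'.
Proof.
rewrite class_polar_adj; apply: commrM; first exact: comm_polar_fc good_sqrt_id.
by rewrite /GRing.comm polarKl polarKr.
Qed.

Lemma pushE j : oddcalc push (N j) = polar (N j) *m fcalc gap (M j).
Proof. by rewrite /polar /oddcalc -mulmxA -fcalcM. Qed.

Lemma class_push : aclass (fun j => oddcalc push (N j)) = v * fc gap M.
Proof.
rewrite /fc -(aclassM bV (bdd_fc good_gap hM bM)); apply: eq_aclass => j.
exact: pushE.
Qed.

Lemma push_bounded j : opnorm (oddcalc push (N j)) <= rho.
Proof.
rewrite pushE; apply: le_trans (opnormM _ _) _; rewrite -[leRHS]mul1r.
apply: ler_pM; rewrite ?opnorm_ge0 //; first by apply: opnorm_isometry_le; exact: polar_unitary.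
by apply: fcalc_norm (ltW rho_gt0) _ => x _; rewrite ger0_norm ?gap_ge0 ?gap_le.
Qed.

Lemma class_push_adj : aclass (fun j => (oddcalc push (N j))^t*) = fc gap M * v'.
Proof.
rewrite /fc -(aclassM (bdd_fc good_gap hM bM) bV'); apply: eq_aclass => j.
exact: etrans (congr1 (fun A => A^t*) (pushE _)) (adj_mul_herm _ (herm_fcalc _ _)).
Qed.

(** |N| is below rho where (rho - |N|)_+ is positive. *)
Lemma small_on_gap : exists2 y, qle rho y & n * fc gap M = y * fc gap M.
Proof.
(* k(|N|^2) = min(|N|, rho) agrees with |N| on the support of the gap. *)
pose k x := Num.min (Num.sqrt x) rho.
have gk : good d k by apply: good_min (good_sqrt (good_id R d)) (good_cst d rho).
exists (v * fc k M).
  rewrite -[rho]mul1r; apply: qleM.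
    by apply: qle_class => j; apply: opnorm_isometry_le; exact: polar_unitary.
  apply: qle_fc (ltW rho_gt0) _ => x.
  by rewrite ger0_norm ?le_min ?sqrtr_ge0 ?(ltW rho_gt0) // ge_min lexx orbT.
have e : fc Num.sqrt M * fc gap M = fc k M * fc gap M.
  rewrite -(fcM hM bM good_sqrt_id good_gap) -(fcM hM bM gk good_gap).
  apply: eq_fc => x /=; rewrite /k /gap.
  by have [h|h] := leP (Num.sqrt x) rho => //; rewrite [Num.max _ _]max_r ?mulr0 // subr_le0 ltW.
by rewrite class_polar -[LHS]mulrA e mulrA.
Qed.

(** |N| + (rho - |N|)_+ is the constant rho where the second term is positive. *)
Lemma pushed_on_gap : (n + v * fc gap M) * fc gap M = rho%:C *: (v * fc gap M).
Proof.
rewrite class_polar -mulrDr -(fcD hM bM good_sqrt_id good_gap) -mulrA.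
have gD := goodD good_sqrt_id good_gap.
rewrite -(fcM hM bM gD good_gap) scalerAr; congr (_ * _).
have -> : rho%:C *: fc gap M = fc (fun=> rho) M * fc gap M by rewrite fc_cst mulr_algl.
rewrite -(fcM hM bM (good_cst d rho) good_gap); apply: eq_fc => x /=; rewrite /gap.
have [h|h] := leP 0 (rho - Num.sqrt x); first by rewrite addrC subrK.
by rewrite !mulr0.
Qed.

(** The modulus has become max(|N|, rho), which is at least rho. *)
Lemma pushed_inverse : exists2 y, qle (rho^-1) y & y * (n + v * fc gap M) = 1.
Proof.
pose k x := (Num.max (Num.sqrt x) rho)^-1.
have k0 x : 0 < Num.max (Num.sqrt x) rho by rewrite lt_max rho_gt0 orbT.
have bk : forall x, `|k x| <= rho^-1.
  move=> x; rewrite ger0_norm ?invr_ge0 ?(ltW (k0 x)) // lef_pV2 ?posrE // ?k0 //.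
  by rewrite le_max lexx orbT.
have lk : locbdd k := locbdd_le bk.
have r0 : 0 <= rho^-1 by rewrite invr_ge0 ltW.
exists (fc k M * v').
  rewrite -[rho^-1]mulr1; apply: qleM; first exact: qle_fc.
  by apply: qle_class => j; rewrite opnorm_adj; apply: opnorm_isometry_le; exact: polar_unitary.
have gD := goodD good_sqrt_id good_gap.
rewrite class_polar -mulrDr -(fcD hM bM good_sqrt_id good_gap) -mulrA [v' * _]mulrA polarKl mul1r.
rewrite -(fcM hM bM lk gD) (_ : 1 = fc (fun=> 1) M); last by rewrite fc_cst rmorph1 scale1r.
apply: eq_fc => x /=; rewrite /k /gap.
suff -> : Num.sqrt x + Num.max (rho - Num.sqrt x) 0 = Num.max (Num.sqrt x) rho.
  by rewrite mulVf // gt_eqF.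
by rewrite addr_maxr addrC subrK addr0 maxC.
Qed.

End Puncture.

(** * Puncturing at finitely many points *)

Section ManyPunctures.
Variables (R : realType) (d : nat -> nat).
Local Notation C := R[i].
Local Notation "x %:C" := (real_complex R x).
Local Notation mxseq := (mxseq R d).
Local Notation asymp := (asymp R d).
Implicit Types (f F G : R -> R).

Lemma normcE (z : C) : `|z| = (normc z)%:C.
Proof. by rewrite normc_def; case: z. Qed.

Lemma normcV_eq (z : C) : normc z^-1 = (normc z)^-1.
Proof. by apply: complexI; rewrite -normcE normfV normcE fmorphV. Qed.

Lemma normcR (x : R) : normc x%:C = `|x|.
Proof. by rewrite /normc /= expr0n addr0 sqrtr_sqr. Qed.

Lemma normc_i : normc ('i : C) = 1.
Proof. by rewrite /normc /= expr0n add0r expr1n sqrtr1. Qed.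

Section Cart.
Variables (X H : mxseq) (hX : hermseq X) (hH : hermseq H) (bX : bdd X) (bH : bdd H).

Lemma class_cart : aclass (fun j => cart (X j) (H j)) = aclass X + 'i *: aclass H.
Proof. by rewrite -(aclassZ _ bH) -(aclassD bX (bddZ _ bH)). Qed.

Lemma bdd_cart : bdd (fun j => cart (X j) (H j)).
Proof. exact: bddD bX (bddZ _ bH). Qed.

Lemma class_cart_adj : aclass (fun j => (cart (X j) (H j))^t*) = aclass X - 'i *: aclass H.
Proof.
rewrite -(aclassZ _ bH) -(aclassB bX (bddZ _ bH)); apply: eq_aclass => j.
exact: cart_adj.
Qed.

End Cart.

Lemma comm_scale (x y : asymp) (c : C) : GRing.comm x y -> GRing.comm x (c *: y).
Proof. by move=> h; rewrite /GRing.comm -scalerAl -scalerAr h. Qed.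

Lemma comm_alg_r (x : asymp) (c : C) : GRing.comm x c%:A.
Proof. exact/commr_sym/comm_alg. Qed.

Lemma comm_parts (x y z : asymp) : GRing.comm z (x + 'i *: y) -> GRing.comm z (x - 'i *: y) ->
  GRing.comm z x /\ GRing.comm z y.
Proof.
move=> h1 h2; have half (u : asymp) : GRing.comm z (u + u) -> GRing.comm z u.
  move=> h; have -> : u = (2^-1 : C) *: (u + u).
    by rewrite -mulr2n -[u *+ 2]scaler_nat scalerA mulVf ?scale1r // pnatr_eq0.
  exact: comm_scale.
split; apply: half.
  by have := commrD h1 h2; rewrite addrACA subrr addr0.
have := comm_scale (- 'i) (commrB h1 h2).
by rewrite opprB addrC addrA subrK -scalerDr scalerA mulNr -expr2 sqrCi opprK scale1r.
Qed.

Definition grid_pt (I : finType) (a b : I -> R) i : C := (a i)%:C + 'i * (b i)%:C.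

Section LocalAnnihilation.
Variables (A B : mxseq) (hA : hermseq A) (hB : hermseq B) (bA : bdd A) (bB : bdd B).
Hypothesis cAB : GRing.comm (aclass A) (aclass B).
Variables (I : finType) (a b : I -> R) (r rho c : R).
Hypotheses (rho_gt0 : 0 < rho) (rho_r : 2 * rho < r) (c_rho : 4 * c <= rho) (c_ge0 : 0 <= c).
Local Notation pt i := (grid_pt a b i).
Hypothesis sep : forall i k, i != k -> r <= normc (pt i - pt k).

Lemma pt_neq i k : i != k -> normc (pt i - pt k) > 0.
Proof.
move=> ik; apply: lt_le_trans (sep ik); apply: lt_trans rho_r.
by rewrite mulr_gt0.
Qed.

(** The scalar pt k - pt i acts on z as y1 - y2, which is too small for that unless z =
    0. *)
Lemma separated_eq0 (m z y1 y2 : asymp) t i k : i != k -> qle t (y1 - y2) -> t < r ->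
  (m - (pt i)%:A) * z = y1 * z -> (m - (pt k)%:A) * z = y2 * z -> z = 0.
Proof.
move=> ik hy tr e1 e2.
have nz : pt k - pt i != 0.
  apply: contraTneq (pt_neq (_ : k != i)) => [->|]; last by rewrite eq_sym.
  by rewrite normc0 ltxx.
apply: (qle_contraction (qleZ (pt k - pt i)^-1 hy)).
  rewrite normcV_eq mulrC ltr_pdivrMr; last by apply: pt_neq; rewrite eq_sym.
  by rewrite mul1r (lt_le_trans tr) // sep // eq_sym.
apply: (scalerI nz); rewrite -scalerAl scalerA divff // scale1r mulrBl -e1 -e2 -mulrBl.
have -> : m - (pt i)%:A - (m - (pt k)%:A) = (pt k - pt i)%:A.
  by rewrite opprB [LHS]addrC addrA subrK scalerBl.
by rewrite mulr_algl.
Qed.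

Lemma clamp_le (u x : R) : `|Num.max (- c) (Num.min c (x - u))| <= c.
Proof. by rewrite ler_norml le_max ge_max ge_min !lexx /= andbT -subr_ge0 opprK addr_ge0. Qed.

Lemma good_clamp (u : R) : good d (fun x => Num.max (- c) (Num.min c (x - u))).
Proof.
exact: (good_max (good_cst d (- c)) (good_min (good_cst d c) (goodB (good_id R d) (good_cst d u)))).
Qed.

Lemma clamp_support (u x F : R) : (F != 0 -> `|x - u| <= c) ->
  (x - u) * F = Num.max (- c) (Num.min c (x - u)) * F.
Proof.
have [->|_] := eqVneq F 0; first by rewrite !mulr0.
move=> /(_ isT); rewrite ler_norml => /andP[h2 h3].
by rewrite (min_r h3) (max_r h2).
Qed.

Lemma local_clamp (E : mxseq) F (u : R) : hermseq E -> bdd E -> good d F ->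
  (forall x, F x != 0 -> `|x - u| <= c) ->
  exists2 y, qle c y & (aclass E - (u%:C)%:A) * fc F E = y * fc F E /\
    forall z, GRing.comm z (aclass E) -> GRing.comm z y.
Proof.
move=> hE bE gF sF.
exists (fc (fun x => Num.max (- c) (Num.min c (x - u))) E).
  by apply: qle_fc => // x; exact: clamp_le.
split; last by move=> z; apply: (good_comm (good_clamp u)).
have gI := goodB (good_id R d) (good_cst d u).
rewrite -(fc_id hE) -(fc_cst E u) -(fcM hE bE (good_clamp u) gF).
rewrite -(fcB hE bE (good_id R d) (good_cst d u)) -(fcM hE bE gI gF).
by apply: eq_fc => x /=; apply: clamp_support; exact: sF.
Qed.

Local Notation x := (aclass A).
Local Notation y := (aclass B).
Variables (g v : I -> asymp).
Hypotheses (gx : forall k, GRing.comm (g k) x) (gy : forall k, GRing.comm (g k) y).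
Hypothesis v_le : forall k, qle 1 (v k).
Hypothesis at_g : forall k, (x + 'i *: y - (pt k)%:A) * g k = (rho%:C *: v k) * g k.
Hypothesis lower : forall i, exists2 w, qle (rho^-1) w &
  forall z, (forall k, k != i -> g k * z = 0) -> w * ((x + 'i *: y - (pt i)%:A) * z) = z.

(** The product z = F(y) G(x) lives within 2c of the point pt i. For another point pt k,
    the element g_k z would also live within rho of pt k, so that it is 0 by
    [separated_eq0]. Hence the lower bound rho for the distance to pt i applies to z,
    and z = 0 because 2c < rho. *)
Lemma local_annihilation i F G : good d F -> good d G ->
  (forall t, F t != 0 -> `|t - b i| <= c) -> (forall t, G t != 0 -> `|t - a i| <= c) ->
  fc F B * fc G A = 0.
Proof.
move=> gF gG sF sG.
have [y1 q1 [e1 c1]] := local_clamp hA bA gG sG.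
have [y2 q2 [e2 c2]] := local_clamp hB bB gF sF.
have xF : GRing.comm x (fc F B) := good_comm gF hB bB cAB.
case: (exist (fun z => z = fc F B * fc G A) (fc F B * fc G A) erefl) => z hz.
rewrite -hz.
have E : (x + 'i *: y - (pt i)%:A) * z = (y1 + 'i *: y2) * z.
  have f1 : (x - ((a i)%:C)%:A) * z = y1 * z.
    have h : GRing.comm (fc F B) (x - ((a i)%:C)%:A).
      by apply: commrB; [exact: commr_sym|exact: comm_alg_r].
    by rewrite hz mulrA -h -mulrA e1 mulrA (c1 _ (commr_sym xF)) mulrA.
  have f2 : (y - ((b i)%:C)%:A) * z = y2 * z by rewrite hz mulrA e2 mulrA.
  rewrite [RHS]mulrDl -[in RHS]scalerAl -f1 -f2 [in RHS]scalerAl -[RHS]mulrDl; congr (_ * _).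
  by rewrite scalerBr addrACA -opprD scalerA -scalerDl.
have zg k : GRing.comm (g k) z.
  rewrite hz; apply: commrM; first exact (good_comm gF hB bB (gy k)).
  exact (good_comm gG hA bA (gx k)).
have qy : qle (2 * c) (y1 + 'i *: y2).
  have -> : 2 * c = c + normc ('i : C) * c by rewrite normc_i mul1r mulr_natl mulr2n.
  by apply: qleD q1 (qleZ _ q2).
have gz k : k != i -> g k * z = 0.
  move=> ki; have ik : i != k by rewrite eq_sym.
  have q3 : qle rho (rho%:C *: v k).
    by have := qleZ rho%:C (v_le k); rewrite normcR mulr1 gtr0_norm.
  apply: (separated_eq0 ik (qleD qy (qleN q3)) _ (m := x + 'i *: y)).
  - by have := rho_r; have := c_rho; have := rho_gt0; lra.
  - by rewrite (zg k) mulrA E -mulrA.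
  - by rewrite mulrA at_g -mulrA.
have [w qw ew] := lower i.
apply: (qle_contraction (qleM qw qy)); last by rewrite -mulrA -E ew.
rewrite mulrC ltr_pdivrMr // mul1r.
by have := c_rho; have := rho_gt0; have := c_ge0; lra.
Qed.

End LocalAnnihilation.

Variables (X H : mxseq) (hX : hermseq X) (hH : hermseq H) (bX : bdd X) (bH : bdd H).
Hypothesis cXH : GRing.comm (aclass X) (aclass H).
Variables (I : finType) (a b : I -> R) (r rho c : R).
Hypotheses (rho_gt0 : 0 < rho) (rho_r : 2 * rho < r) (c_rho : 4 * c <= rho) (c_ge0 : 0 <= c).

Local Notation pt i := (grid_pt a b i).
Hypothesis sep : forall i k, i != k -> r <= normc (pt i - pt k).

Definition shifted_X i : mxseq := fun j => X j - ((a i)%:C)%:M.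
Definition shifted_H i : mxseq := fun j => H j - ((b i)%:C)%:M.
Definition shifted_N i : mxseq := fun j => cart (shifted_X i j) (shifted_H i j).
Hypothesis unitN : forall i j, shifted_N i j \in unitmx.

Definition punctured_X : mxseq := fun j => X j + \sum_i odd_re (push rho) (shifted_X i j) (shifted_H i j).
Definition punctured_H : mxseq := fun j => H j + \sum_i odd_im (push rho) (shifted_X i j) (shifted_H i j).

Lemma herm_shifted_X i : hermseq (shifted_X i).
Proof. by move=> j; apply: hermB; [exact: hX|exact: herm_scalar]. Qed.
Lemma herm_shifted_H i : hermseq (shifted_H i).
Proof. by move=> j; apply: hermB; [exact: hH|exact: herm_scalar]. Qed.
Lemma bdd_shifted_X i : bdd (shifted_X i). Proof. exact: bddB bX (bdd_cst _ _). Qed.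
Lemma bdd_shifted_H i : bdd (shifted_H i). Proof. exact: bddB bH (bdd_cst _ _). Qed.
Lemma bdd_shifted_N i : bdd (shifted_N i). Proof. exact: bdd_cart (bdd_shifted_X i) (bdd_shifted_H i). Qed.

Local Notation x := (aclass X).
Local Notation h := (aclass H).
Local Notation n := (x + 'i *: h).
Local Notation n' := (x - 'i *: h).

Lemma class_shifted_N i : aclass (shifted_N i) = n - (pt i)%:A.
Proof.
rewrite (class_cart (bdd_shifted_X i) (bdd_shifted_H i)) (aclassB bX (bdd_cst _ _)) (aclassB bH (bdd_cst _ _)).
by rewrite !aclass_cst scalerBr addrACA -opprD scalerA -scalerDl.
Qed.

Lemma class_shifted_N_adj i : aclass (fun j => (shifted_N i j)^t*) = n' - (pt i)^*%:A.
Proof.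
rewrite (class_cart_adj (herm_shifted_X i) (herm_shifted_H i) (bdd_shifted_X i) (bdd_shifted_H i)).
rewrite (aclassB bX (bdd_cst _ _)) (aclassB bH (bdd_cst _ _)).
rewrite !aclass_cst scalerBr.
have -> : (pt i)^*%:A = ((a i)%:C)%:A - 'i *: ((b i)%:C)%:A :> asymp.
  by rewrite /grid_pt rmorphD rmorphM /= conjCi !conjR scalerA scalerDl mulNr scaleNr.
rewrite opprB opprB [LHS]addrACA [RHS]addrACA; congr (_ + _); exact: addrC.
Qed.

Lemma comm_nn' : GRing.comm n n'.
Proof.
have xn : GRing.comm x n by apply: commrD; [exact: commr_refl|exact: comm_scale].
have hn : GRing.comm h n.
  by apply: commrD; [exact: commr_sym|apply: comm_scale; exact: commr_refl].
by apply: commrB; [exact: commr_sym|apply: comm_scale; exact: commr_sym].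
Qed.

Lemma normal_shifted_N i : GRing.comm (aclass (shifted_N i)) (aclass (fun j => (shifted_N i j)^t*)).
Proof.
rewrite class_shifted_N class_shifted_N_adj; apply: commrB; last exact: comm_alg_r.
apply: commr_sym; apply: commrB; last exact: comm_alg_r.
exact: commr_sym comm_nn'.
Qed.

Local Notation M i := (fun j => modsq (shifted_N i j)).
Local Notation v i := (aclass (fun j => polar (shifted_N i j))).
Local Notation v' i := (aclass (fun j => (polar (shifted_N i j))^t*)).
Local Notation g i := (fc (gap rho) (M i)).

(** Commutation with both n and its adjoint is what carries over to the functions of
    each shifted modulus. *)
Definition bicommuting (z : asymp) := GRing.comm z n /\ GRing.comm z n'.

Lemma bicommuting_shifted_N z i : bicommuting z ->
  GRing.comm z (aclass (shifted_N i)) /\ GRing.comm z (aclass (fun j => (shifted_N i j)^t*)).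
Proof.
move=> [zn zn']; rewrite class_shifted_N class_shifted_N_adj.
by split; apply: commrB => //; exact: comm_alg_r.
Qed.

Lemma bicommuting_fc z i f : good d f -> bicommuting z -> GRing.comm z (fc f (M i)).
Proof.
by move=> gf /(bicommuting_shifted_N i)[z1 z2]; apply: (comm_normal_fc (bdd_shifted_N i)) gf z1 z2.
Qed.

Lemma bicommuting_of_shifted_N z i : GRing.comm z (aclass (shifted_N i)) ->
  GRing.comm z (aclass (fun j => (shifted_N i j)^t*)) -> bicommuting z.
Proof.
rewrite class_shifted_N class_shifted_N_adj => z1 z2.
by split; [rewrite -(subrK (pt i)%:A n)|rewrite -(subrK (pt i)^*%:A n')];
  apply: commrD => //; exact: comm_alg_r.
Qed.

Lemma bicommuting_v i : bicommuting (v i).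
Proof.
apply: (@bicommuting_of_shifted_N _ i).
  exact: comm_polar_n (bdd_shifted_N i) (unitN i) (normal_shifted_N i).
exact: comm_polar_n' (bdd_shifted_N i) (unitN i) (normal_shifted_N i).
Qed.

Lemma vKl i : v' i * v i = 1. Proof. exact: polarKl (unitN i). Qed.
Lemma vKr i : v i * v' i = 1. Proof. exact: polarKr (unitN i). Qed.

Lemma bicommuting_v' i : bicommuting (v' i).
Proof.
have [h1 h2] := bicommuting_v i.
by split; apply/commr_sym/(comm_left_inverse (vKl i) (vKr i))/commr_sym.
Qed.

Lemma bicommuting_n : bicommuting n /\ bicommuting n'.
Proof.
by split; split; rewrite ?/GRing.comm //; [exact: comm_nn'|exact: commr_sym comm_nn'].
Qed.

Lemma bicommuting_g i : bicommuting (g i).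
Proof.
by have [hn hn'] := bicommuting_n; split; apply/commr_sym/bicommuting_fc => //; exact: good_gap.
Qed.

Lemma v_g i k : GRing.comm (v i) (g k).
Proof. exact/bicommuting_fc/bicommuting_v/good_gap. Qed.
Lemma v'_g i k : GRing.comm (v' i) (g k).
Proof. exact/bicommuting_fc/bicommuting_v'/good_gap. Qed.
Lemma g_g i k : GRing.comm (g i) (g k).
Proof. exact/bicommuting_fc/bicommuting_g/good_gap. Qed.

Lemma rho2_r : rho + rho < r.
Proof. by rewrite -mulr2n -mulr_natl; exact: rho_r. Qed.

(** n cannot be within rho of two points at distance r > 2 rho. *)
Lemma g_disjoint i k : i != k -> g i * g k = 0.
Proof.
move=> ik.
have [y1 q1 e1] := small_on_gap rho_gt0 (bdd_shifted_N i) (unitN i).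
have [y2 q2 e2] := small_on_gap rho_gt0 (bdd_shifted_N k) (unitN k).
rewrite (class_shifted_N i) in e1; rewrite (class_shifted_N k) in e2.
apply: (separated_eq0 rho_gt0 rho_r sep ik (qleD q1 (qleN q2)) rho2_r (m := n)).
  by rewrite mulrA e1 -mulrA.
by rewrite (g_g i k) mulrA e2 -mulrA.
Qed.

Definition displacement i : asymp := v i * g i.
Definition displacement_adj i : asymp := g i * v' i.

Lemma displacement_gap i k : i != k -> displacement i * g k = 0.
Proof. by move=> ik; rewrite /displacement -mulrA g_disjoint // mulr0. Qed.

Local Notation N1 := (aclass (fun j => cart (punctured_X j) (punctured_H j))).
Local Notation N1' := (aclass (fun j => (cart (punctured_X j) (punctured_H j))^t*)).

Lemma bdd_push i : bdd (fun j => oddcalc (push rho) (shifted_N i j)).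
Proof.
apply: (@bdd_le _ _ rho) => j; exact: (push_bounded rho_gt0 (unitN i)).
Qed.

Lemma cart_sum m (F : I -> 'M[C]_m.+1) :
  cart (\sum_i re_part (F i)) (\sum_i im_part (F i)) = \sum_i F i.
Proof.
rewrite /cart scaler_sumr -big_split /=; apply: eq_bigr => i _; exact: cart_parts.
Qed.

Lemma cart1E j : cart (punctured_X j) (punctured_H j) = cart (X j) (H j) + \sum_i oddcalc (push rho) (shifted_N i j).
Proof. by rewrite -cart_sum /punctured_X /punctured_H /cart scalerDr addrACA. Qed.

Lemma class_N1 : N1 = n + \sum_i displacement i.
Proof.
rewrite -(class_cart bX bH).
have <- : aclass (fun j => \sum_i oddcalc (push rho) (shifted_N i j)) = \sum_i displacement i.
  rewrite aclass_sum; last exact: bdd_push.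
  by apply: eq_bigr => i _; rewrite (class_push rho (bdd_shifted_N i) (unitN i)).
rewrite -(aclassD (bdd_cart bX bH) (bdd_sum _ bdd_push)).
by apply: eq_aclass => j; rewrite cart1E.
Qed.

Lemma class_N1' : N1' = n' + \sum_i displacement_adj i.
Proof.
rewrite -(class_cart_adj hX hH bX bH).
have <- : aclass (fun j => \sum_i (oddcalc (push rho) (shifted_N i j))^t*) = \sum_i displacement_adj i.
  rewrite aclass_sum => [|i]; last exact: bdd_adj (bdd_push i).
  by apply: eq_bigr => i _; rewrite (class_push_adj rho (bdd_shifted_N i) (unitN i)).
rewrite -(aclassD (bdd_adj (bdd_cart bX bH)) (bdd_sum _ (fun i => bdd_adj (bdd_push i)))).
apply: eq_aclass => j; rewrite cart1E adjmxD; congr (_ + _).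
by rewrite raddf_sum map_mx_sum.
Qed.

Lemma bicommuting_displacement i : bicommuting (displacement i).
Proof.
by have [h1 h2] := bicommuting_v i; have [h3 h4] := bicommuting_g i;
   split; apply/commr_sym/commrM; exact: commr_sym.
Qed.

Lemma bicommuting_displacement_adj i : bicommuting (displacement_adj i).
Proof.
by have [h1 h2] := bicommuting_v' i; have [h3 h4] := bicommuting_g i;
   split; apply/commr_sym/commrM; exact: commr_sym.
Qed.

(** For i = k both products are the square of the gap, as v is a unitary that commutes
    with it; otherwise both vanish. *)
Lemma displacement_normal i k : GRing.comm (displacement i) (displacement_adj k).
Proof.
have [<-|ik] := eqVneq i k.
  have e1 : displacement i * displacement_adj i = g i * g i.
    by rewrite /displacement /displacement_adj (v_g i i) -(v'_g i i) -mulrA (mulrA (v i)) vKr mul1r.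
  have e2 : displacement_adj i * displacement i = g i * g i by rewrite /displacement /displacement_adj -mulrA (mulrA (v' i)) vKl mul1r.
  by rewrite /GRing.comm e1 e2.
have e1 : displacement i * displacement_adj k = 0.
  by rewrite /displacement /displacement_adj -mulrA (mulrA (g i)) (g_disjoint ik) mul0r mulr0.
have e2 : displacement_adj k * displacement i = 0.
  rewrite /displacement /displacement_adj -(v'_g k k) (v_g i i) -mulrA (mulrA (g k)) (g_disjoint (_ : k != i)).
    by rewrite mul0r mulr0.
  by rewrite eq_sym.
by rewrite /GRing.comm e1 e2.
Qed.

Lemma bicommuting_N1 : bicommuting N1.
Proof.
rewrite class_N1; have [[h1 h2] _] := bicommuting_n.
split; apply/commr_sym/commrD => //; try (exact: commr_sym);
  apply: commr_sum => i _; apply/commr_sym; by case: (bicommuting_displacement i).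
Qed.

Lemma bicommuting_N1' : bicommuting N1'.
Proof.
rewrite class_N1'; have [_ [h1 h2]] := bicommuting_n.
split; apply/commr_sym/commrD => //; try (exact: commr_sym);
  apply: commr_sum => i _; apply/commr_sym; by case: (bicommuting_displacement_adj i).
Qed.

Lemma comm_N1_N1' : GRing.comm N1 N1'.
Proof.
have [hN hN'] := bicommuting_N1; rewrite [N1']class_N1'; apply: commrD => //.
apply: commr_sum => k _; rewrite class_N1; apply/commr_sym/commrD.
  by case: (bicommuting_displacement_adj k).
by apply: commr_sum => i _; apply/commr_sym/displacement_normal.
Qed.

Lemma herm_punctured_X : hermseq punctured_X.
Proof.
by move=> j; apply: hermD; [exact: hX|apply: herm_sum => i; exact: herm_re].
Qed.

Lemma herm_punctured_H : hermseq punctured_H.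
Proof.
by move=> j; apply: hermD; [exact: hH|apply: herm_sum => i; exact: herm_im].
Qed.

Lemma punctured_X_near j : opnorm (punctured_X j - X j) <= #|I|%:R * rho.
Proof.
rewrite /punctured_X addrC addKr; apply: le_trans (opnorm_sum _ _ _) _.
rewrite mulr_natl -sumr_const; apply: ler_sum => i _.
by apply: le_trans (opnorm_re _) _; exact: (push_bounded rho_gt0 (unitN i)).
Qed.

Lemma punctured_H_near j : opnorm (punctured_H j - H j) <= #|I|%:R * rho.
Proof.
rewrite /punctured_H addrC addKr; apply: le_trans (opnorm_sum _ _ _) _.
rewrite mulr_natl -sumr_const; apply: ler_sum => i _.
by apply: le_trans (opnorm_im _) _; exact: (push_bounded rho_gt0 (unitN i)).
Qed.

Lemma bdd_near (A B : mxseq) t : bdd A -> (forall j, opnorm (B j - A j) <= t) -> bdd B.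
Proof.
move=> [[K hK]] hh; apply: (@bdd_le _ _ (t + K)) => j; rewrite -(subrK (A j) (B j)).
by apply: le_trans (opnormD _ _) (lerD _ _).
Qed.

Lemma bdd_punctured_X : bdd punctured_X. Proof. exact: bdd_near bX punctured_X_near. Qed.
Lemma bdd_punctured_H : bdd punctured_H. Proof. exact: bdd_near bH punctured_H_near. Qed.

Local Notation x1 := (aclass punctured_X).
Local Notation h1 := (aclass punctured_H).

Lemma N1E : N1 = x1 + 'i *: h1. Proof. exact: class_cart bdd_punctured_X bdd_punctured_H. Qed.
Lemma N1'E : N1' = x1 - 'i *: h1.
Proof. exact: class_cart_adj herm_punctured_X herm_punctured_H bdd_punctured_X bdd_punctured_H. Qed.

Lemma punctured_comm : GRing.comm x1 h1.
Proof.
have c1 : GRing.comm N1 x1.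
  have c2 : GRing.comm N1 N1 := commr_refl _.
  have c3 := comm_N1_N1'; rewrite [N1']N1'E in c3; rewrite {2}N1E in c2.
  by case: (comm_parts c2 c3).
have c1' : GRing.comm N1' x1.
  have c2 : GRing.comm N1' N1' := commr_refl _.
  have c3 : GRing.comm N1' N1 := commr_sym comm_N1_N1'; rewrite [N1 in GRing.comm _ N1]N1E in c3.
  by rewrite {2}N1'E in c2; case: (comm_parts c3 c2).
have c2 : GRing.comm x1 N1 := commr_sym c1; have c2' : GRing.comm x1 N1' := commr_sym c1'.
by rewrite N1E in c2; rewrite N1'E in c2'; case: (comm_parts c2 c2').
Qed.

Lemma N1_g k : (N1 - (pt k)%:A) * g k = (rho%:C *: v k) * g k.
Proof.
have e := pushed_on_gap rho (bdd_shifted_N k) (unitN k); rewrite class_shifted_N in e.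
rewrite -scalerAl -e class_N1 addrAC mulrDl [in RHS]mulrDl; congr (_ + _).
rewrite mulr_suml (bigD1 k) //= big1 ?addr0 // => i ik; exact: displacement_gap.
Qed.

(** On each gap the new element is rho times a unitary away from its point, and off the
    other gaps its distance to pt i is at least rho: these are the conditions of
    [local_annihilation]. *)
Lemma punctured i F G : good d F -> good d G ->
  (forall y, F y != 0 -> `|y - b i| <= c) -> (forall y, G y != 0 -> `|y - a i| <= c) ->
  fc F punctured_H * fc G punctured_X = 0.
Proof.
apply: (@local_annihilation punctured_X punctured_H herm_punctured_X herm_punctured_H bdd_punctured_X bdd_punctured_H punctured_comm
  I a b r rho c rho_gt0 rho_r c_rho c_ge0 sep (fun k => g k) (fun k => v k)).
- move=> k; have gN := commr_sym (bicommuting_fc k (good_gap d rho) bicommuting_N1).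
  have gN' := commr_sym (bicommuting_fc k (good_gap d rho) bicommuting_N1').
  by rewrite N1E in gN; rewrite N1'E in gN'; case: (comm_parts gN gN').
- move=> k; have gN := commr_sym (bicommuting_fc k (good_gap d rho) bicommuting_N1).
  have gN' := commr_sym (bicommuting_fc k (good_gap d rho) bicommuting_N1').
  by rewrite N1E in gN; rewrite N1'E in gN'; case: (comm_parts gN gN').
- by move=> k; apply: qle_class => j; apply: opnorm_isometry_le; exact: polar_unitary.
- by move=> k; rewrite -N1E N1_g.
move=> k; have [w qw ew] := pushed_inverse rho_gt0 (bdd_shifted_N k) (unitN k).
exists w => // z gz; rewrite -N1E.
suff -> : (N1 - (pt k)%:A) * z = (aclass (shifted_N k) + displacement k) * z by rewrite mulrA ew mul1r.
rewrite class_N1 class_shifted_N addrAC mulrDl [RHS]mulrDl; congr (_ + _).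
rewrite mulr_suml (bigD1 k) //= big1 ?addr0 // => l lk.
by rewrite /displacement -mulrA gz // mulr0.
Qed.

End ManyPunctures.

(** * Half angles on the unit circle *)

Section Circle.
Variables (R : realType).
Local Notation C := R[i].
Local Notation "x %:C" := (real_complex R x).

Definition sign (x : R) : R := if 0 <= x then 1 else -1.
(** For x = cos t this is |cos (t/2)|, and [sin_half] gives |sin (t/2)|. *)
Definition cos_half (x : R) : R := Num.sqrt ((1 + x) / 2).
Definition sin_half (x : R) : R := Num.sqrt ((1 - x) / 2).
(** It is 1/sqrt x near 1 and bounded everywhere, so that [oddcalc] makes an almost
    unitary matrix exactly unitary without changing its class. *)
Definition clamped_invsqrt (x : R) : R := (Num.sqrt (Num.max x (4^-1)))^-1.

Lemma clamped_invsqrt_lipschitz (x : R) : `|clamped_invsqrt x - 1| <= 4 * `|x - 1|.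
Proof.
rewrite /clamped_invsqrt; have [h|h] := leP (4^-1) x.
  have x0 : 0 <= x by apply: le_trans h; rewrite invr_ge0.
  have s2 : 2^-1 <= Num.sqrt x.
    rewrite -(@ler_pXn2r _ 2) ?nnegrE ?sqrtr_ge0 ?invr_ge0 // sqr_sqrtr //.
    by apply: le_trans h; lra.
  rewrite -[in leRHS](sqr_sqrtr x0); move: (Num.sqrt x) s2 => s s2.
  have s0 : 0 < s by lra.
  have -> : s^-1 - 1 = (1 - s) / s by field; rewrite gt_eqF.
  have -> : s ^+ 2 - 1 = (s - 1) * (s + 1) by ring.
  rewrite !normrM normfV (gtr0_norm s0) distrC (gtr0_norm (_ : 0 < s + 1)); last by lra.
  rewrite mulrCA ler_wpM2l ?normr_ge0 //.
  have : s^-1 <= 2 by rewrite -[leRHS]invrK lef_pV2 ?posrE ?invr_gt0.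
  by lra.
have -> : Num.sqrt (4^-1 : R) = 2^-1.
  have -> : (4^-1 : R) = (2^-1) ^+ 2 by rewrite exprVn -natrX.
  by rewrite sqrtr_sqr ger0_norm // invr_ge0.
rewrite invrK (gtr0_norm (_ : 0 < 2 - 1)); last by lra.
by rewrite ltr0_norm; lra.
Qed.

Lemma clamped_invsqrt_bounded (x : R) : `|clamped_invsqrt x| <= 2.
Proof.
rewrite /clamped_invsqrt ger0_norm ?invr_ge0 ?sqrtr_ge0 //.
have h : 2^-1 <= Num.sqrt (Num.max x 4^-1).
  rewrite -(@ler_pXn2r _ 2) ?nnegrE ?sqrtr_ge0 ?invr_ge0 // sqr_sqrtr ?le_max ?invr_ge0 ?ler0n ?orbT //.
  by apply/orP; right; lra.
by rewrite -[leRHS]invrK lef_pV2 ?posrE ?invr_gt0 // (lt_le_trans _ h) // invr_gt0.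
Qed.

Section OneMatrix.
Variable m : nat.
Local Notation n := m.+1.
Implicit Types (A B c s w h q chi : 'M[C]_n).

(** Write h = cos t and q = sin t. On the band chi the pair ([loop_re], [loop_im]) is
    (cos 2t, sin 2t), and off the band it is (1, 0). The products are arranged to be
    hermitian even for matrices that do not commute. *)
Definition loop_re q chi : 'M[C]_n := 1%:M - 2%:R%:C *: (q *m chi *m q).
Definition loop_im h q chi : 'M[C]_n := h *m q *m chi + chi *m (q *m h).

Lemma unitary_parts A B : (A - 'i *: B) *m (A + 'i *: B) = 1%:M ->
  (A + 'i *: B) *m (A - 'i *: B) = 1%:M -> A *m B = B *m A /\ B *m B = 1%:M - A *m A.
Proof.
have hAB : A *m ('i *: B) = 'i *: (A *m B) by rewrite -scalemxAr.
have hBA : ('i *: B) *m A = 'i *: (B *m A) by rewrite -scalemxAl.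
have hBB : ('i *: B) *m ('i *: B) = - (B *m B).
  by rewrite -scalemxAl -scalemxAr scalerA -expr2 sqrCi scaleN1r.
rewrite mulmxDr mulmxBl mulmxBl hAB hBA hBB mulmxDl mulmxBr mulmxBr hAB hBA hBB.
move: (A *m A) (A *m B) (B *m A) (B *m B) => P Q S T e1 e2.
have dbl (U V : 'M[C]_n) : U + U = V + V -> U = V.
  by move=> e; rewrite -(half_sum U) e half_sum.
have e := etrans e1 (esym e2).
split.
  apply: (scalerI (neq0Ci C)); apply: dbl; move: ('i *: Q) ('i *: S) e => Q' S' e.
  have -> : Q' + Q' = (P - S' + (Q' - - T)) - P - T + S' + Q'.
    by apply/matrixP => k l; rewrite !mxE; ring.
  by rewrite e; apply/matrixP => k l; rewrite !mxE; ring.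
apply: dbl; rewrite -{1}e1 -e2; move: ('i *: Q) ('i *: S) => Q' S'.
by apply/matrixP => k l; rewrite !mxE; ring.
Qed.

Lemma sign_sqr x : sign x * sign x = 1.
Proof. by rewrite /sign; case: ifP => _; rewrite ?mulr1 // mulrNN mulr1. Qed.

Lemma sign_abs x : sign x * `|x| = x.
Proof.
rewrite /sign; case: ifP => h; first by rewrite mul1r ger0_norm.
by rewrite mulN1r ltr0_norm ?opprK // ltNge h.
Qed.

Section Angle.
Variables c s : 'M[C]_n.
Hypotheses (hc : herm c) (hs : herm s) (cs : c *m s = s *m c) (one : s *m s = 1%:M - c *m c).
Hypothesis c_le : opnorm c <= 1.

Lemma angle_spec x : in_spec c x -> -1 <= x <= 1.
Proof. by move=> hx; rewrite -ler_norml; apply: le_trans (spec_bound hc hx) c_le. Qed.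

Lemma angle_sign_comm f : fcalc sign s *m fcalc f c = fcalc f c *m fcalc sign s.
Proof.
apply: comm_fcalc => //; apply/esym; apply: comm_fcalc => //.
Qed.

Lemma angle_abs : fcalc (fun x => `|x|) s = fcalc (fun x => 2 * (cos_half x * sin_half x)) c.
Proof.
have -> : fcalc (fun x => `|x|) s = fcalc Num.sqrt (s *m s).
  rewrite -(fcalc_id hs) -fcalcM !fcalc_comp; apply: eq_fcalc => x _ /=.
  by rewrite -expr2 sqrtr_sqr.
rewrite one -{1 2}(fcalc_id hc) -fcalcM -(rmorph1 (real_complex R)) -(fcalc_cst c) -fcalcB fcalc_comp.
apply: eq_fcalc => x /angle_spec /andP[h1 h2] /=.
rewrite /cos_half /sin_half -sqrtrM; last by rewrite divr_ge0 // -lerBlDl sub0r.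
have -> : 1 - x * x = 2 ^+ 2 * ((1 + x) / 2 * ((1 - x) / 2)) by field.
by rewrite [LHS]sqrtrM ?sqr_ge0 // sqrtr_sqr ger0_norm.
Qed.

Lemma angle_sin : s = 2%:R%:C *: (fcalc sign s *m (fcalc cos_half c *m fcalc sin_half c)).
Proof.
rewrite scalemxAr -fcalcM -fcalcZ -angle_abs -fcalcM.
by rewrite -{1}(fcalc_id hs); apply: eq_fcalc => x _ /=; rewrite sign_abs.
Qed.

Lemma angle_sign_sqr : fcalc sign s *m fcalc sign s = 1%:M.
Proof.
rewrite -fcalcM (@eq_fcalc _ _ _ _ (fun=> 1)) ?fcalc_cst ?rmorph1 // => x _ /=.
exact: sign_sqr.
Qed.

Lemma angle_sin_half_sqr : fcalc sin_half c *m fcalc sin_half c = (2^-1)%:C *: (1%:M - c).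
Proof.
rewrite -fcalcM -{2}(fcalc_id hc) -(rmorph1 (real_complex R)) -(fcalc_cst c) -fcalcB -fcalcZ.
apply: eq_fcalc => x /angle_spec /andP[h1 h2] /=.
by rewrite /sin_half -expr2 sqr_sqrtr ?divr_ge0 ?subr_ge0 // mulrC.
Qed.

Lemma angle_cos_half_sqr : fcalc cos_half c *m fcalc cos_half c + fcalc sin_half c *m fcalc sin_half c = 1%:M.
Proof.
rewrite -!fcalcM -fcalcD -(rmorph1 (real_complex R)) -(fcalc_cst c).
apply: eq_fcalc => x /angle_spec /andP[h1 h2] /=.
have p1 : 0 <= (1 + x) / 2 by lra.
have p2 : 0 <= (1 - x) / 2 by lra.
by rewrite /cos_half /sin_half -!expr2 (sqr_sqrtr p1) (sqr_sqrtr p2); field.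
Qed.

(** 1 - cos(t/2) is a multiple of the square of sin(t/2), which confines it to the band.
    *)
Lemma angle_versin : 1%:M - fcalc cos_half c =
  (fcalc sin_half c *m fcalc sin_half c) *m fcalc (fun x => (1 + cos_half x)^-1) c.
Proof.
rewrite -!fcalcM -(rmorph1 (real_complex R)) -(fcalc_cst c) -fcalcB.
apply: eq_fcalc => x /angle_spec /andP[h1 h2] /=.
have c0 : 0 <= cos_half x by exact: sqrtr_ge0.
have e : sin_half x * sin_half x = 1 - cos_half x ^+ 2.
  have p1 : 0 <= (1 + x) / 2 by lra.
  have p2 : 0 <= (1 - x) / 2 by lra.
  by rewrite /cos_half /sin_half -expr2 (sqr_sqrtr p1) (sqr_sqrtr p2); field.
rewrite e; have n0 : 1 + cos_half x != 0 by rewrite gt_eqF // ltr_wpDr.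
by move: (cos_half x) n0 => t n0; field.
Qed.

End Angle.

Lemma spec_near A x (t : R) : herm A -> in_spec A x -> `|x - t| <= opnorm (A - t%:C%:M).
Proof.
move=> hA /(spec_eigvec id)[v [v1]]; rewrite fcalc_id // => e.
have := opnormP (A - t%:C%:M) v; rewrite v1 mulr1 mulmxBl e mul_scalar_mx -scalerBl.
by rewrite -rmorphB l2normZ v1 mulr1 normcR.
Qed.

Lemma modsq_mul_herm A B : herm B -> (A *m B)^t* *m (A *m B) = B *m modsq A *m B.
Proof. by move=> hB; rewrite (adj_mul_herm _ hB) /modsq !mulmxA. Qed.

Lemma clamped_invsqrt_unitary (z : 'M[C]_n) : (forall x, in_spec (modsq z) x -> 4^-1 <= x) ->
  (oddcalc clamped_invsqrt z)^t* *m oddcalc clamped_invsqrt z = 1%:M.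
Proof.
move=> hz; have -> : (oddcalc clamped_invsqrt z)^t* *m oddcalc clamped_invsqrt z =
    fcalc clamped_invsqrt (modsq z) *m fcalc id (modsq z) *m fcalc clamped_invsqrt (modsq z).
  by rewrite (fcalc_id (herm_modsq z)); apply: modsq_mul_herm; exact: herm_fcalc.
rewrite -!fcalcM -(rmorph1 (real_complex R)) -(fcalc_cst (modsq z)).
apply: eq_fcalc => x /hz hx /=; rewrite /clamped_invsqrt max_l //.
have x0 : 0 < x by apply: lt_le_trans hx; rewrite invr_gt0.
rewrite -[X in _ * X * _](sqr_sqrtr (ltW x0)); have : Num.sqrt x != 0 by rewrite sqrtr_eq0 -ltNge.
by move: (Num.sqrt x) => t t0; field.
Qed.

Lemma circle_parts (w : 'M[C]_n) : w^t* *m w = 1%:M ->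
  [/\ herm (re_part w), herm (im_part w), re_part w *m im_part w = im_part w *m re_part w,
      im_part w *m im_part w = 1%:M - re_part w *m re_part w & opnorm (re_part w) <= 1].
Proof.
move=> ww; have ww' := mulmx1C ww.
have e : w = re_part w + 'i *: im_part w := esym (cart_parts w).
have e' : w^t* = re_part w - 'i *: im_part w.
  by rewrite {1}e (cart_adj (herm_re w) (herm_im w)).
have u : (re_part w - 'i *: im_part w) *m (re_part w + 'i *: im_part w) = 1%:M.
  by rewrite -e' -e.
have u' : (re_part w + 'i *: im_part w) *m (re_part w - 'i *: im_part w) = 1%:M.
  by rewrite -e' -e.
have [h1 h2] := unitary_parts u u'; split; [exact: herm_re|exact: herm_im|exact: h1|exact: h2|].
by apply: le_trans (opnorm_re w) _; exact: opnorm_isometry_le.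
Qed.

End OneMatrix.
End Circle.

(** * Half angles in the quotient *)

Section Parts.
Variables (R : realType) (d : nat -> nat).
Local Notation C := R[i].
Local Notation "x %:C" := (real_complex R x).
Local Notation mxseq := (mxseq R d).
Local Notation asymp := (asymp R d).

Lemma bdd_re (Z : mxseq) : bdd Z -> bdd (fun j => re_part (Z j)).
Proof. by move=> [[M hM]]; apply: (@bdd_le _ _ M) => j; apply: le_trans (opnorm_re _) _. Qed.

Lemma bdd_im (Z : mxseq) : bdd Z -> bdd (fun j => im_part (Z j)).
Proof. by move=> [[M hM]]; apply: (@bdd_le _ _ M) => j; apply: le_trans (opnorm_im _) _. Qed.

Lemma class_re (Z W : mxseq) : bdd Z -> bdd W -> aclass Z = aclass W ->
  aclass (fun j => re_part (Z j)) = aclass (fun j => re_part (W j)).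
Proof.
move=> bZ bW e; apply: (aclass_eq (bdd_re bZ) (bdd_re bW)).
apply: (null_le ler01 (aclass_eq0 bZ bW e)) => j; rewrite mul1r.
have -> : re_part (Z j) - re_part (W j) = re_part (Z j - W j).
  by rewrite /re_part -scalerBr adjmxB opprD addrACA.
exact: opnorm_re.
Qed.

Lemma class_im (Z W : mxseq) : bdd Z -> bdd W -> aclass Z = aclass W ->
  aclass (fun j => im_part (Z j)) = aclass (fun j => im_part (W j)).
Proof.
move=> bZ bW e; apply: (aclass_eq (bdd_im bZ) (bdd_im bW)).
apply: (null_le ler01 (aclass_eq0 bZ bW e)) => j; rewrite mul1r.
have -> : im_part (Z j) - im_part (W j) = im_part (Z j - W j).
  rewrite /im_part -scalerBr -scalerBr adjmxB; congr (_ *: (_ *: _)).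
  by move: (Z j) (W j) ((Z j)^t*) ((W j)^t*) => a b a' b'; rewrite !opprD !opprK addrACA.
exact: opnorm_im.
Qed.

Lemma im_cart m (A B : 'M[C]_m.+1) : herm A -> herm B -> im_part (cart A B) = B.
Proof.
move=> hA hB; rewrite /im_part (cart_adj hA hB) /cart opprB addrC addrA subrK -scalerDr (scalerA (- 'i)).
by rewrite mulNr -expr2 sqrCi opprK scale1r half_sum.
Qed.

Lemma fc_one (M : mxseq) (f : R -> R) (L : R) : (forall x, `|f x - 1| <= L * `|x - 1|) ->
  0 <= L -> locbdd f -> hermseq M -> bdd M -> aclass M = 1 -> fc f M = 1.
Proof.
move=> hf L0 lf hM bM M1; rewrite -aclass1 in M1 *.
apply: (aclass_eq (bdd_fc lf hM bM) (bdd_cst _ _)).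
apply: (null_le L0 (aclass_eq0 bM (bdd_cst _ _) M1)) => j.
rewrite -(rmorph1 (real_complex R)) -(fcalc_cst (M j)) -fcalcB fcalc_cst.
apply: fcalc_norm; first by rewrite mulr_ge0 ?opnorm_ge0.
move=> x hx; apply: le_trans (hf x) _; rewrite ler_wpM2l //.
exact: spec_near.
Qed.

End Parts.

Section Corner.
Variables (R : realType) (d : nat -> nat).
Local Notation C := R[i].
Local Notation "x %:C" := (real_complex R x).
Local Notation mxseq := (mxseq R d).
Local Notation asymp := (asymp R d).

Lemma locbdd_sign : locbdd (@sign R).
Proof.
by apply: (@locbdd_le _ _ 1) => x; rewrite /sign; case: ifP => _; rewrite ?normrN normr1.
Qed.

Lemma good_cos_half : good d (@cos_half R).
Proof.
apply: good_sqrt; apply: good_ext (goodZ (2^-1) (goodD (good_cst d 1) (good_id R d))) => x /=.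
exact: mulrC.
Qed.

Lemma good_sin_half : good d (@sin_half R).
Proof.
apply: good_sqrt; apply: good_ext (goodZ (2^-1) (goodB (good_cst d 1) (good_id R d))) => x /=.
exact: mulrC.
Qed.

Definition inv_one_cos_half (x : R) := (1 + cos_half x)^-1.

Lemma locbdd_inv_one_cos_half : locbdd inv_one_cos_half.
Proof.
apply: (@locbdd_le _ _ 1) => x; have c0 : 0 <= cos_half x := sqrtr_ge0 _.
have c1 : 1 <= 1 + cos_half x by rewrite lerDl.
rewrite /inv_one_cos_half ger0_norm ?invr_ge0 ?(le_trans ler01) //.
by rewrite invf_le1 // (lt_le_trans ltr01).
Qed.

Lemma half_sumr (V : lmodType C) (u : V) : (2^-1)%:C *: (u + u) = u.
Proof.
rewrite -(mulr2n u) -[u *+ 2]scaler_nat scalerA -(rmorph_nat (real_complex R) 2) -rmorphM /=.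
by rewrite mulVf ?pnatr_eq0 // rmorph1 scale1r.
Qed.

Section Jump.
Variables (c s : mxseq) (hc : hermseq c) (hs : hermseq s) (bc : bdd c) (bs : bdd s).
Hypothesis circle : exists N, forall j, (N <= j)%N ->
  [/\ c j *m s j = s j *m c j, s j *m s j = 1%:M - c j *m c j & opnorm (c j) <= 1].

Local Notation e_ := (fc (@sign R) s).
Local Notation a_ := (fc (@cos_half R) c).
Local Notation q_ := (fc (@sin_half R) c).
Local Notation i_ := (fc inv_one_cos_half c).

(** The sign is not a good function. Yet the equation s^2 = 1 - c^2 holds exactly for
    the matrices, so that they commute and the sign of s commutes with all functions of
    c. *)
Lemma comm_sign f : locbdd f -> GRing.comm e_ (fc f c).
Proof.
move=> lf; have bf := bdd_fc lf hc bc; have be := bdd_fc locbdd_sign hs bs.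
rewrite /GRing.comm /fc -(aclassM be bf) -(aclassM bf be).
have [N hN] := circle.
apply: (eq_aclass_near (bddM be bf) (bddM bf be) (N := N)) => j /hN[h1 h2 h3].
exact: angle_sign_comm (hc j) (hs j) h1 f.
Qed.

Lemma jump_sign_sqr : e_ * e_ = 1.
Proof.
have be := bdd_fc locbdd_sign hs bs.
rewrite /fc -(aclassM be be) -aclass1; apply: eq_aclass => j; exact: angle_sign_sqr.
Qed.

Lemma class_sin : aclass s = e_ * (a_ * q_) + e_ * (a_ * q_).
Proof.
have be := bdd_fc locbdd_sign hs bs.
have ba := bdd_fc good_cos_half hc bc; have bq := bdd_fc good_sin_half hc bc.
have baq := bddM ba bq; have beaq := bddM be baq.
rewrite /fc -(aclassM ba bq) -(aclassM be baq) -(aclassD beaq beaq).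
have [N hN] := circle.
apply: (eq_aclass_near bs (bddD beaq beaq) (N := N)) => j /hN[h1 h2 h3].
rewrite {1}(angle_sin (hc j) (hs j) h2 h3).
by rewrite (rmorph_nat (real_complex R) 2) scaler_nat mulr2n.
Qed.

Lemma sin_half_sqr : q_ * q_ + q_ * q_ = 1 - aclass c.
Proof.
have bq := bdd_fc good_sin_half hc bc; have bqq := bddM bq bq.
have b1 := bddB (bdd_cst d 1) bc.
rewrite -aclass1 -(aclassB (bdd_cst d 1) bc) /fc -(aclassM bq bq) -(aclassD bqq bqq).
have [N hN] := circle.
apply: (eq_aclass_near (bddD bqq bqq) b1 (N := N)) => j /hN[h1 h2 h3].
by rewrite (angle_sin_half_sqr (hc j) h3) -scalerDr half_sum.
Qed.

Lemma cos_half_sqr : a_ * a_ + q_ * q_ = 1.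
Proof.
have ba := bdd_fc good_cos_half hc bc; have bq := bdd_fc good_sin_half hc bc.
have baa := bddM ba ba; have bqq := bddM bq bq.
rewrite -aclass1 /fc -(aclassM bq bq) -(aclassM ba ba) -(aclassD baa bqq).
have [N hN] := circle.
apply: (eq_aclass_near (bddD baa bqq) (bdd_cst d 1) (N := N)) => j /hN[h1 h2 h3].
exact: angle_cos_half_sqr (hc j) h3.
Qed.

Lemma versin : 1 - a_ = q_ * q_ * i_.
Proof.
have ba := bdd_fc good_cos_half hc bc; have bq := bdd_fc good_sin_half hc bc.
have bi := bdd_fc locbdd_inv_one_cos_half hc bc.
have bqq := bddM bq bq; have b1 := bddB (bdd_cst d 1) ba.
rewrite -aclass1 /fc -(aclassB (bdd_cst d 1) ba) -(aclassM bq bq) -(aclassM bqq bi).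
have [N hN] := circle.
apply: (eq_aclass_near b1 (bddM bqq bi) (N := N)) => j /hN[h1 h2 h3].
exact: angle_versin (hc j) h3.
Qed.

(** For (cos 2t, sin 2t) with sin t >= 0 it is sign(cos t) (1 - |cos t|) = sign(cos t) -
    cos t, made hermitian. *)
Definition jump m (c0 s0 : 'M[C]_m.+1) : 'M[C]_m.+1 :=
  re_part (fcalc (@sign R) s0 *m (1%:M - fcalc (@cos_half R) c0)).

Lemma bdd_jump : bdd (fun j => jump (c j) (s j)).
Proof.
apply: bdd_re; apply: bddM (bdd_fc locbdd_sign hs bs) _.
exact: bddB (bdd_cst d 1) (bdd_fc good_cos_half hc bc).
Qed.

Lemma class_jump : aclass (fun j => jump (c j) (s j)) = e_ * (1 - a_).
Proof.
have be := bdd_fc locbdd_sign hs bs.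
have ba := bdd_fc good_cos_half hc bc; have b1 := bddB (bdd_cst d 1) ba.
have -> : aclass (fun j => jump (c j) (s j)) =
    (2^-1)%:C *: (e_ * (1 - a_) + (1 - a_) * e_).
  rewrite -aclass1 /fc -(aclassB (bdd_cst d 1) ba) -(aclassM be b1) -(aclassM b1 be).
  rewrite -(aclassD (bddM be b1) (bddM b1 be)) -(aclassZ _ (bddD (bddM be b1) (bddM b1 be))).
  apply: eq_aclass => j; congr (_ *: (_ + _)).
  rewrite (adj_mul_herm _ (hermB (adjmx1 _ _) (herm_fcalc _ _))); congr (_ *m _).
  exact: herm_fcalc.
have h : GRing.comm e_ (1 - a_) by apply: commrB (commr1 _) (comm_sign good_cos_half).
by rewrite -h half_sumr.
Qed.

End Jump.

Section Unit.
Variables (A B : mxseq) (hA : hermseq A) (hB : hermseq B) (bA : bdd A) (bB : bdd B).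
Hypothesis cAB : GRing.comm (aclass A) (aclass B).
Hypothesis oneAB : aclass A * aclass A + aclass B * aclass B = 1.

Local Notation z := (fun j => cart (A j) (B j)).
Local Notation M := (fun j => modsq (cart (A j) (B j))).
Local Notation W := (fun j => oddcalc (@clamped_invsqrt R) (cart (A j) (B j))).
Local Notation c := (fun j => odd_re (@clamped_invsqrt R) (A j) (B j)).
Local Notation s := (fun j => odd_im (@clamped_invsqrt R) (A j) (B j)).

Let bz : bdd z := bdd_cart bA bB.
Let hM : hermseq M. Proof. by move=> j; exact: herm_modsq. Qed.
Let bM : bdd M := bddM (bdd_adj bz) bz.

Lemma locbdd_clamped_invsqrt : locbdd (@clamped_invsqrt R).
Proof. exact: locbdd_le (@clamped_invsqrt_bounded R). Qed.

Lemma modulus_sqr (x y : asymp) : GRing.comm x y ->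
  (x - 'i *: y) * (x + 'i *: y) = x * x + y * y.
Proof.
move=> cxy; have e1 : x * ('i *: y) = 'i *: (x * y) by rewrite -scalerAr.
have e2 : ('i *: y) * x = 'i *: (x * y) by rewrite -scalerAl cxy.
have e3 : ('i *: y) * ('i *: y) = - (y * y).
  by rewrite -scalerAl -scalerAr scalerA -expr2 sqrCi scaleN1r.
by rewrite mulrDr mulrBl mulrBl e1 e2 e3 opprK addrA subrK.
Qed.

Lemma class_modsq1 : aclass M = 1.
Proof.
rewrite (aclassM (bdd_adj bz) bz) (class_cart_adj hA hB bA bB) (class_cart bA bB).
by rewrite modulus_sqr.
Qed.

Lemma bW : bdd W.
Proof. exact: bddM bz (bdd_fc locbdd_clamped_invsqrt hM bM). Qed.

Lemma class_W : aclass W = aclass z.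
Proof.
rewrite (aclassM bz (bdd_fc locbdd_clamped_invsqrt hM bM)).
have := fc_one (@clamped_invsqrt_lipschitz R) (ler0n _ 4) locbdd_clamped_invsqrt hM bM class_modsq1.
by rewrite /fc => ->; rewrite mulr1.
Qed.

Lemma class_c : aclass c = aclass A.
Proof.
rewrite (class_re bW bz class_W); apply: eq_aclass => j; exact: re_cart.
Qed.

Lemma class_s : aclass s = aclass B.
Proof.
rewrite (class_im bW bz class_W); apply: eq_aclass => j; exact: im_cart.
Qed.

Lemma bdd_c : bdd c. Proof. exact: bdd_re bW. Qed.
Lemma bdd_s : bdd s. Proof. exact: bdd_im bW. Qed.
Lemma herm_c : hermseq c. Proof. by move=> j; exact: herm_re. Qed.
Lemma herm_s : hermseq s. Proof. by move=> j; exact: herm_im. Qed.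

(** Correcting A + iB to an exact unitary replaces A and B by the two parts of that
    unitary, which satisfy the equation of the circle exactly. *)
Lemma eventually_circle : exists N, forall j, (N <= j)%N ->
  [/\ c j *m s j = s j *m c j, s j *m s j = 1%:M - c j *m c j & opnorm (c j) <= 1].
Proof.
have := class_modsq1; rewrite -aclass1 => e.
have h2 : 0 < 2^-1 :> R by rewrite invr_gt0.
have [N hN] := aclass_le bM (bdd_cst d 1) e h2.
exists N => j /hN hj.
have : (W j)^t* *m W j = 1%:M.
  apply: clamped_invsqrt_unitary => x hx; have := le_trans (spec_near 1 (hM j) hx) hj.
  by rewrite ler_norml; lra.
by case/circle_parts => _ _ h3 h4 h5; split; [exact: h3|exact: h4|exact: h5].
Qed.

End Unit.

End Corner.

(** * Algebra of a cut *)

Section RingAlgebra.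
Variable Q : pzRingType.

(** The letters stand for e = sign s, a = |cos t| and s = sin t on the band. As 1 - a is
    a multiple of s^2, the relation h s = e a s gives h (1 - a) = e a (1 - a). Hence h E
    + E h + E^2 = 2 a (1 - a) + (1 - a)^2 = 1 - a^2. *)
Lemma jump_algebra (h chi q e a s i : Q) :
  (forall x y : Q, x + x = y + y -> x = y) ->
  e * e = 1 -> GRing.comm e a -> GRing.comm e s -> GRing.comm e i ->
  GRing.comm a s -> GRing.comm a i -> GRing.comm s i ->
  GRing.comm h chi -> GRing.comm h q -> s = chi * q ->
  h * (chi * q) + h * (chi * q) = e * (a * s) + e * (a * s) ->
  a * a + s * s = 1 -> 1 - a = s * s * i ->
  let E := e * (1 - a) in
  [/\ h * E + E * h + E * E = s * s, E = (e * i) * (s * s) & E = (s * s) * (i * e)].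
Proof.
move=> half ee ea es ei ca_s ca_i cs_i hchi hq es1 /half hs aa va E.
rewrite -es1 in hs.
have sh : s * h = h * s by rewrite es1; apply/esym; exact: commrM.
have e1a : GRing.comm e (1 - a) by apply: commrB => //; exact: commr1.
have si : s * s * i = i * (s * s) by apply/esym/commrM; exact: commr_sym.
have h1 : h * (1 - a) = e * a * (1 - a).
  by rewrite va !mulrA -(mulrA (h * s)) -(mulrA h) (mulrA h) hs !mulrA.
have h2 : (1 - a) * h = e * a * (1 - a).
  rewrite {1}va si -(mulrA i) -(mulrA s) sh (mulrA s) sh hs va si.
  by rewrite !mulrA -[i * e]ei -(mulrA e i a) -ca_i !mulrA.
split.
- have -> : h * E = a * (1 - a).
    by rewrite /E e1a mulrA h1 -mulrA -e1a mulrA -(mulrA e a e) -ea !mulrA ee mul1r.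
  have -> : E * h = a * (1 - a) by rewrite /E -mulrA h2 !mulrA ee mul1r.
  have -> : E * E = (1 - a) * (1 - a).
    by rewrite /E {1}e1a -mulrA (mulrA e e) ee mul1r.
  have -> : s * s = 1 - a * a by rewrite -aa addrC addKr.
  rewrite -mulrDl -mulrDl; have -> : a + a + (1 - a) = 1 + a by rewrite addrA addrAC addrK addrC.
  by rewrite mulrDl mul1r mulrBr mulr1 addrA subrK.
- by rewrite /E va si mulrA.
by rewrite /E e1a va !mulrA.
Qed.

Section Loop.
Variables h x q : Q.
Hypotheses (chq : GRing.comm h q) (chx : GRing.comm h x) (cxq : GRing.comm x q).
Hypotheses (hq1 : h * h + q * q = 1) (xxq : x * x * q = x * q).

Lemma band_sqr : (x * q) * (x * q) = x * q * q.
Proof. by rewrite -mulrA (mulrA q) -cxq !mulrA xxq. Qed.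

Lemma comm_band : GRing.comm h (x * q).
Proof. exact: commrM. Qed.

Lemma loop_comm :
  GRing.comm (1 - (x * q * q + x * q * q)) (h * (x * q) + h * (x * q)).
Proof.
rewrite -band_sqr.
have cu : GRing.comm (h * (x * q)) (x * q * (x * q)).
  apply/commr_sym; apply: commrM; last by apply/commr_sym/commrM; exact: commr_refl.
  by apply/commr_sym; apply: commrM; exact: comm_band.
apply/commr_sym; apply: commrB; first exact: commr1.
by apply/commr_sym; apply: commrD; apply/commr_sym; apply: commrD.
Qed.

Lemma loop_unit :
  (1 - (x * q * q + x * q * q)) * (1 - (x * q * q + x * q * q)) +
  (h * (x * q) + h * (x * q)) * (h * (x * q) + h * (x * q)) = 1.
Proof.
have cu := comm_band; have uu := band_sqr.
have cuq : GRing.comm (x * q) q by rewrite /GRing.comm mulrA -cxq.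
move: (x * q) cu uu cuq => u cu uu cuq.
have pp : u * q * (u * q) = u * q * (q * q).
  by rewrite -mulrA (mulrA q) -cuq -mulrA mulrA uu.
have hp : GRing.comm h (u * q) by apply: commrM.
have hh : h * u * (h * u) = u * q - u * q * (u * q).
  rewrite -mulrA (mulrA u) -cu -(mulrA h) mulrA uu pp.
  rewrite -[X in X - _]mulr1 -mulrBr -hq1 addrK.
  by rewrite -mulrA hp mulrA hp -mulrA.
move: (u * q) (h * u) hh => p v hv.
have e1 : (v + v) * (v + v) = (p + p) + (p + p) - (p + p) * (p + p).
  rewrite !mulrDl !mulrDr hv; move: (p * p) => w.
  by rewrite (addrACA p) -opprD addrACA -opprD.
rewrite e1; move: (p + p) => t; rewrite mulrBl mul1r mulrBr mulr1.
move: (t * t) => w; rewrite opprB (addrACA 1) -opprD addrA subrK addrK //.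
Qed.
End Loop.

Section Cut.
Variables (I : finType) (h q : Q) (chi E xi xi' : I -> Q).
Hypotheses (hq1 : h * h + q * q = 1)
  (sumE : forall k, h * E k + E k * h + E k * E k = chi k * q * q)
  (El : forall k, E k = xi k * (chi k * q * q)) (Er : forall k, E k = (chi k * q * q) * xi' k)
  (chi_orth : forall k l, k != l -> chi k * chi l * q = 0)
  (chiq : forall k, GRing.comm (chi k) q) (sum_chi : \sum_k chi k = 1).

Lemma E_orth k l : k != l -> E k * E l = 0.
Proof.
move=> kl; rewrite El Er.
have c : GRing.comm (chi l) (q * q) by exact: commrM.
have e : chi k * q * q * (chi l * q * q) = 0.
  rewrite -(mulrA (chi k)) -(mulrA (chi l)) -mulrA (mulrA (q * q)) -c.
  by rewrite !mulrA chi_orth // !mul0r.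
by rewrite -mulrA (mulrA (chi k * q * q)) e mul0r mulr0.
Qed.

(** The corrections E k live on different bands, so that h can be corrected on all of
    them at once. *)
Definition cut := h + \sum_k E k.

(** On the band k the square of h grows by q^2, and the bands add up to 1. *)
Lemma cut_sqr : cut * cut = 1.
Proof.
have e : (\sum_k E k) * (\sum_k E k) = \sum_k E k * E k.
  rewrite mulr_suml; apply: eq_bigr => k _; rewrite mulr_sumr (bigD1 k) //= big1 ?addr0 // => l lk.
  by rewrite E_orth // eq_sym.
have e2 : \sum_k (h * E k + E k * h + E k * E k) = q * q.
  rewrite (eq_bigr (fun k => chi k * (q * q))); last by move=> k _; rewrite sumE mulrA.
  by rewrite -mulr_suml sum_chi mul1r.
rewrite /cut mulrDl !mulrDr e mulr_sumr mulr_suml -hq1 -e2 !big_split /= -!addrA.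
by congr (_ + _).
Qed.

(** On the band k, where E k lives, t is the central element y k. *)
Lemma cut_comm (t : Q) (y : I -> Q) : GRing.comm t h ->
  (forall k, t * (chi k * q) = y k * (chi k * q)) -> (forall k, chi k * q * t = y k * (chi k * q)) ->
  (forall k x, GRing.comm (y k) x) ->
  GRing.comm t cut.
Proof.
move=> th tl tr yc; apply: commrD => //; apply: commr_sum => k _; rewrite /GRing.comm.
have cq : chi k * q * q = q * (chi k * q) by rewrite chiq -mulrA chiq.
have e1 : t * E k = y k * E k by rewrite Er !mulrA -(mulrA t) tl !mulrA.
have e2 : E k * t = y k * E k.
  by rewrite El cq -!mulrA (mulrA (chi k)) tr (yc k (chi k * q)) !mulrA -yc !mulrA.
by rewrite e1 e2.
Qed.

End Cut.
End RingAlgebra.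

(** * Ramps, bands and staircases *)

Section Ramps.
Variables (R : realType) (L : nat) (r c : R).
Hypotheses (c_gt0 : 0 < c) (c_r : 2 * c <= r).

Definition ramp (u x : R) := Num.max 0 (Num.min 1 ((x - u) / (2 * c) + 2^-1)).
(** The nodes have distance r from each other and are symmetric about 0. *)
Definition node (l : nat) : R := (l%:R + 2^-1) * r - L%:R * r / 2.
(** The conventions step 0 = 1 and step k = 0 for k > L make the bands 0, ..., L a
    partition of unity. *)
Definition step (k : nat) (x : R) : R :=
  if k is l.+1 then (if (l < L)%N then ramp (node l) x else 0) else 1.
Definition band (k : nat) (x : R) := step k x - step k.+1 x.
(** A continuous substitute for the sign of x - node i; [wid] measures how far it is
    from being an involution, which it fails to be near the node only. *)
Definition hgt (i : nat) (x : R) := 2 * step i.+1 x - 1.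
Definition wid (i : nat) (x : R) := Num.sqrt (1 - hgt i x * hgt i x).
Definition stair (x : R) := r * \sum_(l < L) (step l.+1 x - 2^-1).

Lemma ramp_ge0 u x : 0 <= ramp u x.
Proof. by rewrite le_max lexx. Qed.

Lemma ramp_le1 u x : ramp u x <= 1.
Proof. by rewrite ge_max ler01 ge_min lexx. Qed.

Lemma ramp_eq0 u x : x <= u - c -> ramp u x = 0.
Proof.
move=> h; rewrite /ramp max_l // ge_min; apply/orP; right.
have : (x - u) / (2 * c) <= - 2^-1; last by lra.
by rewrite ler_pdivrMr ?mulr_gt0 //; lra.
Qed.

Lemma ramp_eq1 u x : u + c <= x -> ramp u x = 1.
Proof.
move=> h; rewrite /ramp min_l ?max_r //.
have : 2^-1 <= (x - u) / (2 * c); last by lra.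
by rewrite ler_pdivlMr ?mulr_gt0 //; lra.
Qed.

Lemma step_ge0 k x : 0 <= step k x.
Proof. by case: k => [|l] //=; case: ifP => // _; exact: ramp_ge0. Qed.

Lemma step_le1 k x : step k x <= 1.
Proof. by case: k => [|l] //=; case: ifP => // _; exact: ramp_le1. Qed.

Lemma node_lt l m : (l < m)%N -> node l + r <= node m.
Proof.
rewrite /node => lm; have : l%:R + 1 <= m%:R :> R by rewrite natr1 ler_nat.
have : 0 <= r by have := c_gt0; have := c_r; lra.
nra.
Qed.

Lemma step_mul k l x : (k < l)%N -> step k x * step l x = step l x.
Proof.
case: l => // l; rewrite ltnS; case: k => [|k] /= kl; first by rewrite mul1r.
case: (ltnP l L) => lL; last by rewrite mulr0.
rewrite (leq_ltn_trans (ltnW kl) lL).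
have [h|h] := leP x (node l - c); first by rewrite (ramp_eq0 h) mulr0.
rewrite [ramp (node k) x]ramp_eq1 ?mul1r //.
by have := node_lt kl; have := c_r; lra.
Qed.

Lemma step_supp k x : step k x * step k x - step k x != 0 ->
  exists2 l, k = l.+1 & (l < L)%N /\ `|x - node l| <= c.
Proof.
case: k => [|l] /=; first by rewrite mulr1 subrr eqxx.
case: ifP => lL; last by rewrite mulr0 subrr eqxx.
move=> h; exists l => //; split=> //; rewrite ler_norml; apply/andP; split.
  have [h2|h2] := leP x (node l - c); last by lra.
  by move: h; rewrite ramp_eq0 // mulr0 subrr eqxx.
have [h2|h2] := leP (node l + c) x; last by lra.
by move: h; rewrite ramp_eq1 // mulr1 subrr eqxx.
Qed.

Lemma hgt_norm i x : -1 <= hgt i x <= 1.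
Proof. by have := step_ge0 i.+1 x; have := step_le1 i.+1 x; rewrite /hgt; lra. Qed.

Lemma hgt_wid i x : hgt i x * hgt i x + wid i x * wid i x = 1.
Proof.
rewrite /wid -[X in _ + X]expr2 sqr_sqrtr; first by rewrite addrC subrK.
by have /andP[h1 h2] := hgt_norm i x; nra.
Qed.

Lemma wid_supp (i : 'I_L) x : wid i x != 0 -> `|x - node i| <= c.
Proof.
move=> h; have [|l [e] [_ hl]] := @step_supp i.+1 x; last by rewrite e.
apply: contraNneq h => h; rewrite /wid /hgt.
by rewrite (_ : 1 - _ = 0) ?sqrtr0 //; move: h; set s := step _ _; nra.
Qed.

Lemma wid_ge0 i x : 0 <= wid i x. Proof. exact: sqrtr_ge0. Qed.

Lemma wid_node (i k : 'I_L) x : wid i x != 0 -> (k < i)%N -> step k.+1 x = 1.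
Proof.
move=> /wid_supp; rewrite ler_norml => /andP[h1 h2] ki /=; rewrite ltn_ord ramp_eq1 //.
by have := node_lt ki; have := c_r; lra.
Qed.

Lemma wid_node' (i k : 'I_L) x : wid i x != 0 -> (i < k)%N -> step k.+1 x = 0.
Proof.
move=> /wid_supp; rewrite ler_norml => /andP[h1 h2] ki /=; rewrite ltn_ord ramp_eq0 //.
by have := node_lt ki; have := c_r; lra.
Qed.

(** Before its node a ramp is 0, and when it starts to rise all the earlier ones have
    reached 1: at most one is rising. *)
Lemma sum_step (K : nat) x : (K <= L)%N -> let z := x + L%:R * r / 2 in
  `|r * (\sum_(l < K) step l.+1 x) - Num.max 0 (Num.min (K%:R * r) z)| <= r /\
  (K%:R * r <= z -> \sum_(l < K) step l.+1 x = K%:R).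
Proof.
have r0 : 0 < r by have := c_gt0; have := c_r; lra.
move=> + z; elim: K => [|K ih] KL.
  rewrite big_ord0 mulr0 mul0r; split => // ; rewrite sub0r normrN.
  have [z0|z0] := leP 0 z; first by rewrite maxxx normr0 ltW.
  by rewrite max_l ?normr0 ltW.
have [ih1 ih2] := ih (ltnW KL); rewrite big_ord_recr /= KL.
have nK : node K = (K%:R + 2^-1) * r - L%:R * r / 2 by [].
have [h|h] := leP z (K%:R * r).
  have e0 : ramp (node K) x = 0.
    by apply: ramp_eq0; rewrite nK; move: h; rewrite /z; have := c_r; lra.
  rewrite e0 addr0; split.
    move: ih1; rewrite (min_r h) min_r //; apply: le_trans h _.
    by rewrite ler_wpM2r ?(ltW r0) // ler_nat.
  by rewrite -natr1 mulrDl mul1r => h2; lra.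
have e1 := ih2 (ltW h); rewrite e1.
have k0 : 0 <= K%:R * r by rewrite mulr_ge0 ?(ltW r0).
have s0 := ramp_ge0 (node K) x; have s1 := ramp_le1 (node K) x.
split; last first.
  rewrite -natr1 mulrDl mul1r => h2; rewrite ramp_eq1 //.
  by rewrite nK; move: h2; rewrite /z; have := c_r; lra.
rewrite mulrDr -(natr1 K) mulrDl mul1r mulrC ler_norml.
have t0 : 0 <= r * ramp (node K) x by rewrite mulr_ge0 ?(ltW r0).
have t1 : r * ramp (node K) x <= r by rewrite ler_piMr ?(ltW r0).
move: (r * ramp _ _) t0 t1 => t t0 t1; move: (K%:R * r) k0 h => a k0 h.
have [h2|h2] := leP (a + r) z; first by rewrite max_r ?addr_ge0 ?(ltW r0) //; lra.
by rewrite max_r; lra.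
Qed.

Lemma stair_near x : `|x| <= L%:R * r / 2 -> `|stair x - x| <= r.
Proof.
move=> hx; have [h _] := sum_step x (leqnn L); move: h.
have -> : stair x = r * \sum_(l < L) step l.+1 x - L%:R * r / 2.
  rewrite /stair sumrB sumr_const card_ord mulrBr; congr (_ - _).
  by rewrite -[_ *+ L]mulr_natl; ring.
move: hx; rewrite ler_norml => /andP[h1 h2]; rewrite min_r; last by lra.
rewrite max_r; last by lra.
by congr (`|_| <= _); ring.
Qed.

Section Good.
Variable d : nat -> nat.

Lemma good_ramp u : good d (ramp u).
Proof.
apply: good_max (good_cst d 0) _; apply: good_min (good_cst d 1) _.
apply: good_ext (goodD (goodZ (2 * c)^-1 (goodB (good_id R d) (good_cst d u))) (good_cst d 2^-1)) => x /=.
by rewrite mulrC.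
Qed.

Lemma good_step k : good d (step k).
Proof.
case: k => [|l]; first exact: good_cst.
case: (boolP (l < L)%N) => lL.
  by apply: good_ext (good_ramp (node l)) => x; rewrite /step lL.
by apply: good_ext (good_cst d 0) => x; rewrite /step (negPf lL).
Qed.

Lemma good_band k : good d (band k).
Proof. exact: goodB (good_step k) (good_step k.+1). Qed.

Lemma good_hgt i : good d (hgt i).
Proof. exact: goodB (goodZ 2 (good_step i.+1)) (good_cst d 1). Qed.

Lemma good_wid i : good d (wid i).
Proof. exact: good_sqrt (goodB (good_cst d 1) (goodM (good_hgt i) (good_hgt i))). Qed.

Lemma good_stair : good d stair.
Proof.
apply: goodZ; apply: good_sum => l; exact: goodB (good_step _) (good_cst d _).
Qed.

End Good.

Lemma nodeN (l : 'I_L) : node (rev_ord l) = - node l.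
Proof.
rewrite /node /= natrB ?ltn_ord // -natr1; by field.
Qed.

Lemma rampN u x : ramp (- u) (- x) = 1 - ramp u x.
Proof.
rewrite /ramp; have -> : (- x - - u) / (2 * c) + 2^-1 = 1 - ((x - u) / (2 * c) + 2^-1) by field; rewrite gt_eqF.
move: ((x - u) / _ + _) => t.
have [h1|h1] := leP t 1; have [h2|h2] := leP 1 (1 - t).
- by rewrite max_r // max_l; lra.
- by rewrite !max_r; lra.
- by lra.
by rewrite max_l ?max_r; lra.
Qed.

Lemma stepN (l : nat) x : (l <= L.+1)%N -> step (L.+1 - l) (- x) = 1 - step l x.
Proof.
case: l => [|l]; first by rewrite subn0 /= ltnn subrr.
rewrite subSS ltnS leq_eqVlt => /orP[/eqP ->|lL]; first by rewrite subnn /= ltnn subr0.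
have -> : (L - l = (rev_ord (Ordinal lL)).+1)%N by rewrite /= subnSK.
by rewrite /step ltn_ord lL nodeN rampN.
Qed.

#[local] Arguments step : simpl never.

Lemma bandN (k : 'I_L.+1) x : band (rev_ord k) (- x) = band k x.
Proof.
have kL : (k <= L)%N by rewrite -ltnS.
have e1 := stepN x (leqW kL); have e2 := @stepN k.+1 x kL; rewrite subSS in e2.
by rewrite /band /= subSS e2 -[(L - k).+1](subSn kL) e1; ring.
Qed.

Lemma stairN x : stair (- x) = - stair x.
Proof.
rewrite /stair -mulrN -sumrN (reindex_inj rev_ord_inj) /=; congr (_ * _).
apply: eq_bigr => l _; have := @stepN l.+1 x (ltnW (ltn_ord l) : (l < L.+1)%N).
rewrite subSS subnSK // => ->; lra.
Qed.

End Ramps.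

(** * The cut at one node *)

Lemma sum_rev_ord (V : nmodType) n (F : 'I_n -> V) : \sum_k F (rev_ord k) = \sum_k F k.
Proof. by rewrite [RHS](reindex_inj rev_ord_inj). Qed.

Section CutMatrices.
Variables (R : realType) (L : nat) (r c : R).
Local Notation C := R[i].
Variable m : nat.
Implicit Types (A B : 'M[C]_m.+1).

(** The correction of h on the band chi: the jump of the loop, which is sign h - h
    there. *)
Definition corner (h q chi : 'M[C]_m.+1) : 'M[C]_m.+1 :=
  jump (odd_re (@clamped_invsqrt R) (loop_re q chi) (loop_im h q chi))
       (odd_im (@clamped_invsqrt R) (loop_re q chi) (loop_im h q chi)).

Definition corner_mx (i k : nat) A B : 'M[C]_m.+1 :=
  corner (fcalc (hgt L r c i) A) (fcalc (wid L r c i) A) (fcalc (band L r c k) B).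

Definition cut_mx (i : nat) A B : 'M[C]_m.+1 :=
  fcalc (hgt L r c i) A + \sum_(k < L.+1) corner_mx i k A B.

Definition sign_mx (i : nat) A B : 'M[C]_m.+1 := fcalc (@sign R) (cut_mx i A B).

Lemma herm_loop_re (q chi : 'M[C]_m.+1) : herm q -> herm chi -> herm (loop_re q chi).
Proof.
by move=> hq hchi; apply: hermB; [exact: adjmx1|apply: hermZ; exact: herm_conj2].
Qed.

Lemma herm_loop_im (h q chi : 'M[C]_m.+1) : herm h -> herm q -> herm chi -> herm (loop_im h q chi).
Proof. exact: herm_anticomm. Qed.

Lemma herm_cut i A B : herm (cut_mx i A B).
Proof. by apply: hermD; [exact: herm_fcalc|apply: herm_sum => k; exact: herm_re]. Qed.

Section Natural.
Variable s : real_automorphism R m.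

Lemma ra_jump (c0 s0 : 'M[C]_m.+1) : herm c0 -> herm s0 ->
  s (jump c0 s0) = jump (s c0) (s s0).
Proof. by move=> h1 h2; rewrite /jump ra_re raM raB ra1 (ra_fcalc _ _ h1) (ra_fcalc _ _ h2). Qed.

Lemma ra_loop_re (q chi : 'M[C]_m.+1) : s (loop_re q chi) = loop_re (s q) (s chi).
Proof. by rewrite /loop_re raB ra1 raZR raM raM. Qed.

Lemma ra_loop_im (h q chi : 'M[C]_m.+1) : s (loop_im h q chi) = loop_im (s h) (s q) (s chi).
Proof. by rewrite /loop_im raD raM raM raM raM. Qed.

Lemma ra_corner (h q chi : 'M[C]_m.+1) : herm h -> herm q -> herm chi ->
  s (corner h q chi) = corner (s h) (s q) (s chi).
Proof.
move=> hh hq hchi; have h1 := herm_loop_re hq hchi; have h2 := herm_loop_im hh hq hchi.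
rewrite /corner (ra_jump (herm_re _) (herm_im _)).
by rewrite (ra_odd_re s _ h1 h2) (ra_odd_im s _ h1 h2) ra_loop_re ra_loop_im.
Qed.

Lemma ra_corner_mx i k A B : herm A -> herm B ->
  s (corner_mx i k A B) = corner_mx i k (s A) (s B).
Proof.
move=> hA hB; rewrite /corner_mx ra_corner; try exact: herm_fcalc.
by rewrite (ra_fcalc s _ hA) (ra_fcalc s _ hA) (ra_fcalc s _ hB).
Qed.

Lemma ra_cut_mx i A B : herm A -> herm B -> s (cut_mx i A B) = cut_mx i (s A) (s B).
Proof.
move=> hA hB; rewrite /cut_mx raD (ra_fcalc s _ hA) ra_sum; congr (_ + _).
by apply: eq_bigr => k _; exact: ra_corner_mx.
Qed.

Lemma ra_sign_mx i A B : herm A -> herm B -> s (sign_mx i A B) = sign_mx i (s A) (s B).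
Proof. by move=> hA hB; rewrite /sign_mx (ra_fcalc s _ (herm_cut _ _ _)) (ra_cut_mx _ hA hB). Qed.

End Natural.

Hypotheses (c_gt0 : 0 < c) (c_r : 2 * c <= r).

Lemma corner_mxN i (k : 'I_L.+1) A B : herm B ->
  corner_mx i (rev_ord k) A (- B) = corner_mx i k A B.
Proof.
move=> hB; rewrite /corner_mx (fcalc_opp _ hB).
by rewrite (eq_fcalc (fun x _ => bandN r c_gt0 k x)).
Qed.

Lemma cut_mxN i A B : herm B -> cut_mx i A (- B) = cut_mx i A B.
Proof.
move=> hB.
refine (congr1 (fun S => fcalc (hgt L r c i) A + S) _).
refine (etrans (esym (sum_rev_ord (fun k : 'I_L.+1 => corner_mx i k A (- B)))) _).
apply: eq_bigr => k _; exact (corner_mxN i k A hB).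
Qed.

Lemma sign_mxN i A B : herm B -> sign_mx i A (- B) = sign_mx i A B.
Proof. by move=> hB; rewrite /sign_mx (cut_mxN _ _ hB). Qed.

End CutMatrices.

Section CutClasses.
Variables (R : realType) (d : nat -> nat) (L : nat) (r c : R).
Hypotheses (c_gt0 : 0 < c) (c_r : 2 * c <= r).
Local Notation C := R[i].
Local Notation "x %:C" := (real_complex R x).
Local Notation mxseq := (mxseq R d).
Local Notation asymp := (asymp R d).

Section Corner.
Variables (H Q X K : mxseq) (hH : hermseq H) (hQ : hermseq Q) (hX : hermseq X).
Variables (bH : bdd H) (bQ : bdd Q) (bX : bdd X) (bK : bdd K).
Hypothesis Q_pos : forall j, Q j = (K j)^t* *m K j.
Local Notation h := (aclass H).
Local Notation q := (aclass Q).
Local Notation x := (aclass X).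
Hypotheses (chq : GRing.comm h q) (chx : GRing.comm h x) (cxq : GRing.comm x q).
Hypotheses (hq1 : h * h + q * q = 1) (xxq : x * x * q = x * q).

Lemma half_eq (u w : asymp) : u + u = w + w -> u = w.
Proof. by move=> e; rewrite -[u]half_sumr e half_sumr. Qed.

Section JumpParts.
Variables (c0 s0 : mxseq) (hc : hermseq c0) (hs : hermseq s0) (bc : bdd c0) (bs : bdd s0).
Hypothesis circle : exists N, forall j, (N <= j)%N ->
  [/\ c0 j *m s0 j = s0 j *m c0 j, s0 j *m s0 j = 1%:M - c0 j *m c0 j & opnorm (c0 j) <= 1].
Hypotheses (ec : aclass c0 = 1 - (x * q * q + x * q * q))
  (es : aclass s0 = h * (x * q) + h * (x * q)).

(** Both elements are positive with the same square, and [aclass_sqrt_intertwine] with Y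
    = 1 makes such elements equal. As x is idempotent against q, the element x q is the
    class of the squares (K X)^* (K X). *)
Lemma sin_half_band : fc (@sin_half R) c0 = x * q.
Proof.
pose rt (t : R) := Num.sqrt (sin_half t).
have lrt : locbdd rt := good_sqrt (good_sin_half R d).
pose K1 : mxseq := fun j => fcalc rt (c0 j).
have bK1 : bdd K1 := bdd_fc lrt hc bc.
pose K2 : mxseq := fun j => K j *m X j.
have bK2 : bdd K2 := bddM bK bX.
have e1 : aclass (fun j => (K1 j)^t* *m K1 j) = fc (@sin_half R) c0.
  apply: eq_aclass => j; rewrite herm_fcalc -fcalcM; apply: eq_fcalc => t _ /=.
  by rewrite -expr2 sqr_sqrtr // sqrtr_ge0.
have e2 : aclass (fun j => (K2 j)^t* *m K2 j) = x * q.
  have -> : aclass (fun j => (K2 j)^t* *m K2 j) = aclass (fun j => X j *m (Q j *m X j)).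
    apply: eq_aclass => j; rewrite /K2 adjmxM Q_pos -[X j in X in X *m _](hX j) trmxCK.
    by rewrite !mulmxA.
  by rewrite (aclassM bX (bddM bQ bX)) (aclassM bQ bX) -cxq mulrA xxq.
have := @aclass_sqrt_intertwine _ _ K1 K2 (fun j => 1%:M) bK1 bK2 (bdd_cst _ 1).
rewrite /= e1 e2 aclass1 !mulr1 !mul1r; apply.
by rewrite (band_sqr cxq xxq); apply: half_eq; rewrite (sin_half_sqr hc bc circle) ec opprB addrC subrK.
Qed.

Lemma jump_parts : exists xi xi',
  let E := aclass (fun j => jump (c0 j) (s0 j)) in
  [/\ h * E + E * h + E * E = x * q * q, E = xi * (x * q * q) & E = (x * q * q) * xi'].
Proof.
exists (fc (@sign R) s0 * fc (@inv_one_cos_half R) c0), (fc (@inv_one_cos_half R) c0 * fc (@sign R) s0).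
move=> E; rewrite /E (class_jump hc hs bc bs circle).
have lc := good_cos_half R d; have lS := good_sin_half R d; have li := @locbdd_inv_one_cos_half R.
have qq : fc (@sin_half R) c0 * fc (@sin_half R) c0 = x * q * q.
  by rewrite sin_half_band (band_sqr cxq xxq).
rewrite -qq; apply: (@jump_algebra _ h x q).
- exact: half_eq.
- exact: jump_sign_sqr.
- exact (comm_sign hc hs bc bs circle lc).
- exact (comm_sign hc hs bc bs circle lS).
- exact (comm_sign hc hs bc bs circle li).
- exact (fc_comm hc bc lc lS).
- exact (fc_comm hc bc lc li).
- exact (fc_comm hc bc lS li).
- exact: chx.
- exact: chq.
- exact: sin_half_band.
- by rewrite -es (class_sin hc hs bc bs circle).
- exact (cos_half_sqr hc bc circle).
exact (versin hc bc circle).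
Qed.

End JumpParts.

Local Notation A := (fun j => loop_re (Q j) (X j)).
Local Notation B := (fun j => loop_im (H j) (Q j) (X j)).

Let hA : hermseq A. Proof. by move=> j; apply: herm_loop_re; [exact: hQ|exact: hX]. Qed.
Let hB : hermseq B.
Proof. by move=> j; apply: herm_loop_im; [exact: hH|exact: hQ|exact: hX]. Qed.
Let bQXQ := bddM (bddM bQ bX) bQ.
Let bA : bdd A. Proof. exact: bddB (bdd_cst d 1) (bddZ _ bQXQ). Qed.
Let bHQX := bddM (bddM bH bQ) bX.
Let bXQH := bddM bX (bddM bQ bH).
Let bB : bdd B. Proof. exact: bddD bHQX bXQH. Qed.

Lemma class_loop_re : aclass A = 1 - (x * q * q + x * q * q).
Proof.
have e : aclass (fun j => 2%:R%:C *: (Q j *m X j *m Q j)) = x * q * q + x * q * q.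
  rewrite (aclassZ _ bQXQ) (aclassM (bddM bQ bX) bQ) (aclassM bQ bX) -cxq.
  by rewrite (rmorph_nat (real_complex R) 2) scaler_nat mulr2n.
by rewrite (aclassB (bdd_cst d 1) (bddZ _ bQXQ)) e aclass1.
Qed.

Lemma class_loop_im : aclass B = h * (x * q) + h * (x * q).
Proof.
rewrite (aclassD bHQX bXQH) (aclassM (bddM bH bQ) bX) (aclassM bH bQ) (aclassM bX (bddM bQ bH)).
by rewrite (aclassM bQ bH) -chq mulrA -chx -mulrA -mulrA -cxq.
Qed.

Let cAB : GRing.comm (aclass A) (aclass B).
Proof. rewrite class_loop_re class_loop_im; exact: loop_comm. Qed.

Let oneAB : aclass A * aclass A + aclass B * aclass B = 1.
Proof. rewrite class_loop_re class_loop_im; exact: loop_unit. Qed.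

(** The two factorizations confine the correction to its band from the left and from the
    right. *)
Lemma corner_parts : exists xi xi',
  let E := aclass (fun j => corner (H j) (Q j) (X j)) in
  [/\ h * E + E * h + E * E = x * q * q, E = xi * (x * q * q) & E = (x * q * q) * xi'].
Proof.
apply: (jump_parts (herm_c A B) (herm_s A B) (bdd_c bA bB) (bdd_s bA bB)).
- exact: eventually_circle hA hB bA bB cAB oneAB.
- by rewrite (class_c hA hB bA bB cAB oneAB) class_loop_re.
by rewrite (class_s hA hB bA bB cAB oneAB) class_loop_im.
Qed.

Lemma bdd_corner : bdd (fun j => corner (H j) (Q j) (X j)).
Proof. exact: bdd_jump (herm_c A B) (herm_s A B) (bdd_c bA bB) (bdd_s bA bB). Qed.

End Corner.
End CutClasses.

(** * The cuts of a punctured pair *)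

#[local] Arguments step : simpl never.

Section ClassRules.
Variables (R : realType) (d : nat -> nat).
Local Notation C := R[i].
Local Notation "x %:C" := (real_complex R x).
Local Notation mxseq := (mxseq R d).
Local Notation asymp := (asymp R d).
Variables (h : mxseq) (hh : hermseq h) (bh : bdd h).

Lemma fc_sum (I : Type) (s : seq I) (F : I -> R -> R) : (forall i, locbdd (F i)) ->
  fc (fun x => \sum_(i <- s) F i x) h = \sum_(i <- s) fc (F i) h.
Proof.
move=> lF; rewrite /fc -(aclass_sum _ (fun i => bdd_fc (lF i) hh bh)).
by apply: eq_aclass => j; rewrite fcalc_sum.
Qed.

Lemma fcZ (t : R) f : locbdd f -> fc (fun x => t * f x) h = t%:C *: fc f h.
Proof.
move=> lf; rewrite /fc -(aclassZ _ (bdd_fc lf hh bh)).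
by apply: eq_aclass => j; rewrite fcalcZ.
Qed.

Lemma fc_eq0 f : f =1 (fun=> 0) -> fc f h = 0.
Proof. by move=> /funext ->; rewrite fc_cst rmorph0 scale0r. Qed.

Lemma fc_mul0 f g : locbdd f -> locbdd g -> (forall x, f x * g x = 0) -> fc f h * fc g h = 0.
Proof. by move=> lf lg e; rewrite -(fcM hh bh lf lg); apply: fc_eq0 => x; exact: e. Qed.

Lemma good_comm2 (A B : mxseq) f g : hermseq A -> hermseq B -> bdd A -> bdd B ->
  GRing.comm (aclass A) (aclass B) -> good d f -> good d g -> GRing.comm (fc f A) (fc g B).
Proof.
move=> hA hB bA bB c gf gg; apply: (good_comm gg hB bB); apply: commr_sym.
exact: (good_comm gf hA bA (commr_sym c)).
Qed.

(** sign x - x is a bounded multiple of 1 - x^2. *)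
Lemma fc_sign : aclass h * aclass h = 1 -> fc (@sign R) h = aclass h.
Proof.
move=> hh1; apply/eqP; rewrite -subr_eq0; apply/eqP.
(* sign x - x = (1 - x^2) sign x / (1 + |x|). *)
pose g (x : R) := sign x / (1 + `|x|).
have lg : locbdd g.
  apply: (@locbdd_le _ _ 1) => x; rewrite /g.
  have n0 := normr_ge0 x; rewrite normrM normfV (ger0_norm (_ : 0 <= 1 + `|x|)) ?addr_ge0 //.
  have -> : `|sign x| = 1 by rewrite /sign; case: ifP => _; rewrite ?normrN normr1.
  by rewrite mul1r invf_le1 ?lerDl // ltr_pwDl.
have l1 : locbdd (fun x : R => 1 - x * x).
  exact: goodB (good_cst d 1) (goodM (good_id R d) (good_id R d)).
have lid : locbdd (@id R) := good_id R d.
rewrite -[X in _ - X](fc_id hh) -(fcB hh bh (@locbdd_sign R) lid).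
have -> : fc (fun x => sign x - id x) h = fc ((fun x => 1 - x * x) \* g) h.
  apply: eq_fc => x; rewrite /= /g /sign; case: ifP => x0.
    rewrite ger0_norm //; field; rewrite gt_eqF //; move: x0; lra.
  move/negbT: x0; rewrite -ltNge => x0; rewrite ltr0_norm //.
  by field; rewrite gt_eqF //; lra.
rewrite (fcM hh bh l1 lg) (fcB hh bh (locbdd_cst 1) (locbddM lid lid)).
by rewrite (fcM hh bh lid lid) (fc_id hh) fc_cst rmorph1 scale1r hh1 subrr mul0r.
Qed.

End ClassRules.

Lemma mulrBmulr (Q : pzRingType) (b c1 c2 w : Q) : b * (c1 - c2) * w = b * c1 * w - b * c2 * w.
Proof. by rewrite mulrBr mulrBl. Qed.

(** When the products are expanded, each term contains one of the four vanishing
    products. *)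
Lemma nested_algebra (Q : pzRingType) (s h w s' h' w' z z' y y' : Q) :
  s - h = z * w -> s - h = w * z' -> s' - h' = y * w' -> s' - h' = w' * y' ->
  (1 - h) * (1 + h') = 0 -> (1 - h) * w' = 0 -> w * (1 + h') = 0 -> w * w' = 0 ->
  GRing.comm h h' -> GRing.comm w w' -> GRing.comm h w' -> GRing.comm w h' ->
  (1 - s) * (1 + s') = 0 /\ (1 + s') * (1 - s) = 0.
Proof.
move=> e1 e2 e3 e4 hh hw wh ww chh cww chw cwh.
have f1 : s = h + z * w by rewrite -e1 addrC subrK.
have f2 : s = h + w * z' by rewrite -e2 addrC subrK.
have f3 : s' = h' + y * w' by rewrite -e3 addrC subrK.
have f4 : s' = h' + w' * y' by rewrite -e4 addrC subrK.
have hh' : (1 + h') * (1 - h) = 0.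
  by rewrite -hh; apply: commrB (commr1 _) (commr_sym (commrD (commr1 _) chh)).
have hw' : w' * (1 - h) = 0.
  rewrite -hw; apply: commrB (commr1 _) (commr_sym chw).
have wh' : (1 + h') * w = 0.
  by rewrite -wh; apply: commr_sym; apply: commrD (commr1 _) cwh.
have ww' : w' * w = 0 by rewrite -cww.
split.
  rewrite f1 f4 opprD !addrA mulrDr mulrDl hh add0r mulNr -mulrA wh mulr0 oppr0 add0r.
  by rewrite mulrA mulrDl hw add0r mulNr -mulrA ww mulr0 oppr0 mul0r.
rewrite f2 f3 opprD !addrA mulrDr mulrDl hh' add0r -mulrA hw' mulr0 add0r.
by rewrite mulrN mulrA mulrDl wh' add0r -(mulrA y) ww' mulr0 mul0r oppr0.
Qed.

#[local] Opaque fc aclass.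

Section StaircaseCuts.
Variables (R : realType) (d : nat -> nat) (L : nat) (r c : R).
Hypotheses (c_gt0 : 0 < c) (c_r : 2 * c <= r).
Local Notation C := R[i].
Local Notation "x %:C" := (real_complex R x).
Local Notation mxseq := (mxseq R d).
Local Notation asymp := (asymp R d).
Variables (A B : mxseq) (hA : hermseq A) (hB : hermseq B) (bA : bdd A) (bB : bdd B).
Hypothesis cAB : GRing.comm (aclass A) (aclass B).
Local Notation node := (node L r).
Local Notation step := (step L r c).
Local Notation band := (band L r c).
Local Notation hgt := (hgt L r c).
Local Notation wid := (wid L r c).
Local Notation stair := (stair L r c).
Hypothesis punct : forall (i l : 'I_L) F G, good d F -> good d G ->
  (forall y, F y != 0 -> `|y - node l| <= c) -> (forall y, G y != 0 -> `|y - node i| <= c) ->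
  fc F B * fc G A = 0.

Local Notation bt k := (fc (step k) B : asymp).
Local Notation ch k := (fc (band k) B : asymp).
Local Notation h i := (fc (hgt i) A : asymp).
Local Notation w i := (fc (wid i) A : asymp).

Let gs k : good d (step k). Proof. exact: good_step. Qed.
Let gb k : good d (band k). Proof. exact: good_band. Qed.
Let gh i : good d (hgt i). Proof. exact: good_hgt. Qed.
Let gw i : good d (wid i). Proof. exact: good_wid. Qed.

Lemma comm_AB f g : good d f -> good d g -> GRing.comm (fc f A : asymp) (fc g B).
Proof. exact: good_comm2. Qed.

(** The function step l is 0 or 1 except near node l, and there the puncture at (node i,
    node l) annihilates wid i. *)
Lemma step_wid_le k l (i : 'I_L) : (k <= l)%N -> bt k * bt l * w i = bt l * w i.
Proof.
rewrite leq_eqVlt => /orP[/eqP ->|kl]; last first.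
  refine (congr1 (fun z => z * w i) _).
  refine (etrans (esym (fcM hB bB (gs k) (gs l))) _).
  by apply: eq_fc => x; exact (step_mul L c_gt0 c_r x kl).
have gF : good d (fun x => step l x * step l x - step l x) := goodB (goodM (gs l) (gs l)) (gs l).
apply/eqP; rewrite -subr_eq0 -mulrBl; apply/eqP.
have -> : bt l * bt l - bt l = fc (fun x => step l x * step l x - step l x) B.
  refine (esym (etrans (fcB hB bB (goodM (gs l) (gs l)) (gs l)) _)).
  exact (congr1 (fun z => z - bt l) (fcM hB bB (gs l) (gs l))).
case: (pselect (exists x, step l x * step l x - step l x != 0)) => [[x]|no]; last first.
  rewrite (fc_eq0 B) ?mul0r // => x; apply/eqP/negPn/negP => hx.
  by apply: no; exists x.
case/(step_supp c_gt0) => l' e [lL _].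
apply: (punct (i := i) (l := Ordinal lL) gF (gw i)) => y; last exact: (wid_supp c_gt0).
by move=> /(step_supp c_gt0)[l2]; rewrite e => -[<-] [].
Qed.

Lemma step_wid k l (i : 'I_L) : bt k * bt l * w i = bt (maxn k l) * w i.
Proof.
case: (leqP k l) => [|/ltnW] kl; first exact: step_wid_le.
by rewrite (fc_comm hB bB (gs k) (gs l)) step_wid_le.
Qed.

Lemma class_band k : ch k = bt k - bt k.+1.
Proof. exact (fcB hB bB (gs k) (gs k.+1)). Qed.

Lemma step_band k l (i : 'I_L) : bt k * ch l * w i = (bt (maxn k l) - bt (maxn k l.+1)) * w i.
Proof.
rewrite class_band; refine (etrans (mulrBmulr _ _ _ _) _).
exact (etrans (congr2 (fun a b => a - b) (step_wid k l i) (step_wid k l.+1 i)) (esym (mulrBl _ _ _))).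
Qed.

Lemma step_band_alg k l (i : 'I_L) : bt k * (ch l * w i) = ((k <= l)%N%:R%:C)%:A * (ch l * w i).
Proof.
refine (etrans (mulrA _ _ _) _); rewrite step_band; case: (leqP k l) => kl.
  by rewrite (maxn_idPr (leqW kl)) class_band rmorph1 scale1r mul1r.
by rewrite (maxn_idPl kl) subrr mul0r rmorph0 scale0r mul0r.
Qed.

Lemma band_sqr_wid k (i : 'I_L) : ch k * ch k * w i = ch k * w i.
Proof.
refine (etrans (esym (mulrA _ _ _)) _); rewrite {1}class_band.
refine (etrans (mulrBl _ _ _) _).
refine (etrans (congr2 (fun a b => a - b) (step_band_alg k k i) (step_band_alg k.+1 k i)) _).
rewrite leqnn ltnn; by rewrite rmorph1 scale1r mul1r rmorph0 scale0r mul0r subr0.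
Qed.

Lemma band_mul_wid k l (i : 'I_L) : k != l -> ch k * ch l * w i = 0.
Proof.
move=> kl; refine (etrans (esym (mulrA _ _ _)) _); rewrite {1}class_band.
refine (etrans (mulrBl _ _ _) _).
refine (etrans (congr2 (fun a b => a - b) (step_band_alg k l i) (step_band_alg k.+1 l i)) _).
by rewrite leq_eqVlt (negPf kl) orFb; exact (subrr _).
Qed.

Lemma sum_bands : \sum_(k < L.+1) ch k = 1.
Proof.
rewrite (eq_bigr (fun k : 'I_L.+1 => bt k - bt k.+1)) => [|k _]; last exact: class_band.
rewrite -(big_mkord predT (fun k => bt k - bt k.+1)).
rewrite (telescope_sumr_eq (fun k => - bt k)) // => [|k _]; last by rewrite opprK addrC.
rewrite opprK addrC (eq_fc B (g := fun=> 1)) // (eq_fc B (f := step _) (g := fun=> 0)) => [|x]; last first.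
  by rewrite /Submission.step ltnn.
by rewrite !fc_cst rmorph1 rmorph0 scale1r scale0r subr0.
Qed.

Definition stair_level (k : nat) : asymp :=
  r%:C *: \sum_(l < L) (((l.+1 <= k)%N%:R%:C)%:A - (2^-1)%:C%:A).

Lemma stair_levelC k (x : asymp) : GRing.comm (stair_level k) x.
Proof.
apply/commr_sym; rewrite /stair_level; apply: comm_scale; apply: commr_sum => l _.
by apply: commrB; exact: comm_alg_r.
Qed.

Lemma stairE : fc stair B = r%:C *: \sum_(l < L) (bt l.+1 - (2^-1)%:C%:A).
Proof.
have lb (l : nat) : locbdd (fun x => step l.+1 x - 2^-1).
  exact: goodB (gs l.+1) (good_cst d 2^-1).
rewrite (fcZ hB bB); last by apply: good_sum => l; exact: goodB (gs l.+1) (good_cst d 2^-1).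
rewrite (fc_sum hB bB _ (fun l : 'I_L => lb l)); congr (_ *: _); apply: eq_bigr => l _.
by rewrite (fcB hB bB (gs l.+1) (locbdd_cst _)) fc_cst.
Qed.

(** The staircase is constant between two consecutive nodes. *)
Lemma stair_band k (i : 'I_L) : fc stair B * (ch k * w i) = stair_level k * (ch k * w i).
Proof.
rewrite stairE /stair_level -!scalerAl; congr (_ *: _); rewrite !mulr_suml.
apply: eq_bigr => l _; refine (etrans (mulrBl _ _ _) _); refine (etrans _ (esym (mulrBl _ _ _))).
exact (congr1 (fun a => a - _) (step_band_alg l.+1 k i)).
Qed.

Let cQ i k : GRing.comm (ch k) (w i).
Proof. exact: commr_sym (comm_AB (gw i) (gb k)). Qed.

Local Notation E i k := (aclass (fun j => corner_mx L r c i k (A j) (B j)) : asymp).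
Local Notation S i := (aclass (fun j => cut_mx L r c i (A j) (B j)) : asymp).

Lemma wid_root i j : fcalc (wid i) (A j) =
  (fcalc (fun x => Num.sqrt (wid i x)) (A j))^t* *m fcalc (fun x => Num.sqrt (wid i x)) (A j).
Proof.
rewrite fcalc_herm -fcalcM; apply: eq_fcalc => x _ /=.
by rewrite -expr2 sqr_sqrtr // wid_ge0.
Qed.

Lemma hgt_wid_class i : h i * h i + w i * w i = 1.
Proof.
refine (etrans (congr2 +%R (esym (fcM hA bA (gh i) (gh i))) (esym (fcM hA bA (gw i) (gw i)))) _).
refine (etrans (esym (fcD hA bA (goodM (gh i) (gh i)) (goodM (gw i) (gw i)))) _).
by rewrite (eq_fc A (g := fun=> 1)) ?fc_cst ?rmorph1 ?scale1r // => x; exact: hgt_wid.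
Qed.

Let hh i : hermseq (fun j => fcalc (hgt i) (A j)). Proof. by move=> j; exact: herm_fcalc. Qed.
Let hw i : hermseq (fun j => fcalc (wid i) (A j)). Proof. by move=> j; exact: herm_fcalc. Qed.
Let hb k : hermseq (fun j => fcalc (band k) (B j)). Proof. by move=> j; exact: herm_fcalc. Qed.

Lemma corner_class (i : 'I_L) (k : 'I_L.+1) : exists xi : asymp * asymp,
  [/\ h i * E i k + E i k * h i + E i k * E i k = ch k * w i * w i,
      E i k = xi.1 * (ch k * w i * w i) & E i k = (ch k * w i * w i) * xi.2].
Proof.
have [xi [xi' xiP]] := corner_parts (hh i) (hw i) (hb k) (bdd_fc (gh i) hA bA)
  (bdd_fc (gw i) hA bA) (bdd_fc (gb k) hB bB)
  (bdd_fc (good_sqrt (gw i)) hA bA) (wid_root i) (fc_comm hA bA (gh i) (gw i))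
  (comm_AB (gh i) (gb k)) (cQ i k) (hgt_wid_class i) (band_sqr_wid k i).
by exists (xi, xi').
Qed.

Lemma bdd_corner_mx i k : bdd (fun j => corner_mx L r c i k (A j) (B j)).
Proof.
exact (bdd_corner (bdd_fc (gh i) hA bA) (bdd_fc (gw i) hA bA) (bdd_fc (gb k) hB bB)).
Qed.

Lemma bdd_cut i : bdd (fun j => cut_mx L r c i (A j) (B j)).
Proof.
exact (bddD (bdd_fc (gh i) hA bA) (bdd_sum _ (fun k : 'I_L.+1 => bdd_corner_mx i k))).
Qed.

Lemma cutE i : S i = cut (h i) (fun k : 'I_L.+1 => E i k).
Proof.
rewrite /cut -(aclass_sum _ (fun k : 'I_L.+1 => bdd_corner_mx i k)).
by rewrite -(aclassD (bdd_fc (gh i) hA bA) (bdd_sum _ (fun k : 'I_L.+1 => bdd_corner_mx i k))).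
Qed.

Lemma cut_facts (i : 'I_L) : [/\ S i * S i = 1, GRing.comm (fc stair B) (S i),
  exists z, S i - h i = z * w i & exists z, S i - h i = w i * z].
Proof.
have [xi xiP] := choice (corner_class i).
have cE (k : 'I_L.+1) : E i k = (xi k).1 * (ch k * w i * w i) by case: (xiP k).
have cE' (k : 'I_L.+1) : E i k = (ch k * w i * w i) * (xi k).2 by case: (xiP k).
rewrite cutE; split.
- apply: (cut_sqr (hgt_wid_class i) _ cE cE' _ _ sum_bands) => k.
  + by case: (xiP k).
  + by move=> l kl; exact: band_mul_wid.
  exact: cQ.
- apply: (cut_comm cE cE' (cQ i) _ (fun k => stair_band k i) _ (fun k x => stair_levelC k x)).
    exact (commr_sym (comm_AB (gh i) (good_stair L r c d))).
  move=> k; refine (etrans _ (stair_band k i)).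
  apply: commr_sym; apply: commrM.
    exact (fc_comm hB bB (good_stair L r c d) (gb k)).
  exact (commr_sym (comm_AB (gw i) (good_stair L r c d))).
- exists (\sum_(k < L.+1) (xi k).1 * (ch k * w i)).
  rewrite /cut addrC addKr mulr_suml; apply: eq_bigr => k _.
  by rewrite {1}cE; exact (mulrA _ _ _).
exists (\sum_(k < L.+1) (ch k * w i) * (xi k).2).
rewrite /cut addrC addKr mulr_sumr; apply: eq_bigr => k _.
rewrite {1}cE'; refine (etrans _ (esym (mulrA _ _ _))).
refine (congr1 (fun z => z * _) _); refine (etrans _ (esym (mulrA _ _ _))).
exact (congr1 (fun z => z * _) (cQ i k)).
Qed.

Local Notation s i := (aclass (fun j => sign_mx L r c i (A j) (B j)) : asymp).

Lemma sign_class (i : 'I_L) : s i = S i.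
Proof.
have [SS _ _ _] := cut_facts i.
exact (fc_sign (fun j => herm_cut L r c i (A j) (B j)) (bdd_cut i) SS).
Qed.

Lemma sign_facts (i : 'I_L) : [/\ s i * s i = 1, GRing.comm (fc stair B) (s i),
  exists z, s i - h i = z * w i & exists z, s i - h i = w i * z].
Proof. rewrite (sign_class i); exact: cut_facts. Qed.

Section Nested.
Variables (i i' : 'I_L) (lt_ii' : (i < i')%N).

Let one_sub_h k : fc (fun x => 1 - hgt k x) A = 1 - h k.
Proof.
refine (etrans (fcB hA bA (good_cst d 1) (gh k)) _).
by rewrite fc_cst rmorph1 scale1r.
Qed.

Let one_add_h k : fc (fun x => 1 + hgt k x) A = 1 + h k.
Proof.
refine (etrans (fcD hA bA (good_cst d 1) (gh k)) _).
by rewrite fc_cst rmorph1 scale1r.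
Qed.

Let l1 k : locbdd (fun x => 1 - hgt k x). Proof. exact: goodB (good_cst d 1) (gh k). Qed.
Let l2 k : locbdd (fun x => 1 + hgt k x). Proof. exact: goodD (good_cst d 1) (gh k). Qed.

Lemma nested_hh : (1 - h i) * (1 + h i') = 0.
Proof.
rewrite -one_sub_h -one_add_h; apply: (fc_mul0 hA bA (l1 i) (l2 i')) => x.
rewrite /Submission.hgt; have := @step_mul R L r c c_gt0 c_r i.+1 i'.+1 x lt_ii'.
move: (step _ x) (step _ x) => a b; lra.
Qed.

Lemma nested_hw : (1 - h i) * w i' = 0.
Proof.
rewrite -one_sub_h; apply: (fc_mul0 hA bA (l1 i) (gw i')) => x.
have [->|] := eqVneq (wid i' x) 0; first by rewrite mulr0.
move/(wid_node c_gt0 c_r) => /(_ i lt_ii'); rewrite /Submission.hgt => ->; lra.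
Qed.

Lemma nested_wh : w i * (1 + h i') = 0.
Proof.
rewrite -one_add_h; apply: (fc_mul0 hA bA (gw i) (l2 i')) => x.
have [->|] := eqVneq (wid i x) 0; first by rewrite mul0r.
move/(wid_node' c_gt0 c_r) => /(_ i' lt_ii'); rewrite /Submission.hgt => ->; lra.
Qed.

Lemma nested_ww : w i * w i' = 0.
Proof.
apply: (fc_mul0 hA bA (gw i) (gw i')) => x.
have [->|] := eqVneq (wid i x) 0; first by rewrite mul0r.
move/(wid_node' c_gt0 c_r) => /(_ i' lt_ii'); rewrite /Submission.wid /Submission.hgt => ->.
by rewrite mulr0 sub0r mulrNN mulr1 subrr sqrtr0 mulr0.
Qed.

(** Away from node i the cut is hgt i, a function of A; so the cuts at different nodes
    are nested like the steps. *)
Lemma nested_signs : (1 - s i) * (1 + s i') = 0 /\ (1 + s i') * (1 - s i) = 0.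
Proof.
have [_ _ [z ez] [z' ez']] := sign_facts i; have [_ _ [y ey] [y' ey']] := sign_facts i'.
apply: (nested_algebra ez ez' ey ey' nested_hh nested_hw nested_wh nested_ww).
- exact (fc_comm hA bA (gh i) (gh i')).
- exact (fc_comm hA bA (gw i) (gw i')).
- exact (fc_comm hA bA (gh i) (gw i')).
exact (fc_comm hA bA (gw i) (gh i')).
Qed.

End Nested.
End StaircaseCuts.

(** * Rounding the levels *)

Section Rounding.
Variables (R : realType) (L : nat).

(** The nearest integer among 0, ..., L: [find] returns L when x is beyond all
    thresholds. *)
Definition round (x : R) : nat := find (fun i : nat => x < i%:R + 2^-1) (iota 0 L).
(** The cofactor of x - round x in the product of the x - k. It is bounded below, so
    that x and round x agree in the quotient as soon as the product vanishes there. *)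
Definition rounding_error (x : R) : R := \prod_(k < L.+1 | k != round x :> nat) (x - k%:R).

Lemma round_le x : (round x <= L)%N.
Proof. by rewrite -[leqRHS](size_iota 0 L); exact: find_size. Qed.

Lemma round_far x k : (k <= L)%N -> k != round x -> 2^-1 <= `|x - k%:R|.
Proof.
move=> kL; rewrite neq_ltn => /orP[lt|lt].
  have := before_find 0 lt; rewrite nth_iota ?add0n; last exact: leq_trans lt (round_le x).
  move/negbT; rewrite -leNgt => h.
  by rewrite ger0_norm; lra.
have rL : (round x < L)%N by exact: leq_trans lt kL.
have hs : has (fun i : nat => x < i%:R + 2^-1) (iota 0 L) by rewrite has_find size_iota.
have := nth_find 0 hs; rewrite -/(round x) nth_iota // add0n.
have : (round x)%:R + 1 <= k%:R :> R by rewrite natr1 ler_nat.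
by move=> h1 h2; rewrite ltr0_norm; lra.
Qed.

Lemma rounding_error_ge x : 2^-1 ^+ L.+1 <= `|rounding_error x|.
Proof.
rewrite /rounding_error normr_prod.
have -> : 2^-1 ^+ L.+1 = \prod_(k < L.+1) 2^-1 :> R by rewrite prodr_const card_ord.
rewrite [leRHS]big_mkcond /=; apply: ler_prod => k _; rewrite invr_ge0 ler0n /=.
case: ifP => [hk|_]; first exact: (round_far (ltn_ord k) hk).
by rewrite invf_le1 ?ler1n.
Qed.

Lemma round_product x : \prod_(k < L.+1) (x - k%:R) = (x - (round x)%:R) * rounding_error x.
Proof.
rewrite (bigD1 (Ordinal (round_le x : (round x < L.+1)%N))) //=; congr (_ * _).
Qed.

End Rounding.

Section NestedProjections.
Variables (Q : pzRingType) (p : nat -> Q).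

(** Let p be the last projection. On 1 - p the sum is the previous one, whose values are
    at most L; on p, which is below all the others, it is the constant L + 1. *)
Lemma nested_sum_roots L :
  (forall i, (i < L)%N -> p i * p i = p i) ->
  (forall i k, (i < k < L)%N -> p i * p k = p k /\ p k * p i = p k) ->
  \prod_(k < L.+1) (\sum_(i < L) p i - k%:R) = 0.
Proof.
elim: L => [|L ih] idem nest; first by rewrite big_ord_recl !big_ord0 subr0 mul0r.
have {}ih : \prod_(k < L.+1) (\sum_(i < L) p i - k%:R) = 0.
  apply: ih => [i h|i k /andP[ik kL]]; first exact: idem (leqW h).
  by apply: nest; rewrite ik leqW.
under eq_bigr => k _ do rewrite big_ord_recr /=.
set N := \sum_(i < L) p i in ih *.
have Np : N * p L = p L *+ L.
  rewrite /N mulr_suml (eq_bigr (fun=> p L)) ?sumr_const ?card_ord // => i _.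
  by case: (nest i L) => //; rewrite ltn_ord ltnSn.
have pN : p L * N = p L *+ L.
  rewrite /N mulr_sumr (eq_bigr (fun=> p L)) ?sumr_const ?card_ord // => i _.
  by case: (nest i L) => //; rewrite ltn_ord ltnSn.
have pp : p L * p L = p L by exact: idem.
move: (p L) Np pN pp => q Np pN pp.
have cN (k : nat) : (N + q - k%:R) * (1 - q) = (1 - q) * (N - k%:R).
  rewrite addrAC mulrDl (mulrBr q) mulr1 pp subrr addr0.
  apply: commrB; first exact: commr1.
  by apply: commr_sym; apply: commrB; [rewrite /GRing.comm Np pN|exact: commr_nat].
have prodN n : (\prod_(k < n) (N + q - k%:R)) * (1 - q) = (1 - q) * \prod_(k < n) (N - k%:R).
  elim: n => [|n ihn]; first by rewrite !big_ord0 mul1r mulr1.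
  by rewrite !big_ord_recr /= -mulrA cN mulrA ihn mulrA.
set P := \prod_(k < L.+2) _.
have e1 : P * (1 - q) = 0 by rewrite prodN big_ord_recr /= ih mul0r mulr0.
have e2 : P * q = 0.
  by rewrite /P big_ord_recr /= -mulrA mulrBl mulrDl Np pp mulr_natl -mulrSr subrr mulr0.
by rewrite -[P]mulr1 -(subrK q 1) mulrDr e1 e2 addr0.
Qed.

End NestedProjections.

Section Pythagoras.
Variables (R : realType) (m : nat).
Local Notation C := R[i].
Local Notation M := 'M[C]_m.+1.

Lemma l2norm_orth_sum (I : finType) (P : pred I) (u : I -> 'cV[C]_m.+1) :
  (forall i k, i != k -> inner (u i) (u k) = 0) ->
  l2norm (\sum_(i | P i) u i) ^+ 2 = \sum_(i | P i) l2norm (u i) ^+ 2.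
Proof.
move=> orth.
have ir (v : 'cV[C]_m.+1) : inner v (\sum_(i | P i) u i) = \sum_(i | P i) inner v (u i).
  by apply: (big_morph (inner v)) => [x y|]; [exact: innerDr|by rewrite -(scale0r (0 : 'cV[C]_m.+1)) innerZr mul0r].
have il (v : 'cV[C]_m.+1) : inner (\sum_(i | P i) u i) v = \sum_(i | P i) inner (u i) v.
  by apply: (big_morph (fun x => inner x v)) => [x y|]; [exact: innerDl|exact: inner0l].
rewrite l2norm_sqr il (eq_bigr (fun i => inner (u i) (u i))) => [|i Pi].
  rewrite (big_morph (@complex.Re R) (id1 := 0) (op1 := +%R)) //; last exact: ReD.
  by apply: eq_bigr => i _; rewrite l2norm_sqr.
by rewrite ir (bigD1 i) //= big1 ?addr0 // => k /andP[_ ki]; rewrite orth // eq_sym.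
Qed.

Lemma proj_norm (e : M) v : herm e -> e *m e = e -> l2norm (e *m v) <= l2norm v.
Proof.
move=> he ee; have [->|n0] := eqVneq (l2norm (e *m v)) 0; first exact: l2norm_ge0.
have n1 : 0 < l2norm (e *m v) by rewrite lt_def n0 l2norm_ge0.
rewrite -(ler_pM2r n1) -expr2 l2norm_sqr inner_adj he mulmxA ee.
exact: cauchy_schwarz.
Qed.

(** The terms have orthogonal ranges and orthogonal supports, so that their norms do not
    add up. This keeps the error independent of the number of nodes. *)
Lemma opnorm_orth_sum (I : finType) (e T : I -> M) (t : R) : 0 <= t ->
  (forall i, herm (e i)) -> (forall i, e i *m e i = e i) ->
  (forall i k, i != k -> e i *m e k = 0) -> (forall i, opnorm (T i) <= t) ->
  opnorm (\sum_i e i *m T i *m e i) <= t.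
Proof.
move=> t0 he ee eo hT.
have hS : herm (\sum_i e i) by exact: herm_sum.
have SS : (\sum_i e i) *m (\sum_i e i) = \sum_i e i.
  rewrite mulmx_suml; apply: eq_bigr => i _.
  by rewrite mulmx_sumr (bigD1 i) //= big1 ?addr0 ?ee // => k ki; rewrite eo // eq_sym.
have orth (u w : I -> 'cV[C]_m.+1) i k : i != k -> inner (e i *m u i) (e k *m w k) = 0.
  move=> ik; rewrite inner_adj he mulmxA eo // mul0mx.
  by rewrite -(scale0r (0 : 'cV[C]_m.+1)) innerZr mul0r.
apply: opnorm_le => // v.
rewrite -(@ler_pXn2r _ 2) ?nnegrE ?mulr_ge0 ?l2norm_ge0 // exprMn mulmx_suml.
rewrite (eq_bigr (fun i => e i *m (T i *m (e i *m v)))) => [|i _]; last by rewrite !mulmxA.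
rewrite l2norm_orth_sum; last exact: orth (fun i => T i *m (e i *m v)) (fun i => T i *m (e i *m v)).
apply: (@le_trans _ _ (\sum_i t ^+ 2 * l2norm (e i *m v) ^+ 2)).
  apply: ler_sum => i _; rewrite -exprMn ler_pXn2r ?nnegrE ?mulr_ge0 ?l2norm_ge0 //.
  apply: le_trans (proj_norm _ (he i) (ee i)) _; apply: le_trans (opnormP _ _) _.
  by rewrite ler_wpM2r ?l2norm_ge0.
rewrite -mulr_sumr -(l2norm_orth_sum xpredT (orth (fun=> v) (fun=> v))) ler_wpM2l ?exprn_ge0 //.
by rewrite -mulmx_suml ler_pXn2r ?nnegrE ?l2norm_ge0 // proj_norm.
Qed.

End Pythagoras.

Section RoundingClass.
Variables (R : realType) (d : nat -> nat) (L : nat).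
Local Notation C := R[i].
Local Notation "x %:C" := (real_complex R x).
Local Notation asymp := (asymp R d).
Variables (M : mxseq R d) (hM : hermseq M) (bM : bdd M).

Lemma locbdd_rootprod n : locbdd (fun x : R => \prod_(k < n) (x - k%:R)).
Proof.
elim: n => [|n ih].
  by apply: (@locbdd_le _ _ 1) => x; rewrite big_ord0 normr1.
have h : locbdd ((fun x : R => \prod_(k < n) (x - k%:R)) \* (fun x => x - n%:R)).
  exact (locbddM ih (goodB (good_id R d) (good_cst d n%:R))).
by apply: (locbdd_dom h) => x; rewrite big_ord_recr.
Qed.

Lemma fc_rootprod n : fc (fun x : R => \prod_(k < n) (x - k%:R)) M = \prod_(k < n) (aclass M - k%:R).
Proof.
elim: n => [|n ih].
  rewrite big_ord0 (eq_fc M (g := fun=> 1)) => [|x]; last by rewrite big_ord0.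
  by rewrite fc_cst rmorph1 scale1r.
rewrite big_ord_recr /= -ih.
rewrite (eq_fc M (g := (fun x : R => \prod_(k < n) (x - k%:R)) \* (fun x => x - n%:R))) => [|x]; last first.
  by rewrite /= big_ord_recr.
refine (etrans (fcM hM bM (locbdd_rootprod n) (goodB (good_id R d) (good_cst d n%:R))) _).
refine (congr1 (fun z => _ * z) _).
refine (etrans (fcB hM bM (good_id R d) (good_cst d n%:R)) _).
by rewrite (fc_id hM) fc_cst rmorph_nat scaler_nat.
Qed.

Lemma locbdd_round : locbdd (fun x : R => (round L x)%:R : R).
Proof.
apply: (@locbdd_le _ _ L%:R) => x; rewrite normr_nat ler_nat; exact: round_le.
Qed.

Lemma class_round : \prod_(k < L.+1) (aclass M - k%:R) = 0 ->
  fc (fun x : R => (round L x)%:R) M = aclass M.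
Proof.
move=> h0; apply/eqP; rewrite eq_sym -subr_eq0; apply/eqP.
have lid : locbdd (@id R) := good_id R d.
rewrite -[X in X - _](fc_id hM).
refine (etrans (esym (fcB hM bM lid locbdd_round)) _).
pose g (x : R) := (rounding_error L x)^-1.
have lg : locbdd g.
  apply: (@locbdd_le _ _ (2 ^+ L.+1)) => x; rewrite /g normfV.
  have h := rounding_error_ge L x; have p : 0 < 2^-1 ^+ L.+1 :> R by rewrite exprn_gt0 ?invr_gt0.
  rewrite exprVn in h p; rewrite -[leRHS]invrK lef_pV2 ?posrE //; exact: lt_le_trans h.
rewrite (eq_fc M (g := (fun x : R => \prod_(k < L.+1) (x - k%:R)) \* g)) => [|x]; last first.
  rewrite /= round_product /g mulfK // -normr_gt0.
  apply: (@lt_le_trans _ _ (2^-1 ^+ L.+1)); first by rewrite exprn_gt0 ?invr_gt0.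
  exact: rounding_error_ge.
refine (etrans (fcM hM bM (locbdd_rootprod L.+1) lg) _).
by rewrite fc_rootprod h0 mul0r.
Qed.

End RoundingClass.

Section Pinching.
Variables (Q : pzRingType) (I : finType) (e : I -> Q) (n y : Q) (a : I -> Q).
Hypotheses (sum_e : \sum_k e k = 1) (ne : forall k, n * e k = a k * e k)
  (en : forall k, e k * n = a k * e k) (yn : GRing.comm y n)
  (ac : forall k x, GRing.comm (a k) x)
  (sep : forall k l x, k != l -> (a k - a l) * x = 0 -> x = 0).

(** (a k - a l) e_k y e_l = 0, so that y is block diagonal. *)
Lemma pinch_id : \sum_k e k * y * e k = y.
Proof.
have off k l : k != l -> e k * y * e l = 0.
  move=> kl; apply: (sep kl); rewrite mulrBl !mulrA -en.
  rewrite -(mulrA (e k) n) -yn (mulrA (e k)) -(mulrA _ n) ne.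
  by rewrite !mulrA -(ac l (e k * y)) !mulrA subrr.
rewrite -[RHS]mul1r -[RHS]mulr1 -sum_e mulr_suml mulr_suml; apply: eq_bigr => k _.
rewrite mulr_sumr (bigD1 k) //= big1 ?addr0 // => l lk.
by rewrite off // eq_sym.
Qed.

End Pinching.

Section Output.
Variables (R : realType) (L : nat) (r c : R) (m : nat).
Local Notation C := R[i].
Local Notation "x %:C" := (real_complex R x).
Implicit Types (A B : 'M[C]_m.+1).

(** The projections (1 + sign)/2 are asymptotically nested, and their sum counts the
    nodes to the left. *)
Definition level_mx A B : 'M[C]_m.+1 := \sum_(i < L) (2^-1)%:C *: (1%:M + sign_mx L r c i A B).

(** The level k is placed halfway between the nodes k - 1 and k. *)
Definition level_value (x : R) : R := r * ((round L x)%:R - L%:R / 2).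

Definition level_proj (k : nat) A B : 'M[C]_m.+1 :=
  fcalc (fun x => (round L x == k)%:R) (level_mx A B).

Definition approx_X A B : 'M[C]_m.+1 := fcalc level_value (level_mx A B).

(** The pinching of the staircase of B by the spectral projections of [approx_X], with
    which it commutes exactly. *)
Definition approx_H A B : 'M[C]_m.+1 :=
  \sum_(k < L.+1) level_proj k A B *m fcalc (stair L r c) B *m level_proj k A B.

Lemma herm_level A B : herm (level_mx A B).
Proof.
apply: herm_sum => i; apply: hermZ; apply: hermD; [exact: adjmx1|exact: herm_fcalc].
Qed.

Lemma herm_approx_X A B : herm (approx_X A B).
Proof. exact: herm_fcalc. Qed.

Lemma herm_approx_H A B : herm (approx_H A B).
Proof. by apply: herm_sum => k; apply: herm_conj2; exact: herm_fcalc. Qed.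

Lemma approx_comm A B : approx_X A B *m approx_H A B = approx_H A B *m approx_X A B.
Proof.
rewrite mulmx_sumr mulmx_suml; apply: eq_bigr => k _.
pose a := ((r * (k%:R - L%:R / 2))%:C)%:M : 'M[C]_m.+1.
have aE : fcalc (fun=> r * (k%:R - L%:R / 2)) (level_mx A B) = a by exact: fcalc_cst.
have e1 : approx_X A B *m level_proj k A B = a *m level_proj k A B.
  rewrite -aE -!fcalcM; apply: eq_fcalc => x _; rewrite /= /level_value.
  by case: eqP => [->|_]; rewrite ?mulr0.
have e2 : level_proj k A B *m approx_X A B = a *m level_proj k A B.
  by rewrite /level_proj /approx_X fcalc_comm.
have e3 Z : Z *m a = a *m Z by exact: scalar_mxC.
move: (approx_X A B) (level_proj k A B) (fcalc (stair L r c) B) a e1 e2 e3 {aE} => x e y a e1 e2 e3.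
by rewrite !mulmxA e1 -[RHS]mulmxA e2 (mulmxA (e *m y)) e3 !mulmxA.
Qed.

Section Natural.
Variable s : real_automorphism R m.
Variables (A B : 'M[C]_m.+1) (hA : herm A) (hB : herm B).

Lemma ra_level : s (level_mx A B) = level_mx (s A) (s B).
Proof.
by rewrite /level_mx ra_sum; apply: eq_bigr => i _; rewrite raZR raD ra1 ra_sign_mx.
Qed.

Lemma ra_approx_X : s (approx_X A B) = approx_X (s A) (s B).
Proof.
refine (etrans (ra_fcalc s level_value (herm_level A B)) _).
by rewrite ra_level.
Qed.

Lemma ra_approx_H : s (approx_H A B) = approx_H (s A) (s B).
Proof.
rewrite /approx_H ra_sum; apply: eq_bigr => k _.
have eP : s (level_proj k A B) = level_proj k (s A) (s B).
  refine (etrans (ra_fcalc s (fun x => (round L x == k)%:R) (herm_level A B)) _).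
  by rewrite ra_level.
by rewrite 2!raM eP (ra_fcalc s _ hB).
Qed.

End Natural.

Hypothesis c_gt0 : 0 < c.

Lemma level_mxN A B : herm B -> level_mx A (- B) = level_mx A B.
Proof.
move=> hB; apply: eq_bigr => i _; refine (congr1 (fun z => _ *: (1%:M + z)) _).
exact (sign_mxN L r c_gt0 i A hB).
Qed.

Lemma approx_XN A B : herm B -> approx_X A (- B) = approx_X A B.
Proof. by move=> hB; rewrite /approx_X level_mxN. Qed.

Lemma approx_HN A B : herm B -> approx_H A (- B) = - approx_H A B.
Proof.
move=> hB; refine (etrans _ (sumrN _ _ _)); apply: eq_bigr => k _.
rewrite /level_proj (level_mxN _ hB) (fcalc_opp _ hB).
rewrite (eq_fcalc (f := fun x => stair L r c (- x)) (g := fun x => - stair L r c x)) => [|x _]; last exact (stairN L r c_gt0 x).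
by rewrite fcalcN mulmxN mulNmx.
Qed.

End Output.

(** * Distance to the rounded pair *)

Lemma natr_sub_reg (K : numFieldType) (V : lalgType K) (k l : nat) (x : V) : k != l ->
  (k%:R - l%:R) * x = 0 -> x = 0.
Proof.
move=> kl; rewrite mulrBl !mulr_natl -[x *+ k]scaler_nat -[x *+ l]scaler_nat -scalerBl => /eqP.
by rewrite scaler_eq0 subr_eq0 eqr_nat (negPf kl) => /eqP.
Qed.

Section Halves.
Variables (R : realType) (d : nat -> nat).
Local Notation "x %:C" := (real_complex R x).
Local Notation asymp := (asymp R d).
Local Notation hf := ((2^-1 : R)%:C).

Lemma half_mul (u v : asymp) : u * v = v + v -> (hf *: u) * (hf *: v) = hf *: v.
Proof. by move=> e; rewrite -scalerAl -scalerAr e half_sumr. Qed.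

Lemma proj_idem (s : asymp) : s * s = 1 -> (hf *: (1 + s)) * (hf *: (1 + s)) = hf *: (1 + s).
Proof.
move=> ss; apply: half_mul; rewrite mulrDl mul1r mulrDr mulr1 ss; congr (_ + _).
exact: addrC.
Qed.

Lemma proj_nested (s s' : asymp) : (1 - s) * (1 + s') = 0 /\ (1 + s') * (1 - s) = 0 ->
  (hf *: (1 + s)) * (hf *: (1 + s')) = hf *: (1 + s') /\
  (hf *: (1 + s')) * (hf *: (1 + s)) = hf *: (1 + s').
Proof.
move=> []; move: (1 + s') => v.
rewrite mulrBl mulrBr mul1r mulr1 => /subr0_eq e1 /subr0_eq e2; split.
  by apply: half_mul; rewrite mulrDl mul1r -e1.
by rewrite -scalerAl -scalerAr mulrDr mulr1 -e2 half_sumr.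
Qed.

Lemma halves_sub (s h b : asymp) : h = b + b - 1 -> hf *: (s - h) = hf *: (1 + s) - b.
Proof.
move=> ->; rewrite -[X in _ = _ - X]half_sumr -scalerBr; congr (_ *: _).
by rewrite opprB addrCA addrA.
Qed.

End Halves.

Section Limits.
Variables (R : realType) (d : nat -> nat) (L : nat) (r c : R).
Hypotheses (c_gt0 : 0 < c) (c_lt : 2 * c < r).
Let c_r : 2 * c <= r. Proof. exact: ltW. Qed.
Local Notation C := R[i].
Local Notation "x %:C" := (real_complex R x).
Local Notation mxseq := (mxseq R d).
Local Notation asymp := (asymp R d).
Variables (A B : mxseq) (hA : hermseq A) (hB : hermseq B) (bA : bdd A) (bB : bdd B).
Hypothesis cAB : GRing.comm (aclass A) (aclass B).
Hypothesis punct : forall (i l : 'I_L) F G, good d F -> good d G ->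
  (forall y, F y != 0 -> `|y - node L r l| <= c) ->
  (forall y, G y != 0 -> `|y - node L r i| <= c) ->
  fc F B * fc G A = 0.

Local Notation hf := ((2^-1 : R)%:C).
Local Notation sg i := (fun j => sign_mx L r c i (A j) (B j)).
Local Notation s i := (aclass (sg i) : asymp).
Local Notation h i := (fc (hgt L r c i) A : asymp).
Local Notation w i := (fc (wid L r c i) A : asymp).
Local Notation M := (fun j => level_mx L r c (A j) (B j)).
Local Notation y := (fc (stair L r c) B : asymp).

Lemma sign_norm i j : opnorm (sg i j) <= 1.
Proof.
apply: fcalc_norm => // x _; rewrite /sign; case: ifP => _; by rewrite ?normrN normr1.
Qed.

Lemma bdd_sign i : bdd (sg i). Proof. exact: bdd_le (sign_norm i). Qed.

Definition lproj i : asymp := hf *: (1 + s i).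

Lemma bdd_lproj i : bdd (fun j => hf *: (1%:M + sg i j)).
Proof. exact (bddZ _ (bddD (bdd_cst d 1) (bdd_sign i))). Qed.

Lemma bdd_level : bdd M.
Proof. exact (bdd_sum _ (fun i : 'I_L => bdd_lproj i)). Qed.

Lemma herm_levels : hermseq M. Proof. by move=> j; exact: herm_level. Qed.

Lemma class_level : aclass M = \sum_(i < L) lproj i.
Proof.
refine (etrans (aclass_sum _ (fun i : 'I_L => bdd_lproj i)) _); apply: eq_bigr => i _.
refine (etrans (aclassZ _ (bddD (bdd_cst d 1) (bdd_sign i))) _).
by rewrite /lproj (aclassD (bdd_cst d 1) (bdd_sign i)) aclass1.
Qed.

Let facts i := sign_facts c_gt0 c_r hA hB bA bB cAB punct (i : 'I_L).

Lemma level_roots : \prod_(k < L.+1) (aclass M - k%:R) = 0.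
Proof.
rewrite class_level; apply: nested_sum_roots => [i iL|i k /andP[ik kL]].
  by have [ss _ _ _] := facts (Ordinal iL); exact: proj_idem ss.
apply: proj_nested.
exact (@nested_signs _ _ _ _ _ c_gt0 c_r _ _ hA hB bA bB cAB punct
  (Ordinal (ltn_trans ik kL)) (Ordinal kL) ik).
Qed.

Let round_level := class_round herm_levels bdd_level level_roots.

Lemma comm_stair_level : GRing.comm y (aclass M).
Proof.
rewrite class_level; apply: commr_sum => i _; apply: comm_scale.
apply: commrD (commr1 _) _; by case: (facts i).
Qed.

Local Notation ind k := (fun x : R => (round L x == k)%:R : R).

Lemma locbdd_ind k : locbdd (ind k).
Proof. by apply: (@locbdd_le _ _ 1) => x; case: eqP => _; rewrite ?normr1 ?normr0. Qed.

Lemma ind_eigen k : aclass M * fc (ind k) M = k%:R * fc (ind k) M.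
Proof.
rewrite -{1}round_level.
refine (etrans (esym (fcM herm_levels bdd_level (locbdd_round R L) (locbdd_ind k))) _).
rewrite (eq_fc M (g := fun x => k%:R * ind k x)) => [|x]; last first.
  by rewrite /=; case: eqP => [->|_]; rewrite ?mulr0.
by rewrite (fcZ herm_levels bdd_level _ (locbdd_ind k)) rmorph_nat scaler_nat mulr_natl.
Qed.

Lemma comm_ind k : GRing.comm (aclass M) (fc (ind k) M).
Proof. rewrite -{1}round_level; exact (fc_comm herm_levels bdd_level (locbdd_round R L) (locbdd_ind k)). Qed.

Lemma bdd_ind k : bdd (fun j => level_proj L r c k (A j) (B j)).
Proof. exact (bdd_fc (locbdd_ind k) herm_levels bdd_level). Qed.

Lemma bdd_stairB : bdd (fun j => fcalc (stair L r c) (B j)).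
Proof. exact (bdd_fc (good_stair L r c d) hB bB). Qed.

Lemma class_approx_H : aclass (fun j => approx_H L r c (A j) (B j)) = y.
Proof.
have b k := bddM (bddM (bdd_ind k) bdd_stairB) (bdd_ind k).
refine (etrans (aclass_sum _ (fun k : 'I_L.+1 => b k)) _).
refine (etrans (eq_bigr (fun k : 'I_L.+1 => fc (ind k) M * y * fc (ind k) M) _) _) => [k _|].
  refine (etrans (aclassM (bddM (bdd_ind k) bdd_stairB) (bdd_ind k)) _).
  exact (congr1 (fun z => z * _) (aclassM (bdd_ind k) bdd_stairB)).
apply: (pinch_id (n := aclass M) (a := fun k : 'I_L.+1 => k%:R)).
- refine (etrans (esym (fc_sum herm_levels bdd_level _ (fun k : 'I_L.+1 => locbdd_ind k))) _).
  rewrite (eq_fc M (g := fun=> 1)) ?fc_cst ?rmorph1 ?scale1r // => x.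
  rewrite (bigD1 (Ordinal (round_le L x : (round L x < L.+1)%N))) //= eqxx big1 ?addr0 // => k.
  by rewrite eq_sym => /negPf; rewrite -val_eqE /= => ->.
- by move=> k; exact: ind_eigen.
- by move=> k; refine (etrans (esym (comm_ind k)) _); exact: ind_eigen.
- exact: comm_stair_level.
- by move=> k x; apply: commr_sym; exact: commr_nat.
by move=> k l x kl; exact (natr_sub_reg (k := k) (l := l) kl).
Qed.

Local Notation win i := (fun x : R => (`|x - node L r i| <= c)%R%:R : R).
Local Notation e i j := (fcalc (win i) (A j)).
Local Notation T i j := ((r / 2)%:C *: (sg i j - fcalc (hgt L r c i) (A j))).

Lemma r_gt0 : 0 < r. Proof. by have := c_gt0; have := c_r; lra. Qed.

Lemma locbdd_win (i : nat) : locbdd (win i).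
Proof. by apply: (@locbdd_le _ _ 1) => x; case: (`|x - node L r i| <= c); rewrite ?normr1 ?normr0. Qed.

Lemma win_wid (i : 'I_L) : fc (win i) A * w i = w i.
Proof.
refine (etrans (esym (fcM hA bA (locbdd_win i) (good_wid L r c d i))) _).
apply: eq_fc => x /=; have [->|] := eqVneq (wid L r c i x) 0; first by rewrite mulr0.
by move/(wid_supp c_gt0) => ->; rewrite mul1r.
Qed.

Lemma wid_win (i : 'I_L) : w i * fc (win i) A = w i.
Proof. by rewrite -{2}win_wid; exact (fc_comm hA bA (good_wid L r c d i) (locbdd_win i)). Qed.

Lemma bdd_T (i : nat) : bdd (fun j => T i j).
Proof. exact (bddZ _ (bddB (bdd_sign i) (bdd_fc (good_hgt L r c d i) hA bA))). Qed.

Lemma bdd_e (i : nat) : bdd (fun j => e i j).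
Proof. exact (bdd_fc (locbdd_win i) hA bA). Qed.

Lemma bdd_eTe (i : nat) : bdd (fun j => e i j *m T i j *m e i j).
Proof. exact (bddM (bddM (bdd_e i) (bdd_T i)) (bdd_e i)). Qed.

Lemma class_eTe (i : 'I_L) : aclass (fun j => e i j *m T i j *m e i j) = (r / 2)%:C *: (s i - h i).
Proof.
refine (etrans (aclassM (bddM (bdd_e i) (bdd_T i)) (bdd_e i)) _).
refine (etrans (congr1 (fun z => z * _) (aclassM (bdd_e i) (bdd_T i))) _).
have -> : aclass (fun j => T i j) = (r / 2)%:C *: (s i - h i).
  refine (etrans (aclassZ _ (bddB (bdd_sign i) (bdd_fc (good_hgt L r c d i) hA bA))) _).
  exact (congr1 (fun z => _ *: z) (aclassB (bdd_sign i) (bdd_fc (good_hgt L r c d i) hA bA))).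
have [_ _ [z ez] [z' ez']] := facts i.
have e1 : (s i - h i) * fc (win i) A = s i - h i by rewrite ez -mulrA wid_win.
have e2 : fc (win i) A * (s i - h i) = s i - h i.
  rewrite ez'; refine (etrans (mulrA _ _ _) _); exact (congr1 (fun u => u * z') (win_wid i)).
by rewrite -scalerAr e2 -scalerAl e1.
Qed.

(** Windows around different nodes are disjoint, so that their projections are exactly
    orthogonal. *)
Lemma opnorm_eTe j : opnorm (\sum_(i < L) e i j *m T i j *m e i j) <= r.
Proof.
have r0 := r_gt0.
apply: opnorm_orth_sum => [|i|i|i k ik|i]; first exact: ltW.
- exact: herm_fcalc.
- by rewrite -fcalcM; apply: eq_fcalc => x _ /=; case: (`|x - node L r i| <= c); rewrite ?mulr1 ?mulr0.
- rewrite -fcalcM (@eq_fcalc _ _ _ _ (fun=> 0)) ?fcalc_cst ?rmorph0 ?scalemx1 ?raddf0 // => x _ /=.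
  case: (boolP (`|x - node L r i| <= c)) => [|_]; last by rewrite mul0r.
  case: (boolP (`|x - node L r k| <= c)) => [|_]; last by rewrite mulr0.
  rewrite !ler_norml => /andP[a1 a2] /andP[b1 b2].
  by move: ik; rewrite -val_eqE neq_ltn => /orP[lt|lt];
    have := node_lt L c_gt0 c_r lt; have := c_lt; lra.
have r2 : 0 <= r / 2 by lra.
apply: le_trans (opnormZ_le _ _) _; rewrite normcR ger0_norm //.
apply: (@le_trans _ _ (r / 2 * (1 + 1))); last by rewrite -mulrA (_ : 2^-1 * (1 + 1) = 1) ?mulr1 //; field.
rewrite ler_wpM2l //; apply: le_trans (opnormB _ _) (lerD (sign_norm i j) _).
by apply: fcalc_norm => // x _; rewrite ler_norml; exact: hgt_norm.
Qed.

(** The rounded matrix and the staircase of A have the same steps, and differ at node i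
    by (r/2) (sign - hgt i), which lives in the window of that node. *)
Lemma class_approx_X :
  aclass (fun j => approx_X L r c (A j) (B j)) - fc (stair L r c) A =
  aclass (fun j => \sum_(i < L) e i j *m T i j *m e i j).
Proof.
have -> : aclass (fun j => approx_X L r c (A j) (B j)) = r%:C *: \sum_(i < L) (lproj i - hf%:A).
  have lr : locbdd (fun x => (round L x)%:R - L%:R / 2 : R).
    exact (locbddD (locbdd_round R L) (locbdd_cst (- (L%:R / 2)))).
  refine (etrans (fcZ herm_levels bdd_level r lr) _); congr (_ *: _).
  refine (etrans (fcB herm_levels bdd_level (locbdd_round R L) (locbdd_cst _)) _).
  rewrite round_level fc_cst class_level sumrB sumr_const card_ord; congr (_ - _).
  by rewrite rmorphM rmorph_nat -scalerA scaler_nat.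
rewrite (stairE L r c hA bA) -scalerBr -sumrB.
refine (etrans _ (esym (aclass_sum _ (fun i : 'I_L => bdd_eTe i)))).
rewrite scaler_sumr; apply: eq_bigr => i _; refine (etrans _ (esym (class_eTe i))).
rewrite rmorphM -scalerA; congr (_ *: _).
refine (etrans _ (esym (halves_sub (s i) (b := fc (step L r c i.+1) A) _))).
  by rewrite /lproj opprB addrA subrK.
have ls := good_step L r c d i.+1.
refine (etrans (fcB hA bA (goodZ 2 ls) (good_cst d 1)) _).
by rewrite (fcZ hA bA _ ls) fc_cst rmorph1 scale1r (rmorph_nat _ 2) scaler_nat mulr2n.
Qed.

Lemma stair_close (Z : mxseq) : hermseq Z -> (forall j, opnorm (Z j) <= L%:R * r / 2) ->
  forall j, opnorm (fcalc (stair L r c) (Z j) - Z j) <= r.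
Proof.
move=> hZ nZ j; rewrite -{2}(fcalc_id (hZ j)) -fcalcB.
apply: fcalc_norm => [|x hx]; first exact: ltW r_gt0.
by apply: stair_near => //; apply: le_trans (spec_bound (hZ j) hx) (nZ j).
Qed.

Lemma approx_X_near (eps : R) : 0 < eps -> (forall j, opnorm (A j) <= L%:R * r / 2) ->
  exists N, forall j, (N <= j)%N -> opnorm (approx_X L r c (A j) (B j) - A j) <= 2 * r + eps.
Proof.
move=> eps0 nA.
have b1 : bdd (fun j => approx_X L r c (A j) (B j)).
  apply: bdd_fc herm_levels bdd_level.
  exact (locbddM (locbdd_cst r) (locbddD (locbdd_round R L) (locbdd_cst (- (L%:R / 2))))).
have b2 : bdd (fun j => fcalc (stair L r c) (A j)) := bdd_fc (good_stair L r c d) hA bA.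
have b3 := bdd_sum (index_enum _) (fun i : 'I_L => bdd_eTe i).
have e1 := etrans (aclassB b1 b2) class_approx_X.
have [N hN] := aclass_le (bddB b1 b2) b3 e1 eps0; exists N => j /hN.
have := stair_close hA nA j; have := opnorm_eTe j.
move: (\sum_(i < L) _) (approx_X _ _ _ _ _) (fcalc _ _) => D X S n1 n2 n3.
have -> : X - A j = (X - S - D) + D + (S - A j) by rewrite subrK addrA subrK.
apply: (le_trans (opnormD _ _)).
apply: (le_trans (lerD (le_trans (opnormD _ _) (lerD n3 n1)) n2)).
by rewrite mulr2n mulrDl mul1r -addrA addrC.
Qed.

Lemma approx_H_near (eps : R) : 0 < eps -> (forall j, opnorm (B j) <= L%:R * r / 2) ->
  exists N, forall j, (N <= j)%N -> opnorm (approx_H L r c (A j) (B j) - B j) <= r + eps.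
Proof.
move=> eps0 nB.
have b1 : bdd (fun j => approx_H L r c (A j) (B j)).
  exact (bdd_sum _ (fun k : 'I_L.+1 => bddM (bddM (bdd_ind k) bdd_stairB) (bdd_ind k))).
have [N hN] := aclass_le b1 bdd_stairB class_approx_H eps0; exists N => j /hN.
have := stair_close hB nB j.
move: (approx_H _ _ _ _ _) (fcalc _ _) => X S n1 n2.
have -> : X - B j = (X - S) + (S - B j) by rewrite addrA subrK.
by apply: (le_trans (opnormD _ _)); rewrite addrC; exact: lerD.
Qed.

End Limits.

(** * Symmetries as automorphisms of the matrix algebra *)

Section Symmetries.
Variables (R : realType) (m : nat).
Local Notation C := R[i].
Local Notation M := 'M[C]_m.+1.
Implicit Types (A X H U : M).

Lemma mulmx_ext (A B : M) : (forall v : 'cV[C]_m.+1, A *m v = B *m v) -> A = B.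
Proof.
move=> h; apply/matrixP => i j; have := congr1 (fun v : 'cV__ => v i 0) (h (delta_mx j 0)).
by rewrite -!colE !mxE.
Qed.

Lemma commutes_mx U A : commutes_with (mulmx U) A <-> U *m A = A *m U.
Proof.
split=> [h|e v]; last by rewrite !mulmxA e.
by apply: mulmx_ext => v; rewrite -!mulmxA h.
Qed.

Lemma anticommutes_mx U A : anticommutes_with (mulmx U) A <-> U *m A = - (A *m U).
Proof.
split=> [h|e v]; last by rewrite !mulmxA e mulNmx.
by apply: mulmx_ext => v; rewrite mulNmx -!mulmxA h.
Qed.

Section Conjugation.
Variables (U : M) (UU : U *m U^t* = 1%:M) (UU' : U^t* *m U = 1%:M).
Variables (f : M -> M) (anti : bool).
Hypotheses (fD : forall A B, f (A + B) = f A + f B) (fM : forall A B, f (A *m B) = f A *m f B)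
  (f1 : f 1%:M = 1%:M) (fZ : forall c A, f (c *: A) = (if anti then c^* else c) *: f A)
  (fA : forall A, f (A^t*) = (f A)^t*).

Definition conjugation : real_automorphism R m.
Proof.
apply: (@RealAutomorphism R m (fun A => U *m f A *m U^t*) anti).
- by move=> A B; rewrite fD mulmxDr mulmxDl.
- by move=> A B; rewrite fM !mulmxA -(mulmxA _ (U^t*) U) UU' mulmx1.
- by rewrite f1 mulmx1.
- by move=> c A; rewrite fZ -scalemxAr -scalemxAl.
by move=> A; rewrite fA !adjmxM trmxCK mulmxA.
Defined.

Lemma conjugation_fix A B : conjugation A = B <-> U *m f A = B *m U.
Proof.
rewrite /=; split=> [<-|->]; first by rewrite -mulmxA UU' mulmx1.
by rewrite -mulmxA UU mulmx1.
Qed.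

End Conjugation.

Lemma unitary_automorphism U : U \is unitarymx -> exists s : real_automorphism R m,
  forall A, (s A = A <-> commutes_with (mulmx U) A) /\
            (s A = - A <-> anticommutes_with (mulmx U) A).
Proof.
move=> uU; have UU : U *m U^t* = 1%:M by exact/unitarymxP.
have UU' : U^t* *m U = 1%:M by exact: mulmx1C.
pose s := @conjugation U UU UU' id false (fun _ _ => erefl) (fun _ _ => erefl) erefl
  (fun _ _ => erefl) (fun _ => erefl).
exists s => A; split.
  by rewrite commutes_mx; exact: conjugation_fix.
by rewrite anticommutes_mx -mulNmx; exact: conjugation_fix.
Qed.

(** T is determined by the images of the basis vectors, which are the columns of U. *)
Lemma antiunitary_mx (T : 'cV[C]_m.+1 -> 'cV[C]_m.+1) : antiunitary T ->
  exists2 U : M, U^t* *m U = 1%:M & forall v, T v = U *m map_mx Num.conj v.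
Proof.
move=> [_ TD TZ Ti].
pose U : M := \matrix_(i, j) T (delta_mx j 0) i 0.
have TE v : T v = U *m map_mx Num.conj v.
  have T0 : T 0 = 0 by have := TZ 0 0; rewrite conjC0 !scale0r.
  rewrite {1}[v](matrix_sum_delta v).
  rewrite (eq_bigr (fun i => v i 0 *: delta_mx i 0)) => [|i _]; last by rewrite big_ord1.
  rewrite (big_morph T TD T0); apply/matrixP => i k; rewrite !ord1 summxE !mxE.
  by apply: eq_bigr => j _; rewrite TZ !mxE mulrC.
exists U => //; apply/matrixP => i j.
have Ue k : T (delta_mx k 0) = U *m delta_mx k 0 by rewrite TE map_delta_mx.
have := Ti (delta_mx i 0) (delta_mx j 0).
rewrite !Ue inner_adj mulmxA inner_delta => ->.
by rewrite -[delta_mx j 0]mul1mx inner_delta !mxE conjC_nat.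
Qed.

Lemma antiunitary_automorphism (T : 'cV[C]_m.+1 -> 'cV[C]_m.+1) : antiunitary T ->
  exists s : real_automorphism R m,
  forall A, (s A = A <-> commutes_with T A) /\ (s A = - A <-> anticommutes_with T A).
Proof.
move=> /antiunitary_mx[U UU' TE]; have UU : U *m U^t* = 1%:M by exact: mulmx1C.
pose s := @conjugation U UU UU' (map_mx Num.conj) true (fun A B => map_mxD _ A B)
  (fun A B => map_mxM _ A B) (map_mx1 _ _) (fun c A => map_mxZ _ c A) (fun A => congr1 (map_mx _) (esym (map_trmx _ A))).
have conjK (v : 'cV[C]_m.+1) : map_mx Num.conj (map_mx Num.conj v) = v.
  by apply/matrixP => i j; rewrite !mxE conjCK.
have ext A B : (forall v, T (A *m v) = B *m T v) <-> U *m map_mx Num.conj A = B *m U.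
  split=> [h|e v]; last by rewrite !TE map_mxM !mulmxA e.
  apply: mulmx_ext => v; have := h (map_mx Num.conj v).
  by rewrite !TE map_mxM conjK !mulmxA.
exists s => A; split.
  by apply: iff_trans (conjugation_fix _ _ _ _ _ _ _ _ _) _; apply: iff_sym; exact: ext.
apply: iff_trans (conjugation_fix _ _ _ _ _ _ _ _ _) _; apply: iff_sym.
apply: iff_trans (ext A (- A)); split=> h v; by rewrite h mulNmx.
Qed.

End Symmetries.

(** * Regular shifts and the symmetry of the puncture *)

Section AvoidSpectra.
Variables (R : realType).
Local Notation C := R[i].
Local Notation "x %:C" := (real_complex R x).

Lemma small_nonroot (q : {poly C}) (t : R) : q != 0 -> 0 < t ->
  exists2 u : R, 0 < u <= t & ~~ root q u%:C.
Proof.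
move=> q0 t0; apply: contrapT => no.
pose s := [seq ((t / k.+1%:R)%:C : C) | k <- iota 0 (size q)].
have us : uniq s.
  rewrite map_inj_uniq ?iota_uniq // => k l /= [] /(mulfI (lt0r_neq0 t0)) /invr_inj /eqP.
  by rewrite eqr_nat => /eqP [].
have rs : all (root q) s.
  apply/allP => z /mapP[k _ ->]; apply: contrapT => /negP nr; apply: no.
  exists (t / k.+1%:R) => //; rewrite divr_gt0 ?ltr0n //=.
  by rewrite ler_pdivrMr ?ltr0n // ler_peMr ?ler1n // ltW.
by have := max_poly_roots q0 rs us; rewrite size_map size_iota ltnn.
Qed.

(** Only finitely many shifts are eigenvalues. *)
Lemma shift_unit m (I : finType) (Z : I -> 'M[C]_m.+1) (t : R) : 0 < t ->
  exists2 u : R, 0 < u <= t & forall i, Z i - (u%:C)%:M \in unitmx.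
Proof.
move=> t0; pose q := \prod_i char_poly (Z i).
have q0 : q != 0 by apply/prodf_neq0 => i _; exact: monic_neq0 (char_poly_monic _).
have [u hu nr] := small_nonroot q0 t0; exists u => // i.
move: nr; rewrite rootE horner_prod => /prodf_neq0 /(_ i isT); rewrite -rootE.
rewrite -eigenvalue_root_char /eigenvalue /eigenspace negbK kermx_eq0.
by rewrite row_free_unit.
Qed.

End AvoidSpectra.

Section PunctureMatrices.
Variables (R : realType) (L : nat) (r rho : R) (m : nat).
Local Notation C := R[i].
Local Notation "x %:C" := (real_complex R x).
Implicit Types (X H : 'M[C]_m.+1).
Local Notation a := (fun p : 'I_L * 'I_L => node L r p.1).
Local Notation b := (fun p : 'I_L * 'I_L => node L r p.2).

(** [punctured_X] for a single matrix, the points being all pairs of nodes. *)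
Definition puncture_X X H : 'M[C]_m.+1 :=
  X + \sum_(p : 'I_L * 'I_L) odd_re (push rho) (X - ((a p)%:C)%:M) (H - ((b p)%:C)%:M).
Definition puncture_H X H : 'M[C]_m.+1 :=
  H + \sum_(p : 'I_L * 'I_L) odd_im (push rho) (X - ((a p)%:C)%:M) (H - ((b p)%:C)%:M).

Let hsub X (t : R) : herm X -> herm (X - (t%:C)%:M).
Proof. by move=> hX; apply: hermB => //; exact: herm_scalar. Qed.

Lemma ra_puncture_X (s : real_automorphism R m) X H : herm X -> herm H ->
  s (puncture_X X H) = puncture_X (s X) (s H).
Proof.
move=> hX hH; rewrite /puncture_X raD ra_sum; congr (_ + _); apply: eq_bigr => p _.
by rewrite (ra_odd_re s _ (hsub _ hX) (hsub _ hH)) !raB !raC.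
Qed.

Lemma ra_puncture_H (s : real_automorphism R m) X H : herm X -> herm H ->
  s (puncture_H X H) = puncture_H (s X) (s H).
Proof.
move=> hX hH; rewrite /puncture_H raD ra_sum; congr (_ + _); apply: eq_bigr => p _.
by rewrite (ra_odd_im s _ (hsub _ hX) (hsub _ hH)) !raB !raC.
Qed.

Lemma sum_rev_snd (V : nmodType) (F : 'I_L * 'I_L -> V) :
  \sum_p F (p.1, rev_ord p.2) = \sum_p F p.
Proof.
rewrite -(pair_bigA _ (fun i k => F (i, rev_ord k))) /=.
transitivity (\sum_i \sum_k F (i, k)); first by apply: eq_bigr => i _; exact: (sum_rev_ord (fun k => F (i, k))).
by rewrite (pair_bigA _ (fun i k => F (i, k))); apply: eq_bigr => -[].
Qed.

Let flip H (k : 'I_L) : - H - ((node L r (rev_ord k))%:C)%:M = - (H - ((node L r k)%:C)%:M).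
Proof. by rewrite nodeN rmorphN raddfN opprK opprB addrC. Qed.

(** Reflecting the grid in the real axis turns the sum for - H into the sum for H. *)
Lemma puncture_XN X H : herm X -> herm H -> puncture_X X (- H) = puncture_X X H.
Proof.
move=> hX hH; refine (congr1 (fun S => X + S) _).
refine (etrans (esym (sum_rev_snd (fun p =>
  odd_re (push rho) (X - ((a p)%:C)%:M) (- H - ((b p)%:C)%:M)))) _).
apply: eq_bigr => p _; refine (etrans _ (odd_reN (push rho) (hsub (a p) hX) (hsub (b p) hH))).
exact (congr1 (odd_re _ _) (flip H p.2)).
Qed.

Lemma puncture_HN X H : herm X -> herm H -> puncture_H X (- H) = - puncture_H X H.
Proof.
move=> hX hH; refine (etrans _ (esym (opprD _ _))); refine (congr1 (fun S => - H + S) _).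
refine (etrans (esym (sum_rev_snd (fun p =>
  odd_im (push rho) (X - ((a p)%:C)%:M) (- H - ((b p)%:C)%:M)))) _).
refine (etrans _ (sumrN _ _ _)).
apply: eq_bigr => p _; refine (etrans _ (odd_imN (push rho) (hsub (a p) hX) (hsub (b p) hH))).
exact (congr1 (odd_im _ _) (flip H p.2)).
Qed.

End PunctureMatrices.

Lemma node_grid_sep (R : realType) (L : nat) (r c : R) (p q : 'I_L * 'I_L) :
  0 < c -> 2 * c <= r -> p != q ->
  r <= normc (grid_pt (fun p : 'I_L * 'I_L => node L r p.1) (fun p : 'I_L * 'I_L => node L r p.2) p -
              grid_pt (fun p : 'I_L * 'I_L => node L r p.1) (fun p : 'I_L * 'I_L => node L r p.2) q).
Proof.
move=> c0 cr; have r0 : 0 <= r by lra.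
have nd (i k : 'I_L) : i != k -> r <= `|node L r i - node L r k|.
  rewrite -val_eqE neq_ltn => /orP[lt|lt]; have h := node_lt L c0 cr lt.
    by rewrite distrC ger0_norm; lra.
  by rewrite ger0_norm; lra.
have nE (u v u' v' : R) : normc (real_complex R u + 'i * real_complex R v -
    (real_complex R u' + 'i * real_complex R v')) = Num.sqrt ((u - u') ^+ 2 + (v - v') ^+ 2).
  by rewrite /normc /=; congr (Num.sqrt (_ ^+ 2 + _ ^+ 2)); ring.
move=> pq; rewrite /grid_pt nE -(@ler_pXn2r _ 2) ?nnegrE ?sqrtr_ge0 // sqr_sqrtr ?addr_ge0 ?sqr_ge0 //.
case: (eqVneq p.1 q.1) => e1.
  have e2 : p.2 != q.2.
    by apply: contraNneq pq => e2; rewrite [p]surjective_pairing e1 e2 -surjective_pairing.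
  rewrite -[leLHS]add0r lerD ?sqr_ge0 // -[leRHS]real_normK ?num_real //.
  by rewrite ler_pXn2r ?nnegrE // nd.
rewrite -[leLHS]addr0 lerD ?sqr_ge0 // -[leRHS]real_normK ?num_real //.
by rewrite ler_pXn2r ?nnegrE // nd.
Qed.

(** * Symmetric approximation along a sequence *)

Lemma opnorm_triangle (R : realType) n (A B D : 'M[R[i]]_n) (s t : R) :
  opnorm (A - B) <= s -> opnorm (B - D) <= t -> opnorm (A - D) <= s + t.
Proof.
move=> h1 h2; have -> : A - D = (A - B) + (B - D) by rewrite addrA subrK.
exact: le_trans (opnormD _ _) (lerD h1 h2).
Qed.

Section SymmetricApproximation.
Variable R : realType.
Local Notation C := R[i].
Local Notation "x %:C" := (real_complex R x).

Section Construction.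
Variables (L : nat) (r rho c t : R) (m : nat).
Implicit Types (X H : 'M[C]_m.+1).
Local Notation shift X := (X - (t%:C)%:M).

Definition final_X X H : 'M[C]_m.+1 :=
  approx_X L r c (puncture_X L r rho (shift X) H) (puncture_H L r rho (shift X) H).
Definition final_H X H : 'M[C]_m.+1 :=
  approx_H L r c (puncture_X L r rho (shift X) H) (puncture_H L r rho (shift X) H).

Lemma herm_puncture_X X H : herm X -> herm (puncture_X L r rho X H).
Proof. by move=> hX; apply: hermD => //; apply: herm_sum => p; exact: herm_re. Qed.

Lemma herm_puncture_H X H : herm H -> herm (puncture_H L r rho X H).
Proof. by move=> hH; apply: hermD => //; apply: herm_sum => p; exact: herm_im. Qed.

Hypothesis c_gt0 : 0 < c.

Lemma final_natural (s : real_automorphism R m) X H : herm X -> herm H ->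
  s (final_X X H) = final_X (s X) (s H) /\ s (final_H X H) = final_H (s X) (s H).
Proof.
move=> hX hH; have hX' : herm (shift X) by apply: hermB => //; exact: herm_scalar.
have h1 := herm_puncture_X H hX'; have h2 := herm_puncture_H (shift X) hH.
have e1 := ra_puncture_X L r rho s hX' hH; have e2 := ra_puncture_H L r rho s hX' hH.
rewrite (raB s X) raC in e1 e2; split.
  exact (etrans (ra_approx_X L r c s h1 h2) (congr2 (@approx_X R L r c m) e1 e2)).
exact (etrans (ra_approx_H L r c s h1 h2) (congr2 (@approx_H R L r c m) e1 e2)).
Qed.

Lemma final_flip X H : herm X -> herm H ->
  final_X X (- H) = final_X X H /\ final_H X (- H) = - final_H X H.
Proof.
move=> hX hH; have hX' : herm (shift X) by apply: hermB => //; exact: herm_scalar.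
have h2 := herm_puncture_H (shift X) hH.
rewrite /final_X /final_H (puncture_XN L r rho hX' hH) (puncture_HN L r rho hX' hH).
by rewrite (approx_XN L r c_gt0 _ h2) (approx_HN L r c_gt0 _ h2).
Qed.

End Construction.

(** A single pair serves all automorphisms, which makes it independent of the symmetries
    that are considered. *)
Definition symmetric_approximation (eps : R) m (X H : 'M[C]_m.+1) :=
  exists X2 H2 : 'M[C]_m.+1,
    [/\ herm X2, herm H2, X2 *m H2 = H2 *m X2, opnorm (X2 - X) <= eps & opnorm (H2 - H) <= eps] /\
    forall s : real_automorphism R m, s X = X ->
      (s H = H -> s X2 = X2 /\ s H2 = H2) /\ (s H = - H -> s X2 = X2 /\ s H2 = - H2).

Section AlongSequence.
Variables (d : nat -> nat) (X H : mxseq R d) (hX : hermseq X) (hH : hermseq H).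
Hypotheses (nX : forall j, opnorm (X j) <= 1) (nH : forall j, opnorm (H j) <= 1)
  (cXH : null (fun j => X j *m H j - H j *m X j)).

Section Constants.
Variables (L : nat) (r rho c : R).
Hypotheses (r_gt0 : 0 < r) (r_le1 : r <= 1) (Lr : L%:R * r = 8) (rho_gt0 : 0 < rho)
  (rho_r : 2 * rho < r) (rho_L : (L * L)%:R * rho <= r) (c_gt0 : 0 < c) (c_rho : 4 * c <= rho).
Local Notation a := (fun p : 'I_L * 'I_L => node L r p.1).
Local Notation b := (fun p : 'I_L * 'I_L => node L r p.2).

(** A real shift of X is fixed by every automorphism that fixes X, so that it spoils no
    symmetry. *)
Lemma good_shifts : exists u : nat -> R, forall j, 0 < u j <= r /\
  forall p, cart (X j - ((u j)%:C)%:M - ((a p)%:C)%:M) (H j - ((b p)%:C)%:M) \in unitmx.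
Proof.
have h j : exists u : R, 0 < u <= r /\
    forall p, cart (X j - (u%:C)%:M - ((a p)%:C)%:M) (H j - ((b p)%:C)%:M) \in unitmx.
  have [u hu unit_u] := shift_unit (fun p => cart (X j - ((a p)%:C)%:M) (H j - ((b p)%:C)%:M)) r_gt0.
  exists u; split=> // p; have := unit_u p.
  by rewrite /cart -addrAC (addrAC (X j)).
by have [u hu] := choice h; exists u.
Qed.

Let sum_r : 2 * r + r + r + r <= 5 * r /\ r + r + r <= 5 * r.
Proof. by have := r_gt0; split; lra. Qed.

(** The shift, the puncture and the passage to the limit cost r each, and the staircase
    with its rounding costs 2 r. *)
Lemma approximation_along : exists j, symmetric_approximation (5 * r) (X j) (H j).
Proof.
have [u hu] := good_shifts.
pose Xs : mxseq R d := fun j => X j - ((u j)%:C)%:M.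
have hXs : hermseq Xs by move=> j; apply: hermB; [exact: hX|exact: herm_scalar].
have u_norm j : opnorm (Xs j - X j) <= u j.
  have [/andP[u0 _] _] := hu j.
  rewrite /Xs addrAC subrr sub0r opnormN; apply: le_trans (opnorm_scalar_le _ _) _.
  by rewrite normcR ger0_norm // ltW.
have u_r j : u j <= r by have [/andP[]] := hu j.
have nXs j : opnorm (Xs j) <= 2.
  have -> : Xs j = (Xs j - X j) + X j by rewrite subrK.
  apply: le_trans (opnormD _ _) _; have := u_norm j; have := u_r j; have := nX j; have := r_le1.
  by move: (opnorm _) (opnorm _) (u j) => x y z; lra.
have bXs : bdd Xs := bdd_le nXs; have bH : bdd H := bdd_le nH.
have cXs : GRing.comm (aclass Xs) (aclass H).
  rewrite /GRing.comm -(aclassM bXs bH) -(aclassM bH bXs).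
  apply: (aclass_eq (bddM bXs bH) (bddM bH bXs)); apply: eq_null cXH => j.
  by rewrite /Xs mulmxBl mulmxBr scalar_mxC opprB addrA subrK.
have unitN p j : shifted_N Xs H a b p j \in unitmx by have [_] := hu j; exact.
have c_r : 2 * c < r by move: rho_r c_rho rho_gt0 c_gt0; lra.
have sep (p q : 'I_L * 'I_L) : p != q -> r <= normc (grid_pt a b p - grid_pt a b q).
  by apply: node_grid_sep c_gt0 _; exact: ltW.
pose A : mxseq R d := fun j => puncture_X L r rho (Xs j) (H j).
pose B : mxseq R d := fun j => puncture_H L r rho (Xs j) (H j).
have hA : hermseq A by move=> j; exact: herm_puncture_X.
have hB : hermseq B by move=> j; exact: herm_puncture_H.
have card : #|{: 'I_L * 'I_L}| = (L * L)%N by rewrite card_prod card_ord.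
have nA j : opnorm (A j - Xs j) <= r.
  by apply: le_trans (punctured_X_near rho_gt0 unitN j) _; rewrite card.
have nB j : opnorm (B j - H j) <= r.
  by apply: le_trans (punctured_H_near rho_gt0 unitN j) _; rewrite card.
have bA : bdd A := bdd_punctured_X bXs rho_gt0 unitN.
have bB : bdd B := bdd_punctured_H bH rho_gt0 unitN.
have cAB : GRing.comm (aclass A) (aclass B) :=
  punctured_comm hXs hH bXs bH cXs rho_gt0 rho_r sep unitN.
have punct (i l : 'I_L) F G : good d F -> good d G ->
    (forall y, F y != 0 -> `|y - node L r l| <= c) ->
    (forall y, G y != 0 -> `|y - node L r i| <= c) -> fc F B * fc G A = 0.
  exact: (punctured hXs hH bXs bH cXs rho_gt0 rho_r c_rho (ltW c_gt0) sep unitN (i := (i, l))).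
have bound4 (Z1 Z2 : mxseq R d) j : opnorm (Z1 j - Z2 j) <= r -> opnorm (Z2 j) <= 2 ->
    opnorm (Z1 j) <= L%:R * r / 2.
  move=> z1 z2; rewrite Lr; have -> : Z1 j = (Z1 j - Z2 j) + Z2 j by rewrite subrK.
  apply: le_trans (opnormD _ _) _; move: z1 z2; have := r_le1.
  by move: (opnorm _) (opnorm _) => x y; lra.
have nA4 j : opnorm (A j) <= L%:R * r / 2 := bound4 A Xs j (nA j) (nXs j).
have nB4 j : opnorm (B j) <= L%:R * r / 2.
  by apply: (bound4 B H j (nB j)); apply: le_trans (nH j) _; rewrite ler1n.
have [N1 hN1] := approx_X_near c_gt0 c_r hA hB bA bB cAB punct r_gt0 nA4.
have [N2 hN2] := approx_H_near c_gt0 c_r hA hB bA bB cAB punct r_gt0 nB4.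
exists (N1 + N2)%N; move: (N1 + N2)%N (hN1 _ (leq_addr N2 N1)) (hN2 _ (leq_addl N1 N2)) => j h1 h2.
exists (final_X L r rho c (u j) (X j) (H j)), (final_H L r rho c (u j) (X j) (H j)); split.
  split; [exact: herm_approx_X|exact: herm_approx_H|exact: approx_comm| |].
    have g : opnorm (final_X L r rho c (u j) (X j) (H j) - A j) <= 2 * r + r := h1.
    apply: le_trans (opnorm_triangle (opnorm_triangle g (nA j)) (le_trans (u_norm j) (u_r j))) _.
    by case: sum_r.
  have g : opnorm (final_H L r rho c (u j) (X j) (H j) - B j) <= r + r := h2.
  by apply: le_trans (opnorm_triangle g (nB j)) _; case: sum_r.
move=> s sX; have [n1 n2] := final_natural L r rho c (u j) s (hX j) (hH j).
have [f1 f2] := final_flip L r rho (u j) c_gt0 (hX j) (hH j).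
split=> sH; rewrite sX sH in n1 n2; first exact (conj n1 n2).
exact (conj (etrans n1 f1) (etrans n2 f2)).
Qed.

End Constants.
End AlongSequence.
End SymmetricApproximation.

(** * The modulus and the theorem *)

Section AlmostCommuting.
Variable R : realType.
Local Notation C := R[i].
Local Notation "x %:C" := (real_complex R x).

Lemma symmetric_approximation_le (e e' : R) m (X H : 'M[C]_m.+1) : e <= e' ->
  symmetric_approximation e X H -> symmetric_approximation e' X H.
Proof.
move=> ee [X2 [H2 [[h1 h2 h3 h4 h5] h6]]]; exists X2, H2; split=> //; split=> //.
  exact: le_trans ee.
exact: le_trans ee.
Qed.

Lemma some_symmetric_approximation (d : nat -> nat) (X H : mxseq R d) (e : R) :
  hermseq X -> hermseq H -> (forall j, opnorm (X j) <= 1) -> (forall j, opnorm (H j) <= 1) ->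
  null (fun j => X j *m H j - H j *m X j) -> 0 < e ->
  exists j, symmetric_approximation e (X j) (H j).
Proof.
move=> hX hH nX nH cXH e0.
(* L r = 8 makes the staircase cover [-4, 4], which contains the spectra of the
   punctured pair, whose norms are at most 3. *)
pose L := (Num.bound (40 / e) + 8)%N; pose r : R := 8 / L%:R.
have L8 : 8 <= L%:R :> R by rewrite ler_nat leq_addl.
have Le : 40 / e <= L%:R.
  apply: (@le_trans _ _ (Num.bound (40 / e))%:R); last by rewrite ler_nat leq_addr.
  by rewrite ltW // archi_boundP // divr_ge0 // ltW.
have L0 : 0 < L%:R :> R by apply: lt_le_trans L8; rewrite ltr0n.
have r0 : 0 < r by rewrite divr_gt0.
have r1 : r <= 1 by rewrite ler_pdivrMr // mul1r.
have Lr : L%:R * r = 8 by rewrite mulrCA mulfV ?mulr1 // gt_eqF.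
have re : 5 * r <= e.
  rewrite mulrA -natrM ler_pdivrMr // mulrC -ler_pdivrMr //.
move: L r L8 Le L0 r0 r1 Lr re => L r L8 Le L0 r0 r1 Lr re.
pose D : R := (L * L)%:R + 3.
have D3 : 3 <= D by rewrite lerDr.
have D0 : 0 < D by apply: lt_le_trans D3; rewrite ltr0n.
have rho0 : 0 < r / D by rewrite divr_gt0.
have rho_r : 2 * (r / D) < r by rewrite mulrCA gtr_pMr // ltr_pdivrMr // mul1r (lt_le_trans _ D3) // ltr_nat.
have rho_L : (L * L)%:R * (r / D) <= r.
  by rewrite mulrCA ler_piMr ?(ltW r0) // ler_pdivrMr // mul1r lerDl.
have c0 : 0 < r / D / 4 by rewrite divr_gt0.
have c_rho : 4 * (r / D / 4) <= r / D by rewrite mulrCA mulfV ?mulr1 // pnatr_eq0.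
have [j hj] := approximation_along hX hH nX nH cXH r0 r1 Lr rho0 rho_r rho_L c0 c_rho.
by exists j; exact: symmetric_approximation_le hj.
Qed.

Definition approximable (delta e : R) := forall m (X H : 'M[C]_m.+1), herm X -> herm H ->
  opnorm X <= 1 -> opnorm H <= 1 -> opnorm (mx_commutator X H) <= delta ->
  symmetric_approximation e X H.

(** Counterexamples for delta = 1/(k + 1) would form a sequence without any
    approximation, although its class is a commuting pair. *)
Lemma almost_commuting (e : R) : 0 < e -> exists2 delta, 0 < delta & approximable delta e.
Proof.
move=> e0; apply: contrapT => no.
pose pair := {m : nat & ('M[C]_m.+1 * 'M[C]_m.+1)%type}.
have bad (k : nat) : exists p : pair, let X := (projT2 p).1 in let H := (projT2 p).2 in
    [/\ herm X, herm H, opnorm X <= 1 & opnorm H <= 1] /\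
    (opnorm (mx_commutator X H) <= k.+1%:R^-1 /\ ~ symmetric_approximation e X H).
  apply: contrapT => nok; apply: no; exists k.+1%:R^-1; first by rewrite invr_gt0 ltr0n.
  move=> m X H hX hH nX nH cXH; apply: contrapT => nos; apply: nok.
  exists (existT _ m (X, H)); split; [exact (And4 hX hH nX nH)|exact (conj cXH nos)].
have [p hp] := choice bad.
pose X : mxseq R (fun k => projT1 (p k)) := fun k => (projT2 (p k)).1.
pose H : mxseq R (fun k => projT1 (p k)) := fun k => (projT2 (p k)).2.
have hX : hermseq X by move=> k; case: (hp k) => -[].
have hH : hermseq H by move=> k; case: (hp k) => -[].
have nX k : opnorm (X k) <= 1. by have [[_ _ h _] _] := hp k; exact h.
have nH k : opnorm (H k) <= 1. by have [[_ _ _ h] _] := hp k; exact h.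
have cXH : null (fun k => X k *m H k - H k *m X k).
  split=> t t0; exists (Num.bound t^-1) => k hk; have [_ [h _]] := hp k.
  apply: le_trans h _; rewrite -[leRHS]invrK lef_pV2 ?posrE ?invr_gt0 ?ltr0n //.
  apply: (@le_trans _ _ (Num.bound t^-1)%:R); last by rewrite ler_nat ltnW.
  by rewrite ltW // archi_boundP // invr_ge0 ltW.
have [k hk] := some_symmetric_approximation hX hH nX nH cXH e0.
by have [_ [_]] := hp k; apply.
Qed.

Lemma approximable1 (delta : R) : approximable delta 1.
Proof.
move=> m X H hX hH nX nH _; exists 0, 0.
have n0 (Z : 'M[C]_m.+1) : opnorm Z <= 1 -> opnorm (0 - Z) <= 1 by rewrite sub0r opnormN.
split; first exact (And5 (herm0 R m) (herm0 R m) erefl (n0 X nX) (n0 H nH)).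
move=> s _; split=> _; first exact (conj (ra0 s) (ra0 s)).
split; first exact (ra0 s).
by rewrite ra0 oppr0.
Qed.

Lemma approximable_le (delta delta' e e' : R) : delta' <= delta -> e <= e' ->
  approximable delta e -> approximable delta' e'.
Proof.
move=> dd ee h m X H hX hH nX nH cXH; apply: symmetric_approximation_le ee _.
by apply: h => //; exact: le_trans dd.
Qed.

Definition modulus_set (delta : R) : set R := [set e | 0 < e /\ approximable delta e].
(** Adding delta leaves room for an admissible value below; 1 is admissible for every
    delta by [approximable1]. *)
Definition modulus (delta : R) : R := if delta <= 0 then 1 else inf (modulus_set delta) + delta.

Lemma has_inf_modulus delta : has_inf (modulus_set delta).
Proof.
split; first by exists 1; split=> //; exact: approximable1.
by exists 0 => e [e0 _]; exact: ltW.
Qed.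

Lemma inf_modulus_ge0 delta : 0 <= inf (modulus_set delta).
Proof.
by apply: lb_le_inf; [exact: (has_inf_modulus delta).1|move=> e [e0 _]; exact: ltW].
Qed.

Lemma modulus_ge0 delta : 0 <= modulus delta.
Proof.
rewrite /modulus; case: ifP => [_|/negbT]; first exact: ler01.
by rewrite -ltNge => d0; rewrite addr_ge0 ?inf_modulus_ge0 // ltW.
Qed.

Lemma approximable_modulus delta : approximable delta (modulus delta).
Proof.
rewrite /modulus; case: ifP => [_|/negbT]; first exact: approximable1.
rewrite -ltNge => d0; have [e [e0 he] lt] := inf_adherent d0 (has_inf_modulus delta).
exact: approximable_le (lexx _) (ltW lt) he.
Qed.

Lemma modulus_cvg : modulus delta @[delta --> 0^'+] --> (0 : R).
Proof.
apply/cvgrPdist_le => e e0; have e2 : 0 < e / 2 by rewrite divr_gt0.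
have [delta0 d0 hd] := almost_commuting e2.
near=> delta; rewrite sub0r normrN ger0_norm ?modulus_ge0 //.
have dpos : 0 < delta by near: delta; exact: nbhs_right_gt.
have dlt : delta < Num.min delta0 (e / 2).
  by near: delta; apply: nbhs_right_lt; rewrite lt_min d0 e2.
move: dlt; rewrite lt_min => /andP[d1 d2].
have -> : modulus delta = inf (modulus_set delta) + delta by rewrite /modulus leNgt dpos.
have : inf (modulus_set delta) <= e / 2.
  apply: ge_inf; first exact: (has_inf_modulus delta).2.
  by split=> //; exact: approximable_le (ltW d1) (lexx _) hd.
by move=> h; lra.
Unshelve. all: by end_near. Qed.

End AlmostCommuting.

Section SizeZero.
Variables (R : realType) (X H : 'M[R[i]]_0).

Lemma approximants0 (e : R) : X \is hermsymmx -> H \is hermsymmx -> 0 <= e ->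
  commuting_approximants e X H X H.
Proof.
move=> hX hH e0; split=> //; try by rewrite subrr opnorm0.
by rewrite /comm_mx [LHS]flatmx0 [RHS]flatmx0.
Qed.

End SizeZero.

Theorem theorem1p9 (R : realType) :
  exists eps : R -> R,
    [/\ forall delta, 0 <= delta -> 0 <= eps delta,
        eps delta @[delta --> 0^'+] --> (0 : R)
      & forall (n : nat) (X H : 'M[R[i]]_n),
        X \is hermsymmx -> H \is hermsymmx ->
        contraction_mx X -> contraction_mx H ->
        let e := eps (opnorm (mx_commutator X H)) in
        (exists X2 H2 : 'M[R[i]]_n, commuting_approximants e X H X2 H2) /\
        forall (I J : Type) (W : I -> 'M[R[i]]_n)
               (T : J -> 'cV[R[i]]_n -> 'cV[R[i]]_n),
          symmetry_families W T ->
          families_commute_with W T X -> families_commute_with W T H ->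
          [/\ exists X2 H2 : 'M[R[i]]_n,
                [/\ commuting_approximants e X H X2 H2,
                    families_commute_with W T X2
                  & families_commute_with W T H2],
              forall C : 'cV[R[i]]_n -> 'cV[R[i]]_n,
                antiunitary C ->
                commutes_with_families_up_to_phase W T C ->
                commutes_with C X -> anticommutes_with C H ->
                exists X2 H2 : 'M[R[i]]_n,
                  [/\ commuting_approximants e X H X2 H2,
                      families_commute_with W T X2,
                      families_commute_with W T H2,
                      commutes_with C X2
                    & anticommutes_with C H2]
            & forall S : 'M[R[i]]_n,
                S \is unitarymx ->
                commutes_with_families_up_to_phase W T (mulmx S) ->
                commutes_with (mulmx S) X -> anticommutes_with (mulmx S) H ->
                exists X2 H2 : 'M[R[i]]_n,
                  [/\ commuting_approximants e X H X2 H2,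
                      families_commute_with W T X2,
                      families_commute_with W T H2,
                      commutes_with (mulmx S) X2
                    & anticommutes_with (mulmx S) H2]]].
Proof.
exists (@modulus R); split=> [delta _||]; [exact: modulus_ge0|exact: modulus_cvg|].
case=> [|m] X H hX hH cX cH e.
  have ap := approximants0 hX hH (modulus_ge0 (opnorm (mx_commutator X H))).
  split; first by exists X, H.
  move=> I J W T _ WX WH; split; first by exists X, H.
    by move=> C _ _ CX CH; exists X, H.
  by move=> S _ _ SX SH; exists X, H.
have /hermsymmxP hX' := hX; have /hermsymmxP hH' := hH.
have [X2 [H2 [[hX2 hH2 cXH nX nH] nat]]] :=
  approximable_modulus hX' hH' cX cH (lexx (opnorm (mx_commutator X H))).
have ap : commuting_approximants e X H X2 H2.
  by split; [exact/hermsymmxP|exact/hermsymmxP|exact cXH|exact nX|exact nH].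
have even U (s : real_automorphism R m) : (forall A, (s A = A <-> commutes_with U A) /\
    (s A = - A <-> anticommutes_with U A)) ->
  commutes_with U X -> commutes_with U H -> commutes_with U X2 /\ commutes_with U H2.
  move=> hs /(hs X).1 sX /(hs H).1 sH; have [/(_ sH)[e1 e2] _] := nat s sX.
  by split; [apply/(hs X2).1|apply/(hs H2).1].
have odd U (s : real_automorphism R m) : (forall A, (s A = A <-> commutes_with U A) /\
    (s A = - A <-> anticommutes_with U A)) ->
  commutes_with U X -> anticommutes_with U H -> commutes_with U X2 /\ anticommutes_with U H2.
  move=> hs /(hs X).1 sX /(hs H).2 sH; have [_ /(_ sH)[e1 e2]] := nat s sX.
  by split; [apply/(hs X2).1|apply/(hs H2).2].
split; first by exists X2, H2.
move=> I J W T [uW uT _ _] [WX TX] [WH TH].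
have evenW a : commutes_with (mulmx (W a)) X2 /\ commutes_with (mulmx (W a)) H2.
  by have [s hs] := unitary_automorphism (uW a); exact: even hs (WX a) (WH a).
have evenT b : commutes_with (T b) X2 /\ commutes_with (T b) H2.
  by have [s hs] := antiunitary_automorphism (uT b); exact: even hs (TX b) (TH b).
have fX : families_commute_with W T X2.
  by split=> [a|b]; [case: (evenW a)|case: (evenT b)].
have fH : families_commute_with W T H2.
  by split=> [a|b]; [case: (evenW a)|case: (evenT b)].
split; first by exists X2, H2.
  move=> C uC _ CX CH; have [s hs] := antiunitary_automorphism uC.
  by have [c1 c2] := odd C s hs CX CH; exists X2, H2.
move=> S uS _ SX SH; have [s hs] := unitary_automorphism uS.
by have [c1 c2] := odd (mulmx S) s hs SX SH; exists X2, H2.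
Qed.
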